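(* Let $d_0 \geq 2$ and let $\mathcal{T}_{[d_0]}$ be the rooted tree in which every vertex has exactly $d_0-1$ offspring (so every non-root vertex has $d_0$ neighbours). If $d_0 \geq 1287$ then $\big[ d_0^{-1} + 3 d_0^{-2}, \infty\big) \subseteq \mathscr{T}^{\mathcal{T}_{[d_0]}}$. Moreover, for any $\epsilon > 0$ there exists $d_0' \in \mathbb{N}$ such that if $d_0 \geq d_0'$ then $\big[ d_0^{-1} + (\tfrac{13}{6} + \epsilon) d_0^{-2}, \infty\big) \subseteq \mathscr{T}^{\mathcal{T}_{[d_0]}}$.
   Context: For a graph $G$, $\mathscr{T}^G$ denotes the set of $T>0$ such that the random stirring model on $G$ with parameter $T$ has infinite cycles (cycles with infinitely many elements) almost surely. The random stirring model with parameter $T$ is the random permutation $\sigma_T$ of $V(G)$, where $(\sigma_t)_{t\ge0}$ starts at the identity and, independently for each edge $e$, the transposition of the endpoints of $e$ is composed at each point of a rate-one Poisson process on $[0,\infty)$. *)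

(* Defs.v *)
From HB Require Import structures.
From mathcomp Require Import all_boot all_order all_algebra.
From mathcomp Require Import all_classical all_reals all_analysis.
Set Implicit Arguments. Unset Strict Implicit. Unset Printing Implicit Defensive.
Import Order.TTheory GRing.Theory Num.Theory.
Local Open Scope classical_set_scope.
Local Open Scope ring_scope.

(* The rooted tree T_[d0]: every vertex has exactly d0-1 offspring.         *)
(* A vertex is a finite word over the alphabet 'I_(d0-1); the root is [::]  *)
(* and the children of v are the words i :: v.                             *)
Definition tvert (d0 : nat) : Type := seq 'I_(d0.-1).

Definition tadj (d0 : nat) (u v : tvert d0) : bool :=
  ((v != [::]) && (behead v == u)) || ((u != [::]) && (behead u == v)).

(* Edges are indexed by their child endpoint (a non-empty word):           *)
(* the edge indexed by w (w != [::]) joins w and its parent  behead w.      *)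
Definition tedge_of (d0 : nat) (u v : tvert d0) : tvert d0 :=
  if (size u < size v)%N then v else u.

Definition tincident (d0 : nat) (v w : tvert d0) : bool :=
  (w != [::]) && ((w == v) || (behead w == v)).

Section Stirring.
Context {R : realType} (d0 : nat) {dO : measure_display} {Omega : measurableType dO}.

(* N e w t : number of rings of the clock of edge e in [0, t] (outcome w). *)
Definition rings_at (N : tvert d0 -> Omega -> R -> nat) (e : tvert d0)
    (om : Omega) (t : R) : Prop :=
  0 < t /\ forall s, 0 <= s -> s < t -> (N e om s < N e om t)%N.

Definition poisson_clocks (P : probability Omega R)
    (N : tvert d0 -> Omega -> R -> nat) : Prop :=
  (forall e om, N e om 0 = 0%N) /\
  (forall e om s t, 0 <= s -> s <= t -> (N e om s <= N e om t)%N) /\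
  (forall e om t, 0 <= t -> exists2 delta : R, 0 < delta &
       forall s, t <= s -> s < t + delta -> N e om s = N e om t) /\
  (forall e t, measurable_fun setT (fun om => (N e om t)%:R : R)) /\
  (* finite-dimensional distributions: increments over disjoint intervals *)
  (* (across all edges) are independent and Poisson(length) distributed.  *)
  (forall (s : seq (tvert d0 * R * R * nat)),
     (forall k, (k < size s)%N ->
        let: (e, a, b, _) := nth ([::], 0, 0, 0%N) s k in
        e != [::] /\ 0 <= a /\ a < b) ->
     (forall k l, (k < size s)%N -> (l < size s)%N -> k <> l ->
        let: (e1, a1, b1, _) := nth ([::], 0, 0, 0%N) s k in
        let: (e2, a2, b2, _) := nth ([::], 0, 0, 0%N) s l in
        e1 = e2 -> b1 <= a2 \/ b2 <= a1) ->
     P [set om | forall k, (k < size s)%N ->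
        let: (e, a, b, n) := nth ([::], 0, 0, 0%N) s k in
        (N e om b - N e om a)%N = n]
     = (\prod_(q <- s) (poisson_pmf (q.1.2 - q.1.1.2) q.2)%:E)%E).

(* stir_rel N om T x y : following the stirring dynamics up to time T, the  *)
(* element starting at vertex x is at vertex y at time T, i.e. there are    *)
(* successive jumps x = v_0 -> v_1 -> ... -> v_k = y at times               *)
(* 0 < t_1 < ... < t_k <= T, the jump at t_i across the ring of the edge    *)
(* {v_(i-1), v_i}, with no ring of an edge incident to v_(i-1) strictly     *)
(* between t_(i-1) and t_i, and no ring incident to y in (t_k, T].          *)
Definition stir_rel (N : tvert d0 -> Omega -> R -> nat) (om : Omega) (T : R)
    (x y : tvert d0) : Prop :=
  exists (vs : seq (tvert d0)) (ts : seq R),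
    size vs = size ts /\
    last x vs = y /\
    (forall i, (i < size ts)%N -> nth 0 (0 :: ts) i < nth 0 (0 :: ts) i.+1) /\
    last 0 ts <= T /\
    (forall i, (i < size vs)%N ->
       let u := nth x (x :: vs) i in
       let v := nth x (x :: vs) i.+1 in
       let a := nth 0 (0 :: ts) i in
       let b := nth 0 (0 :: ts) i.+1 in
       tadj u v /\ rings_at N (tedge_of u v) om b /\
       forall w, tincident u w ->
         forall s, a < s -> s < b -> N w om s = N w om a) /\
    (forall w, tincident y w -> N w om T = N w om (last 0 ts)).

Definition stirring_infinite_cycle (N : tvert d0 -> Omega -> R -> nat)
    (om : Omega) (T : R) : Prop :=
  exists sigma : tvert d0 -> tvert d0,
    bijective sigma /\
    (forall x y, stir_rel N om T x y <-> sigma x = y) /\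
    exists x, ~ finite_set
      [set y | exists n : nat, iter n sigma x = y \/ iter n sigma y = x].

End Stirring.

Definition in_scrT {R : realType} (d0 : nat) (T : R) : Prop :=
  0 < T /\
  forall (dO : measure_display) (Omega : measurableType dO)
         (P : probability Omega R) (N : tvert d0 -> Omega -> R -> nat),
    poisson_clocks P N ->
    {ae P, forall om, stirring_infinite_cycle N om T}.

(* Main.v *)
From mathcomp Require Import all_boot all_order all_algebra.
From mathcomp Require Import all_classical all_reals all_analysis.
From mathcomp Require Import measurable_realfun lra zify ring.
Require Import Defs.
Set Implicit Arguments. Unset Strict Implicit. Unset Printing Implicit Defensive.
Import Order.TTheory GRing.Theory Num.Theory.
Import numFieldNormedType.Exports.
Local Open Scope classical_set_scope.
Local Open Scope ring_scope.

(** The walk of a particle is followed along the poles [{v} x [0, T)] of the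
    tree, a bar joining two poles wherever an edge rings; an orbit of the
    permutation is finite iff the walk closes up.  Time is cut into [M] cells and
    the tree at level [n], so that the bars become finitely many independent
    bits, and a lower bound for the probability that the walk reaches level [n],
    uniform in [n] and in large [M], is wanted.  Write [d] for the number of
    offspring.

    If [d T < 20], a child joined to its parent by a single bar is certainly
    visited by a closed walk unless the bars of a sibling straddle that bar.  The
    mean of the resulting branching process tends to [d T e^-T (1 - d T^2 / 6)] as
    [M] grows, and this exceeds [1] above the threshold.

    If [d T >= 20], let [rho] bound the probability that the walk leaves a
    subtree it has just entered, in the presence of independent bars on the edge
    above.  The first bar met almost always leads to some child [w]; if the walk
    comes back from [w] (probability at most [rho]), then following the walk
    that only [w] would generate one almost always meets a bar to a second,
    untouched child, from which the walk comes back with probability at most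
    [rho] again.  The inequality [rho' <= small + rho (small + rho)] keeps [rho]
    below [1 / 5] for all [n].

    Since the subtrees of distinct vertices of a level are independent, one of
    them almost surely carries an infinite cycle.  The permutation itself is well
    defined because the expected number of chains of [k] successive rings issued
    from a vertex is at most [((d + 1) T)^k / k!]. *)

(** * The walk on a finite tree in discrete time *)

Section PoleWalk.
Variables (M : nat) (I : finType).
Implicit Types (B : pred 'I_M) (bars : I -> pred 'I_M).
Implicit Types (returns : I -> 'I_M -> 'I_M -> Prop).

(* [pole_walk B bars returns i b]: the walk that is at the root at the beginning
   of cell [i] meets the bars [B] of the parent edge for the first time in cell
   [b], where [returns w i' j] says that it returns from its excursion into child
   [w], begun in cell [i'], through cell [j].  A cell with bars to several
   children blocks the walk. *)
Inductive pole_walk B bars returns : 'I_M -> 'I_M -> Prop :=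
| pole_walk_exit i : B i -> pole_walk B bars returns i i
| pole_walk_pass i b : ~~ B i -> (forall w, ~~ bars w i) ->
    pole_walk B bars returns (ordS i) b -> pole_walk B bars returns i b
| pole_walk_child i w j b : ~~ B i -> bars w i ->
    (forall w', w' != w -> ~~ bars w' i) -> returns w (ordS i) j ->
    pole_walk B bars returns (ordS j) b -> pole_walk B bars returns i b.

Lemma pole_walk_bar B bars returns i b : pole_walk B bars returns i b -> B b.
Proof. by elim. Qed.

Lemma pole_walk_mono B B' bars returns i b : {subset B <= B'} ->
  pole_walk B bars returns i b -> exists b', pole_walk B' bars returns i b'.
Proof.
move=> BB'; elim=> {i b}.
- by move=> i Bi; exists i; apply: pole_walk_exit; apply: BB'.
- move=> i b _ clear_i _ [b' IH].
  case: (boolP (B' i)) => B'i; first by exists i; apply: pole_walk_exit.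
  by exists b'; apply: pole_walk_pass.
- move=> i w j b _ wi others_clear wj _ [b' IH].
  case: (boolP (B' i)) => B'i; first by exists i; apply: pole_walk_exit.
  by exists b'; apply: (pole_walk_child (w := w) (j := j)).
Qed.

Lemma pole_walk_functional B bars returns i b b' :
  (forall w i j j', returns w i j -> returns w i j' -> j = j') ->
  pole_walk B bars returns i b -> pole_walk B bars returns i b' -> b = b'.
Proof.
move=> returns_fun walk; elim: walk b' => {i b}.
- by move=> i Bi b' walk; case: walk Bi => // [k c /negbTE-> //|k w j c /negbTE-> //].
- move=> i b nBi clear_i _ IH b' walk; case: walk nBi clear_i IH.
  + by move=> k ->.
  + by move=> k c _ _ walk _ _; apply.
  + by move=> k w j c _ wk _ _ _ _ /(_ w); rewrite wk.
- move=> i w j b nBi wi others_clear wj _ IH b' walk.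
  case: walk nBi wi others_clear wj IH.
  + by move=> k ->.
  + by move=> k c _ /(_ w) /negbTE->.
  + move=> k w' j' c _ w'k _ w'j' walk _ wk others_clear wj IH.
    have ew : w' = w by apply/eqP/negPn/negP => /others_clear; rewrite w'k.
    by rewrite ew in w'j'; apply: IH; rewrite (returns_fun _ _ _ _ wj w'j').
Qed.

Lemma pole_walk_first_bar B bars returns r b : pole_walk B bars returns r b ->
  exists t, let c := iter t (@ordS M) r in
  (forall s, (s < t)%N -> ~~ B (iter s (@ordS M) r) /\
     forall w, ~~ bars w (iter s (@ordS M) r)) /\
  (B c \/ exists w, [/\ ~~ B c, bars w c, forall w', w' != w -> ~~ bars w' c &
     exists j, returns w (ordS c) j]).
Proof.
elim=> {r b}.
- by move=> i Bi; exists 0%N; split=> //; left.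
- move=> i b nBi clear_i _ [t [clear_t at_t]].
  exists t.+1; rewrite iterSr; split=> // -[|s] //.
  by rewrite ltnS iterSr; apply: clear_t.
- move=> i w j b nBi wi others_clear wj _ _.
  by exists 0%N; split=> //; right; exists w; split=> //; exists j.
Qed.

End PoleWalk.

Section OnlyChildWalk.
Variable M : nat.
Implicit Types (B : pred 'I_M) (ret : 'I_M -> 'I_M -> Prop).

(* One step of the walk on the pole of the root when it has a single child, with
   bars [B], to which the walk returns according to [ret]; an excursion without
   return is skipped. *)
Definition only_child_step B ret c : 'I_M :=
  ordS (xget c [set j | B c /\ ret (ordS c) j]).

Lemma only_child_step_no_bar B ret c : ~~ B c -> only_child_step B ret c = ordS c.
Proof. by move=> /negbTE nBc; rewrite /only_child_step xgetPN // => j [] /=; rewrite nBc. Qed.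

Lemma only_child_step_return B ret c j : B c -> ret (ordS c) j ->
  (forall j', ret (ordS c) j' -> j' = j) -> only_child_step B ret c = ordS j.
Proof.
move=> Bc cj j_uniq; rewrite /only_child_step (@xget_unique _ _ _ j) //.
by move=> j' [_ /j_uniq].
Qed.

Lemma only_child_step_pred B ret c c' : (forall i j, ret i j -> B j) ->
  only_child_step B ret c = c' -> ~~ B (ord_pred c') -> c = ord_pred c'.
Proof.
move=> ret_bar <-; rewrite /only_child_step ordSK.
by case: xgetP => // j _ [_ /ret_bar ->].
Qed.

Lemma pole_walk_only_child (I : finType) B (bars : I -> pred 'I_M) returns w r b :
  (forall i j j', returns w i j -> returns w i j' -> j = j') ->
  pole_walk B bars returns r b ->
  let walk s := iter s (only_child_step (bars w) (returns w)) r in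
  exists t, (forall s, (s < t)%N -> ~~ B (walk s) /\
      forall w', w' != w -> ~~ bars w' (walk s)) /\
    (B (walk t) \/ exists w', [/\ w' != w, bars w' (walk t) &
       exists j, returns w' (ordS (walk t)) j]).
Proof.
move=> returns_fun; elim=> {r b} /=.
- by move=> i Bi; exists 0%N; split=> //; left.
- move=> i b nBi clear_i _ [t [clear_t at_t]].
  have step_i := only_child_step_no_bar (returns w) (clear_i w).
  exists t.+1; rewrite iterSr step_i; split=> // -[|s] //=.
  by rewrite ltnS -iterS iterSr step_i; apply: clear_t.
- move=> i w' j b nBi w'i others_clear w'j _ [t [clear_t at_t]].
  have [ew|w'w] := eqVneq w' w; last first.
    by exists 0%N; split=> //; right; exists w'; split=> //; exists j.
  rewrite {w'}ew in w'i others_clear w'j.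
  have step_i : only_child_step (bars w) (returns w) i = ordS j.
    by apply: only_child_step_return => // j' w'j'; apply: returns_fun w'j.
  exists t.+1; rewrite iterSr step_i; split=> // -[|s] //=.
  by rewrite ltnS -iterS iterSr step_i; apply: clear_t.
Qed.

End OnlyChildWalk.

Section BarredTree.
Variables (M d : nat).

Definition edge_bars : finType := {ffun 'I_M -> bool}.

Fixpoint tree_bars n : finType :=
  if n is n'.+1 then {ffun 'I_d -> (edge_bars * tree_bars n')%type} else unit.

Definition branch n : finType := (edge_bars * tree_bars n)%type.

(* Reaching level [n] counts as not coming back: [exits_at] is empty for [n = 0]. *)
Fixpoint exits_at n : tree_bars n -> pred 'I_M -> 'I_M -> 'I_M -> Prop :=
  match n with
  | 0 => fun _ _ _ _ => False
  | n'.+1 => fun (c : tree_bars n'.+1) B =>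
      pole_walk B (fun j => (c j).1) (fun j => exits_at (c j).2 (c j).1)
  end.

Lemma exits_at_bar n (c : tree_bars n) B i b : exits_at c B i b -> B b.
Proof. by case: n c => // n c; apply: pole_walk_bar. Qed.

Lemma exits_at_functional n (c : tree_bars n) B i b b' :
  exits_at c B i b -> exits_at c B i b' -> b = b'.
Proof.
elim: n c B i b b' => // n IH c B i b b'; apply: pole_walk_functional => w k j j'.
exact: IH.
Qed.

Lemma exits_at_mono n (c : tree_bars n) (B B' : pred 'I_M) i b : {subset B <= B'} ->
  exits_at c B i b -> exists b', exits_at c B' i b'.
Proof. by case: n c => // n c; apply: pole_walk_mono. Qed.

(* The walk that enters the branch through a bar of its edge in cell [i0] leaves
   it again, through that bar or another one. *)
Definition exits n (y : branch n) (i0 : 'I_M) : bool :=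
  `[< exists b, exits_at y.2 [pred i | y.1 i || (i == i0)] (ordS i0) b >].

Definition no_bars : edge_bars := [ffun=> false].

Lemma exits_mono n (c : tree_bars n) (B B' : edge_bars) i0 :
  (forall i, i != i0 -> B i -> B' i) -> exits (B, c) i0 -> exits (B', c) i0.
Proof.
move=> BB' /asboolP [b out]; apply/asboolP; apply: exits_at_mono out => i; rewrite !inE /=.
by case: eqVneq => [->|ni]; rewrite ?orbT ?orbF // => /BB' ->.
Qed.

Lemma exits_at_exits n (y : branch n) i0 b :
  y.1 i0 -> exits_at y.2 y.1 (ordS i0) b -> exits y i0.
Proof.
move=> yi0 out; apply/asboolP; apply: exits_at_mono out => i; rewrite !inE /in_mem /= => ->.
by [].
Qed.

Lemma exits_level0 (y : branch 0) i0 : exits y i0 = false.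
Proof. by apply/asboolP => -[b []]. Qed.

End BarredTree.

Arguments no_bars {M}.

(** * Finite probability *)

Section Expectation.
Variable R : realFieldType.

Definition is_distr (X : finType) (u : X -> R) :=
  (forall x, 0 <= u x) /\ \sum_x u x = 1.

Definition expect (X : finType) (u f : X -> R) : R := \sum_x u x * f x.

Definition Pr (X : finType) (u : X -> R) (A : pred X) : R :=
  expect u (fun x => (A x)%:R).

Section ExpectationTheory.
Variables (X : finType) (u : X -> R).

Lemma eq_expect f g : f =1 g -> expect u f = expect u g.
Proof. by move=> fg; apply: eq_bigr => x _; rewrite fg. Qed.

Lemma eq_Pr (A B : pred X) : A =1 B -> Pr u A = Pr u B.
Proof. by move=> AB; apply: eq_expect => x; rewrite AB. Qed.

Lemma expectZl c f : expect u (fun x => c * f x) = c * expect u f.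
Proof. by rewrite /expect mulr_sumr; apply: eq_bigr => x _; rewrite mulrCA. Qed.

Lemma expectZr c f : expect u (fun x => f x * c) = expect u f * c.
Proof. by rewrite /expect mulr_suml; apply: eq_bigr => x _; rewrite mulrA. Qed.

Lemma expectD f g : expect u (fun x => f x + g x) = expect u f + expect u g.
Proof. by rewrite /expect -big_split; apply: eq_bigr => x _; rewrite mulrDr. Qed.

Lemma expectB f g : expect u (fun x => f x - g x) = expect u f - expect u g.
Proof. by rewrite /expect -sumrB; apply: eq_bigr => x _; rewrite mulrBr. Qed.

Lemma expect_sum (J : Type) (r : seq J) (P : pred J) F :
  expect u (fun x => \sum_(j <- r | P j) F j x) = \sum_(j <- r | P j) expect u (F j).
Proof. by rewrite /expect exchange_big; apply: eq_bigr => x _; rewrite mulr_sumr. Qed.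

Lemma Pr0 : Pr u pred0 = 0.
Proof. by rewrite /Pr /expect big1 // => x _; rewrite mulr0. Qed.

Hypothesis u_distr : is_distr u.

Lemma expect_cst c : expect u (fun=> c) = c.
Proof. by rewrite /expect -mulr_suml u_distr.2 mul1r. Qed.

Lemma le_expect f g : (forall x, f x <= g x) -> expect u f <= expect u g.
Proof. by move=> fg; apply: ler_sum => x _; apply: ler_wpM2l => //; apply: u_distr.1. Qed.

Lemma expect_ge0 f : (forall x, 0 <= f x) -> 0 <= expect u f.
Proof. by move=> f0; apply: sumr_ge0 => x _; apply: mulr_ge0 => //; apply: u_distr.1. Qed.

Lemma Pr_ge0 (A : pred X) : 0 <= Pr u A.
Proof. by apply: expect_ge0 => x; apply: ler0n. Qed.

Lemma le_Pr (A B : pred X) : (forall x, A x -> B x) -> Pr u A <= Pr u B.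
Proof. by move=> AB; apply: le_expect => x; rewrite ler_nat; case: (A x) (AB x) => // ->. Qed.

Lemma PrT : Pr u predT = 1.
Proof. exact: expect_cst. Qed.

Lemma Pr_le1 (A : pred X) : Pr u A <= 1.
Proof. by rewrite -PrT; apply: le_Pr. Qed.

Lemma PrC (A : pred X) : Pr u (predC A) = 1 - Pr u A.
Proof.
rewrite -PrT -expectB; apply: eq_expect => x /=.
by case: (A x); rewrite ?subrr ?subr0.
Qed.

Lemma Pr_union_le (J : eqType) (r : seq J) (A : pred X) (B : J -> pred X) :
  (forall x, A x -> exists2 j, j \in r & B j x) -> Pr u A <= \sum_(j <- r) Pr u (B j).
Proof.
move=> AB; rewrite -expect_sum; apply: le_expect => x.
case: (boolP (A x)) => [/AB [j jr Bj]|_]; last by apply: sumr_ge0.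
by rewrite (big_rem j) //= Bj lerDl; apply: sumr_ge0.
Qed.

Lemma Pr_union_le_cst (J : eqType) (r : seq J) (A : pred X) (B : J -> pred X) c :
  (forall x, A x -> exists2 j, j \in r & B j x) -> (forall j, j \in r -> Pr u (B j) <= c) ->
  Pr u A <= (size r)%:R * c.
Proof.
move=> AB B_le; apply: le_trans (Pr_union_le AB) _; rewrite big_seq.
apply: le_trans (ler_sum _ B_le) _.
by rewrite -big_seq big_const_seq count_predT iter_addr_0 mulr_natl.
Qed.

Lemma Pr_exists_in_le (J : finType) (Q : pred J) (B : J -> pred X) :
  Pr u (fun x => [exists (j | Q j), B j x]) <= \sum_(j | Q j) Pr u (B j).
Proof.
apply: le_trans (Pr_union_le (r := enum Q) (B := B) _) _; last by rewrite big_enum.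
by move=> x /exists_inP [j Qj Bj]; exists j; rewrite // mem_enum.
Qed.

Lemma Pr_exists_le (J : finType) (B : J -> pred X) :
  Pr u (fun x => [exists j, B j x]) <= \sum_j Pr u (B j).
Proof. exact: (Pr_exists_in_le xpredT). Qed.

Lemma Pr_or_le (A B C : pred X) :
  (forall x, A x -> B x || C x) -> Pr u A <= Pr u B + Pr u C.
Proof.
move=> ABC; rewrite -expectD; apply: le_expect => x; rewrite -natrD ler_nat.
by case: (A x) (ABC x) => // /(_ isT); case: (B x) => //= ->.
Qed.

Lemma Pr_andl_le (b : bool) (A : pred X) c : 0 <= c -> (b -> Pr u A <= c) ->
  Pr u (fun x => b && A x) <= c.
Proof. by move=> c0; case: b => [/(_ isT)|_] //=; rewrite Pr0. Qed.

End ExpectationTheory.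

Section ProductDistr.

Definition pair_distr (X Y : finType) (u : X -> R) (v : Y -> R) : X * Y -> R :=
  fun z => u z.1 * v z.2.

Lemma expect_pair (X Y : finType) (u : X -> R) (v : Y -> R) f :
  expect (pair_distr u v) f = expect u (fun x => expect v (fun y => f (x, y))).
Proof.
rewrite /expect /pair_distr (eq_bigr (fun x => \sum_y u x * v y * f (x, y))).
  by rewrite pair_bigA; apply: eq_bigr => -[].
by move=> x _; rewrite mulr_sumr; apply: eq_bigr => y _; rewrite mulrA.
Qed.

Lemma Pr_pair (X Y : finType) (u : X -> R) (v : Y -> R) (A : pred X) (B : pred Y) :
  Pr (pair_distr u v) (fun z => A z.1 && B z.2) = Pr u A * Pr v B.
Proof.
rewrite /Pr expect_pair -expectZr; apply: eq_expect => x; rewrite -expectZl.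
by apply: eq_expect => y /=; rewrite -natrM mulnb.
Qed.

Lemma pair_is_distr (X Y : finType) (u : X -> R) (v : Y -> R) :
  is_distr u -> is_distr v -> is_distr (pair_distr u v).
Proof.
move=> u_distr v_distr; split=> [z|].
  by apply: mulr_ge0; [apply: u_distr.1|apply: v_distr.1].
transitivity (expect (pair_distr u v) (fun=> 1)).
  by apply: eq_bigr => z _; rewrite mulr1.
by rewrite expect_pair; under eq_expect do rewrite expect_cst //; rewrite expect_cst.
Qed.

Variables (I X : finType) (u : X -> R).

Definition ffun_distr : {ffun I -> X} -> R := fun f => \prod_i u (f i).

Lemma expect_prod (F : I -> X -> R) :
  expect ffun_distr (fun f => \prod_i F i (f i)) = \prod_i expect u (F i).
Proof. by rewrite [RHS]bigA_distr_bigA; apply: eq_bigr => f _; rewrite -big_split. Qed.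

Lemma Pr_forall (A : I -> pred X) :
  Pr ffun_distr (fun f => [forall i, A i (f i)]) = \prod_i Pr u (A i).
Proof.
rewrite -expect_prod; apply: eq_expect => f.
case: (boolP [forall i, A i (f i)]) => [/forallP Af|/forallPn [i /negbTE nAf]].
  by rewrite big1 // => i _; rewrite Af.
by rewrite (bigD1 i) //= nAf mul0r.
Qed.

Hypothesis u_distr : is_distr u.

Lemma ffun_is_distr : is_distr ffun_distr.
Proof.
split=> [f|]; first by apply: prodr_ge0 => i _; apply: u_distr.1.
transitivity (Pr ffun_distr (fun=> [forall i : I, predT i])); last first.
  by rewrite (Pr_forall (fun=> predT)) big1 // => i _; apply: PrT.
by apply: eq_bigr => f _; rewrite (introT forallP) ?mulr1.
Qed.

Definition fupd (f : {ffun I -> X}) i x : {ffun I -> X} :=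
  [ffun j => if j == i then x else f j].

Lemma fupd_eq f i x : fupd f i x i = x. Proof. by rewrite ffunE eqxx. Qed.

Lemma fupd_neq f i x j : j != i -> fupd f i x j = f j.
Proof. by rewrite ffunE => /negbTE->. Qed.

Lemma fupd_fupd f i x y : fupd (fupd f i x) i y = fupd f i y.
Proof. by apply/ffunP => j; rewrite !ffunE; case: eqP. Qed.

Lemma fupd_same f i : fupd f i (f i) = f.
Proof. by apply/ffunP => j; rewrite ffunE; case: eqP => [->|]. Qed.

Lemma ffun_distr_fupd f i x : ffun_distr (fupd f i x) * u (f i) = ffun_distr f * u x.
Proof.
rewrite /ffun_distr [X in X * _](bigD1 i) //= [X in _ = X * _](bigD1 i) //= fupd_eq.
rewrite mulrC [RHS]mulrC mulrCA; congr (_ * (_ * _)).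
by apply: eq_bigr => j /fupd_neq->.
Qed.

(* Exchanging [x] with the [i]-th coordinate of [f] preserves the law of the pair. *)
Lemma expect_resample i (F : {ffun I -> X} -> R) :
  expect ffun_distr F = expect u (fun x => expect ffun_distr (fun f => F (fupd f i x))).
Proof.
pose swap (z : X * {ffun I -> X}) := (z.2 i, fupd z.2 i z.1).
have swapK : involutive swap by move=> [x f]; rewrite /swap /= fupd_eq fupd_fupd fupd_same.
rewrite -(expect_pair u ffun_distr (fun z => F (swap z).2)).
transitivity (expect (pair_distr u ffun_distr) (fun z => F z.2)).
  by rewrite expect_pair /= expect_cst.
rewrite /expect [RHS](reindex_inj (inv_inj swapK)); apply: eq_bigr => -[x f] _.
rewrite swapK; congr (_ * _).
by rewrite /pair_distr /= mulrC -(ffun_distr_fupd f i) mulrC.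
Qed.

Lemma expect_at i x (F : {ffun I -> X} -> R) :
  expect ffun_distr (fun f => (f i == x)%:R * F f) =
  u x * expect ffun_distr (fun f => F (fupd f i x)).
Proof.
rewrite (expect_resample i) [LHS](bigD1 x) //= big1 => [|y /negbTE yx]; last first.
  by rewrite /expect big1 ?mulr0 // => f _; rewrite fupd_eq yx mul0r mulr0.
by rewrite addr0; congr (_ * _); apply: eq_expect => f; rewrite fupd_eq eqxx mul1r.
Qed.

Lemma expect_coord i (F : X -> R) : expect ffun_distr (fun f => F (f i)) = expect u F.
Proof.
rewrite (expect_resample i); apply: eq_expect => x.
by under eq_expect do rewrite fupd_eq; rewrite expect_cst //; apply: ffun_is_distr.
Qed.

Lemma expect_mul_coords i j (F G : X -> R) : j != i ->
  expect ffun_distr (fun f => F (f i) * G (f j)) = expect u F * expect u G.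
Proof.
move=> ji; rewrite (expect_resample i) -expectZr; apply: eq_expect => x.
rewrite -(expect_coord j) -expectZl; apply: eq_expect => f.
by rewrite fupd_eq fupd_neq.
Qed.

End ProductDistr.

Section BernoulliFfun.
Variables (I : finType) (p : R).
Hypothesis p01 : 0 <= p <= 1.

Definition bits_distr : {ffun I -> bool} -> R := ffun_distr (bernoulli_pmf p).

Lemma bernoulli_is_distr : is_distr (bernoulli_pmf p).
Proof.
split=> [b|]; first exact: bernoulli_pmf_ge0.
by rewrite big_bool /bernoulli_pmf /= addrC subrK.
Qed.

Lemma bits_is_distr : is_distr bits_distr.
Proof. exact/ffun_is_distr/bernoulli_is_distr. Qed.

Lemma Pr_bit k : Pr bits_distr (fun b => b k) = p.
Proof.
rewrite /Pr (expect_coord bernoulli_is_distr k (fun x => x%:R)) /expect big_bool /=.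
by rewrite mulr1 mulr0 addr0.
Qed.

Lemma Pr_single_bit k :
  Pr bits_distr (pred1 [ffun i => i == k]) = (1 - p) ^+ #|I|.-1 * p.
Proof.
rewrite /Pr /expect (bigD1 [ffun i => i == k]) //= eqxx mulr1 big1 ?addr0; last first.
  by move=> b /negbTE->; rewrite mulr0.
rewrite /bits_distr /ffun_distr (bigD1 k) //= ffunE eqxx mulrC; congr (_ * _).
rewrite (eq_bigr (fun=> 1 - p)) => [|i /negbTE ik]; last by rewrite ffunE ik.
by rewrite prodr_const cardC1.
Qed.

Lemma has_fupd (l : seq I) (b : {ffun I -> bool}) k x : k \notin l ->
  has (fupd b k x) l = has b l.
Proof.
by move=> kl; apply: eq_in_has => i il; rewrite fupd_neq //; apply: contraNneq kl => <-.
Qed.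

Lemma expect_bit_le k x (h : {ffun I -> bool} -> R) : (forall b, h (fupd b k x) <= h b) ->
  expect bits_distr (fun b => (b k == x)%:R * h b) <=
  bernoulli_pmf p x * expect bits_distr h.
Proof.
move=> h_le; rewrite (expect_at bernoulli_is_distr); apply: ler_wpM2l.
  exact: bernoulli_pmf_ge0.
exact: le_expect bits_is_distr _ _ h_le.
Qed.

Lemma expect_none_le l (h : {ffun I -> bool} -> R) : uniq l ->
  (forall k b, k \in l -> h (fupd b k false) <= h b) ->
  expect bits_distr (fun b => (~~ has b l)%:R * h b) <=
  (1 - p) ^+ size l * expect bits_distr h.
Proof.
elim: l h => [|k l IH] h /=; first by rewrite expr0 mul1r; under eq_expect do rewrite mul1r.
case/andP=> kl ul h_le.
have -> : expect bits_distr (fun b => (~~ has b (k :: l))%:R * h b) =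
   expect bits_distr (fun b => (b k == false)%:R * ((~~ has b l)%:R * h b)).
  by apply: eq_expect => b; rewrite /= eqbF_neg mulrA -natrM mulnb negb_or.
apply: le_trans (expect_bit_le _) _.
  by move=> b; rewrite has_fupd //; apply: ler_wpM2l => //; apply/h_le/mem_head.
rewrite exprS -mulrA; apply: ler_wpM2l; first exact: (bernoulli_pmf_ge0 false).
by apply: IH => // i b il; apply: h_le; rewrite in_cons il orbT.
Qed.

Lemma Pr_none l : uniq l -> Pr bits_distr (fun b => ~~ has b l) = (1 - p) ^+ size l.
Proof.
elim: l => [|k l IH] /=; first by rewrite expr0 -(PrT bits_is_distr).
case/andP=> kl ul; rewrite exprS -(IH ul).
have -> : Pr bits_distr (fun b => ~~ (b k || has b l)) =
    expect bits_distr (fun b => (b k == false)%:R * (~~ has b l)%:R).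
  by apply: eq_expect => b; rewrite /= eqbF_neg -natrM mulnb negb_or.
rewrite (expect_at bernoulli_is_distr); congr (_ * _).
by apply: eq_expect => b; rewrite has_fupd.
Qed.

Lemma expect_first_le l c (h : {ffun I -> bool} -> R) : uniq (c :: l) ->
  (forall k b, k \in l -> h (fupd b k false) <= h b) ->
  (forall b, h (fupd b c true) <= h b) ->
  expect bits_distr (fun b => (~~ has b l && b c)%:R * h b) <=
  (1 - p) ^+ size l * p * expect bits_distr h.
Proof.
case/andP=> cl ul h_le_none h_le_c.
have -> : expect bits_distr (fun b => (~~ has b l && b c)%:R * h b) =
   expect bits_distr (fun b => (b c == true)%:R * ((~~ has b l)%:R * h b)).
  by apply: eq_expect => b; rewrite eqb_id andbC mulrA -natrM mulnb.
apply: le_trans (expect_bit_le _) _.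
  by move=> b; rewrite has_fupd //; apply: ler_wpM2l.
rewrite [_ * p]mulrC -mulrA; apply: ler_wpM2l; first by case/andP: p01.
exact: expect_none_le.
Qed.

Lemma Pr_first_le l c : uniq (c :: l) ->
  Pr bits_distr (fun b => ~~ has b l && b c) <= (1 - p) ^+ size l * p.
Proof.
move=> ul; have := expect_first_le (h := fun=> 1) ul.
rewrite (expect_cst bits_is_distr) mulr1.
move=> /(_ (fun _ _ _ => lexx _) (fun _ => lexx _)); apply: le_trans.
by apply: (le_expect bits_is_distr) => b; rewrite mulr1.
Qed.

Lemma Pr_first_and_bit_le l c c' : uniq (c :: l) -> c' \notin l -> c' != c ->
  Pr bits_distr (fun b => [&& ~~ has b l, b c & b c']) <= (1 - p) ^+ size l * p * p.
Proof.
move=> ul c'l c'c; rewrite -[X in _ * X](Pr_bit c').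
apply: le_trans (expect_first_le ul _ _).
- by apply: (le_expect bits_is_distr) => b; rewrite -natrM mulnb andbA.
- by move=> k b kl; rewrite fupd_neq //; apply: contraNneq c'l => ->.
- by move=> b; rewrite fupd_neq.
Qed.

Lemma Pr_two_bits_le k k' : k' != k -> Pr bits_distr (fun b => b k && b k') <= p * p.
Proof. by move=> kk'; have := @Pr_first_and_bit_le [::] k k' isT isT kk'; rewrite mul1r. Qed.

End BernoulliFfun.

End Expectation.

Section TreeDistr.
Variables (R : realFieldType) (M d : nat) (p : R).
Hypothesis p01 : 0 <= p <= 1.

Fixpoint tree_distr n : tree_bars M d n -> R :=
  match n with
  | 0 => fun=> 1
  | n'.+1 => ffun_distr (pair_distr (bits_distr p) (@tree_distr n'))
  end.

Definition branch_distr n : branch M d n -> R := pair_distr (bits_distr p) (@tree_distr n).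

Lemma tree_is_distr n : is_distr (@tree_distr n).
Proof.
elim: n => [|n IH]; first by split=> //; rewrite (big_pred1 tt) // => -[].
exact/ffun_is_distr/pair_is_distr/IH/bits_is_distr.
Qed.

Lemma branch_is_distr n : is_distr (@branch_distr n).
Proof. exact: pair_is_distr (bits_is_distr _ p01) (tree_is_distr n). Qed.

Lemma Pr_edge n (A : pred (edge_bars M)) :
  Pr (@branch_distr n) (fun y => A y.1) = Pr (bits_distr p) A.
Proof.
by rewrite /Pr expect_pair; apply: eq_expect => b /=; rewrite expect_cst //; apply: tree_is_distr.
Qed.

Lemma Pr_edge_none n l : uniq l ->
  Pr (@branch_distr n) (fun y => ~~ has y.1 l) = (1 - p) ^+ size l.
Proof. by move=> ul; rewrite (Pr_edge n (fun b => ~~ has b l)) Pr_none. Qed.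

Lemma Pr_root_children n (A : pred (edge_bars M)) (P : pred 'I_d)
    (B : 'I_d -> pred (branch M d n)) :
  Pr (@branch_distr n.+1) (fun z => A z.1 && [forall (j | P j), B j (z.2 j)]) =
  Pr (bits_distr p) A * \prod_(j | P j) Pr (@branch_distr n) (B j).
Proof.
rewrite (Pr_pair _ _ A (fun f : tree_bars M d n.+1 => [forall (j | P j), B j (f j)])).
rewrite (Pr_forall _ (fun j y => P j ==> B j y)) [in RHS]big_mkcond; congr (_ * _).
apply: eq_bigr => j _; case: (P j) => //=; exact/PrT/branch_is_distr.
Qed.

Definition replace_child n (z : branch M d n.+1) w (y : branch M d n) : branch M d n.+1 :=
  (z.1, fupd z.2 w y).

Lemma expect_resample_child n w (F : branch M d n.+1 -> R) :
  expect (@branch_distr n.+1) F = expect (@branch_distr n) (fun y =>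
    expect (@branch_distr n.+1) (fun z => F (replace_child z w y))).
Proof.
rewrite expect_pair; under eq_expect => b do
  rewrite (expect_resample (branch_is_distr n) w (fun f => F (b, f))).
rewrite /expect; under eq_bigr do rewrite mulr_sumr.
rewrite exchange_big; apply: eq_bigr => y _.
rewrite -/(expect _ _) expect_pair /= mulr_sumr.
by apply: eq_bigr => b _; rewrite mulrCA.
Qed.

(* Conditioning on where the bars of the edge to a child are first met can only
   help the walk to survive: bars are removed, except the one it enters through. *)
Lemma Pr_first_exits_le n l c rho : uniq (c :: l) ->
  Pr (@branch_distr n) (fun y => exits y c) <= rho ->
  Pr (@branch_distr n) (fun y => [&& ~~ has y.1 l, y.1 c & exits y c]) <=
  (1 - p) ^+ size l * p * rho.
Proof.
move=> ul rho_bound; pose h b := Pr (@tree_distr n) (fun t => exits (b, t) c).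
have tree_distrP := tree_is_distr n.
apply: (@le_trans _ _ ((1 - p) ^+ size l * p * expect (bits_distr p) h)); last first.
  apply: ler_wpM2l; last by move: rho_bound; rewrite /Pr expect_pair.
  by case/andP: p01 => p0 p1; apply: mulr_ge0 => //; rewrite exprn_ge0 ?subr_ge0.
apply: le_trans (expect_first_le p01 ul _ _).
- rewrite /Pr expect_pair; apply: (le_expect (bits_is_distr _ p01)) => b /=; rewrite -expectZl.
  by apply: (le_expect tree_distrP) => t /=; rewrite -natrM mulnb andbA.
- move=> k b kl; apply: (le_Pr tree_distrP) => t; apply: exits_mono => i _.
  by rewrite ffunE; case: eqP.
- move=> b; apply: (le_Pr tree_distrP) => t; apply: exits_mono => i ic.
  by rewrite ffunE (negbTE ic).
Qed.

End TreeDistr.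

(** * The regime of large [T] *)

Section CyclicCells.
Variable M : nat.
Implicit Types i r : 'I_M.

Lemma val_iter_ordS s i : iter s (@ordS M) i = ((i + s) %% M)%N :> nat.
Proof.
elim: s => [|s IH]; first by rewrite addn0 modn_small.
by rewrite iterS [LHS]/= IH -addn1 modnDml addn1 addnS.
Qed.

Lemma iter_ordS_inj i s t : (s < M)%N -> (t < M)%N ->
  iter s (@ordS M) i = iter t (@ordS M) i -> s = t.
Proof.
move=> sM tM /(congr1 val) /eqP; rewrite /= !val_iter_ordS eqn_modDl !modn_small //.
by move/eqP.
Qed.

Lemma iter_ordS_period i : iter M.-1 (@ordS M) (ordS i) = i.
Proof.
rewrite -iterSr prednK; last by apply: leq_ltn_trans (ltn_ord i).
by apply: val_inj; rewrite [LHS]val_iter_ordS modnDr modn_small.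
Qed.

Lemma uniq_traject_ordS r k : (k <= M)%N -> uniq (traject (@ordS M) r k).
Proof.
case: k => // k kM; rewrite looping_uniq; apply/trajectP => -[s sk /iter_ordS_inj]; lia.
Qed.

Lemma uniq_iter_traject_ordS r k : (k < M)%N ->
  uniq (iter k (@ordS M) r :: traject (@ordS M) r k).
Proof. by move=> kM; rewrite /= -rcons_uniq -trajectSr; apply: uniq_traject_ordS. Qed.

Lemma iter_ord_predK s i : iter s (@ordS M) (iter s (@ord_pred M) i) = i.
Proof. by elim: s => // s IH; rewrite iterSr iterS ord_predK IH. Qed.

Lemma iter_ordS_in_traject_ord_pred i k L : (k < M.-1)%N ->
  iter k (@ordS M) (ordS i) \in traject (@ord_pred M) (ord_pred i) L -> (M.-1 <= k + L)%N.
Proof.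
move=> kM /trajectP [s sL]; rewrite -[RHS]iterSr => e; rewrite leqNgt; apply/negP => kL.
have := congr1 (iter s.+1 (@ordS M)) e; rewrite iter_ord_predK -iterD.
rewrite -{2}(iter_ordS_period i) => /iter_ordS_inj; lia.
Qed.

End CyclicCells.

Lemma uniq_traject_first_hit (T : eqType) (f : T -> T) x (hit : pred T) t :
  hit (iter t f x) -> (forall s, (s < t)%N -> ~~ hit (iter s f x)) ->
  uniq (traject f x t.+1).
Proof.
move=> hit_t no_hit; rewrite looping_uniq; apply/trajectP => -[s st e].
by move: (no_hit s st); rewrite -e hit_t.
Qed.

Section FirstChildVisited.
Variables (M d n : nat) (i0 : 'I_M).
Implicit Types (y : branch M d n) (z : branch M d n.+1) (w j : 'I_d) (l : seq 'I_M).
Let r := ordS i0.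
Local Notation cell k := (iter k (@ordS M) r).
Local Notation cells k := (traject (@ordS M) r k).

Definition child_step y : 'I_M -> 'I_M := only_child_step y.1 (exits_at y.2 y.1).
Definition child_walk y t : 'I_M := iter t (child_step y) r.
Definition visited y t : seq 'I_M := traject (child_step y) r t.

Definition clear_but w l z :=
  ~~ has z.1 l && [forall (j | j != w), ~~ has (z.2 j).1 l].

Definition escapes w c z := z.1 c || [exists (j | j != w), (z.2 j).1 c && exits (z.2 j) c].

Lemma clear_butP w l z : reflect
  (forall c, c \in l -> ~~ z.1 c /\ forall j, j != w -> ~~ (z.2 j).1 c) (clear_but w l z).
Proof.
apply: (iffP andP) => [[/hasPn nz /forall_inP nj] c cl|H].
  by split=> [|j jw]; [apply: nz|move/hasPn: (nj j jw); apply].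
split; first by apply/hasPn => c /H [].
by apply/forall_inP => j jw; apply/hasPn => c /H [_]; apply.
Qed.

Lemma clear_but_take w k l z : clear_but w l z -> clear_but w (take k l) z.
Proof. by move/clear_butP => H; apply/clear_butP => c /mem_take /H. Qed.

Lemma child_walk_no_bar y k s : ~~ has y.1 (cells k) -> (s <= k)%N -> child_walk y s = cell s.
Proof.
move=> /hasPn no_bar; elim: s => // s IH sk; rewrite /child_walk !iterS -/(child_walk y s).
rewrite (IH (ltnW sk)); apply/only_child_step_no_bar/no_bar/trajectP.
by exists s.
Qed.

Lemma child_walk_back y t L : child_walk y t = i0 ->
  ~~ has y.1 (traject (@ord_pred M) (ord_pred i0) L) ->
  forall s, (s <= L)%N -> (s <= t)%N -> child_walk y (t - s) = iter s (@ord_pred M) i0.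
Proof.
move=> at_t /hasPn no_bar; elim=> [|s IH] sL st; first by rewrite subn0.
rewrite iterS; apply: (only_child_step_pred (B := y.1) (ret := exits_at y.2 y.1)).
- exact: exits_at_bar.
- by rewrite -(IH (ltnW sL) (ltnW st)) -(subnSK st).
- by rewrite -iterS iterSr; apply/no_bar/trajectP; exists s.
Qed.

Lemma exits_child_walk w z : exits z i0 -> exists t,
  [/\ (t < M)%N, uniq (visited (z.2 w) t.+1), clear_but w (visited (z.2 w) t) z &
   child_walk (z.2 w) t = i0 \/ escapes w (child_walk (z.2 w) t) z].
Proof.
move=> /asboolP [b walk].
have [|t [clear_t at_t]] := pole_walk_only_child (w := w) _ walk.
  by move=> ? ? ?; apply: exits_at_functional.
rewrite -/(child_step _) in clear_t at_t.
pose hit c := [|| z.1 c, c == i0 | [exists (j | j != w), (z.2 j).1 c]].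
have no_hit s : (s < t)%N -> ~~ hit (child_walk (z.2 w) s).
  move=> /clear_t [/= ns nsj]; rewrite /hit orbA negb_or ns negb_exists.
  by apply/forallP => j; rewrite negb_and -implybE; apply/implyP/nsj.
have hit_t : hit (child_walk (z.2 w) t).
  rewrite /hit orbA; apply/orP; case: at_t => [|[j [jw jt _]]]; first by left.
  by right; apply/existsP; exists j; rewrite jw.
have uniq_visited := uniq_traject_first_hit hit_t no_hit.
exists t; split=> //.
- rewrite -(size_traject (child_step (z.2 w)) r t.+1) -(card_uniqP uniq_visited).
  by rewrite -[X in (_ <= X)%N](card_ord M) max_card.
- apply/clear_butP => c /trajectP [s st ->]; have [/= ns nsj] := clear_t s st.
  by split=> //; case/norP: ns.
- case: at_t => [/orP [zt|/eqP]|[j [jw jt [k out]]]]; [right|by left|right].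
    by rewrite /escapes zt.
  apply/orP; right; apply/existsP; exists j; rewrite jw jt /=.
  exact: exits_at_exits jt out.
Qed.

(* [parent_first], [no_child_bar] and [return_first] tell what the walk that
   enters through cell [i0] meets first.  After a return from [w], the parent edge
   and the other children have no bar along the walk generated by [w], up to an
   escape or up to [L] cells after the bar to [w], unless [w] has another bar among
   the [L] cells that precede [i0]. *)
Definition parent_first k z :=
  [&& ~~ has z.1 (cells k), z.1 (cell k) & [forall j, ~~ has (z.2 j).1 (cells k)]].
Definition no_child_bar z := [forall j, ~~ has (z.2 j).1 (cells M.-1)].
Definition return_first k y := [&& ~~ has y.1 (cells k), y.1 (cell k) & exits y (cell k)].
Definition late_bar L y := has y.1 (traject (@ord_pred M) (ord_pred i0) L).
Definition escapes_at w y t z :=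
  uniq (visited y t.+1) && (clear_but w (visited y t) z && escapes w (child_walk y t) z).
Definition after_return L w k y z :=
  [|| late_bar L y && clear_but w (cells k) z,
      uniq (visited y (k + L).+1) && clear_but w (visited y (k + L).+1) z |
      [exists (t : 'I_M | (k < t)%N), escapes_at w y t z]].

Lemma return_first_after_return L w k z : (k < M.-1)%N -> exits z i0 ->
  return_first k (z.2 w) -> clear_but w (cells k.+1) z -> after_return L w k (z.2 w) z.
Proof.
move=> kM out /and3P [no_bar_w wk _] clear_k.
have [t [tM uniq_t clear_t at_t]] := exits_child_walk w out.
have kt : (k < t)%N.
  rewrite ltnNge; apply/negP => tk; rewrite (child_walk_no_bar no_bar_w tk) in at_t.
  have /clear_butP/(_ (cell t)) [|nzt njt] := clear_k.
    by apply/trajectP; exists t.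
  case: at_t => [|/orP [|/exists_inP [j /njt /negbTE->]] //]; last by rewrite (negbTE nzt).
  rewrite -[RHS](iter_ordS_period i0) => /iter_ordS_inj; lia.
have [late|no_late] := boolP (late_bar L (z.2 w)).
  by apply/or3P; constructor 1; have := clear_but_take k clear_k; rewrite take_traject // late.
apply/or3P; case: at_t => [at_i0|escape]; last first.
  constructor 3; apply/existsP; exists (Ordinal tM).
  by rewrite /escapes_at kt uniq_t clear_t escape.
have kLt : (k + L < t)%N.
  rewrite ltnNge; apply/negP => tkL.
  have e : cell k = iter (t - k) (@ord_pred M) i0.
    rewrite -(child_walk_no_bar no_bar_w (leqnn k)).
    by rewrite -(child_walk_back at_i0 no_late (s := t - k)) ?subKn //; lia.
  case/hasP: no_late; exists (cell k) => //; rewrite e; apply/trajectP.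
  by exists (t - k).-1; [lia|rewrite -iterSr prednK ?subn_gt0].
constructor 2; apply/andP; split.
  by have := take_uniq (k + L).+1 uniq_t; rewrite take_traject // ltnS ltnW.
by have := clear_but_take (k + L).+1 clear_t; rewrite take_traject.
Qed.

Lemma exits_cases L z : exits z i0 ->
  [\/ exists2 k, (k < M.-1)%N & parent_first k z,
      no_child_bar z |
      exists w k, [/\ (k < M.-1)%N, return_first k (z.2 w) & after_return L w k (z.2 w) z]].
Proof.
move=> out; have [b walk] := asboolP _ out.
have [t [clear_t at_t]] := pole_walk_first_bar walk.
have no_bar k : (k <= t)%N ->
    ~~ has z.1 (cells k) /\ forall j, ~~ has (z.2 j).1 (cells k).
  move=> kt; split=> [|j]; apply/hasPn => c /trajectP [s sk ->];
    have [|/norP [ns _] nsj] := clear_t s; [lia|exact: ns|lia|exact: nsj].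
have tM : (t <= M.-1)%N.
  rewrite leqNgt; apply/negP => /clear_t [].
  by rewrite iter_ordS_period /= eqxx orbT.
have [et|ntM] := eqVneq t M.-1.
  by constructor 2; apply/forallP => j; have [_] := no_bar t (leqnn t); rewrite et.
have {}tM : (t < M.-1)%N by rewrite ltn_neqAle ntM.
have [no_bar_z no_bar_j] := no_bar t (leqnn t).
have t_i0 : (cell t == i0) = false.
  by apply/eqP; rewrite -[RHS](iter_ordS_period i0) => /iter_ordS_inj; lia.
case: at_t => [/=|[w [/norP [nzt _] wt nwt [k ret]]]].
  rewrite t_i0 orbF => zt; constructor 1; exists t => //.
  by rewrite /parent_first no_bar_z zt; apply/forallP.
constructor 3; exists w, t.
have return_t : return_first t (z.2 w).
  by rewrite /return_first no_bar_j wt; apply: exits_at_exits ret.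
split=> //; apply: return_first_after_return => //; apply/clear_butP => c.
rewrite trajectSr mem_rcons in_cons => /predU1P [->|ct]; first by [].
by split=> [|j _]; [exact: (hasPn no_bar_z)|exact: (hasPn (no_bar_j j))].
Qed.

End FirstChildVisited.

Lemma sum_expr_tail_le (R : realFieldType) (x : R) k N : 0 <= x <= 1 ->
  \sum_(t < N | (k < t)%N) x ^+ t <= x ^+ k * \sum_(t < N) x ^+ t.
Proof.
case/andP=> x0 x1; have pow_ge0 t : 0 <= x ^+ t by apply: exprn_ge0.
elim: k N => [|k IH] N.
  rewrite expr0 mul1r [leRHS](bigID (fun t : 'I_N => (0 < t)%N)) /= lerDl.
  exact: sumr_ge0.
case: N => [|N]; first by rewrite !big_ord0 mulr0.
rewrite big_mkcond big_ord_recl /= add0r.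
under eq_bigr => t _ do rewrite /bump /= add1n ltnS exprS.
rewrite -big_mkcond -mulr_sumr exprS -mulrA; apply: ler_wpM2l => //.
apply: le_trans (IH N) _; apply: ler_wpM2l => //.
by rewrite big_ord_recr lerDl.
Qed.

Section ReturnProbability.
Variables (R : realFieldType) (M d n : nat) (p : R).
Hypothesis p01 : 0 <= p <= 1.
Let q := 1 - p.
Local Notation branch := (branch M d).
Local Notation law := (@branch_distr R M d p).
Implicit Types (y : branch n) (z : branch n.+1) (w : 'I_d).

Let p_ge0 : 0 <= p. Proof. by case/andP: p01. Qed.
Let q01 : 0 <= q <= 1. Proof. by case/andP: p01 => p0 p1; rewrite /q subr_ge0 p1 lerBlDr lerDl. Qed.
Let qX_ge0 k : 0 <= q ^+ k. Proof. by rewrite exprn_ge0 //; case/andP: q01. Qed.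
Let law_distr m : is_distr (@law m). Proof. exact: branch_is_distr. Qed.

Lemma Pr_clear_but w l : uniq l -> Pr (@law n.+1) (clear_but w l) = q ^+ (d * size l).
Proof.
move=> ul; rewrite (Pr_root_children p01 (fun b => ~~ has b l) _
  (fun=> fun y : branch n => ~~ has y.1 l)) (Pr_none p01 ul).
under eq_bigr do rewrite (Pr_edge_none d p01 n ul).
rewrite prodr_const cardC1 card_ord -exprM -exprD; congr (_ ^+ _).
by rewrite mulnC -mulSn prednK //; apply: leq_ltn_trans (ltn_ord w).
Qed.

Lemma Pr_clear_but_parent w l c : uniq (c :: l) ->
  Pr (@law n.+1) (fun z => clear_but w l z && z.1 c) <= q ^+ (d * size l) * p.
Proof.
move=> ucl; have /andP [_ ul] := ucl.
rewrite -(Pr_clear_but w ul) (Pr_root_children p01 (fun b => ~~ has b l) _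
  (fun=> fun y : branch n => ~~ has y.1 l)) (Pr_none p01 ul).
under eq_Pr => z do rewrite /clear_but andbAC.
rewrite (Pr_root_children p01 (fun b => ~~ has b l && b c) _
  (fun=> fun y : branch n => ~~ has y.1 l)) mulrAC.
apply: ler_wpM2r; last exact: Pr_first_le.
by apply: prodr_ge0 => j _; apply: Pr_ge0.
Qed.

Variable rho : R.
Hypothesis exits_le : forall c, Pr (@law n) (fun y => exits y c) <= rho.

Lemma Pr_clear_but_return w j l c : j != w -> uniq (c :: l) ->
  Pr (@law n.+1) (fun z => clear_but w l z && ((z.2 j).1 c && exits (z.2 j) c)) <=
  q ^+ (d * size l) * (p * rho).
Proof.
move=> jw ucl; have /andP [_ ul] := ucl.
rewrite -(Pr_clear_but w ul) (Pr_root_children p01 (fun b => ~~ has b l) _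
  (fun=> fun y : branch n => ~~ has y.1 l)).
pose A i (y : branch n) := ~~ has y.1 l && ((i == j) ==> (y.1 c && exits y c)).
have -> : Pr (@law n.+1) (fun z => clear_but w l z && ((z.2 j).1 c && exits (z.2 j) c)) =
    Pr (@law n.+1) (fun z => ~~ has z.1 l && [forall (i | i != w), A i (z.2 i)]).
  apply: eq_Pr => z; rewrite /clear_but -andbA; congr (_ && _).
  apply/andP/forall_inP => [[/forall_inP none_i ret_j] i iw|A_i].
    by rewrite /A none_i //=; apply/implyP => /eqP->.
  split; first by apply/forall_inP => i /A_i /andP[].
  by have /andP[_] := A_i j jw; rewrite eqxx.
rewrite (Pr_root_children p01 (fun b => ~~ has b l)) -mulrA.
apply: ler_wpM2l; first exact: Pr_ge0 (bits_is_distr _ p01) _.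
rewrite (bigD1 j) //= [X in _ <= X * _](bigD1 j) //= mulrAC.
rewrite (eq_bigr (fun=> Pr (@law n) (fun y => ~~ has y.1 l))) => [|i /andP[_ /negbTE ij]].
  apply: ler_wpM2r; first by apply: prodr_ge0 => i _; apply: Pr_ge0.
  rewrite (Pr_edge_none d p01 n ul) mulrA.
  under eq_Pr do rewrite /A eqxx /=.
  exact: Pr_first_exits_le.
by apply: eq_Pr => y; rewrite /A ij andbT.
Qed.

Hypothesis rho_ge0 : 0 <= rho.

Lemma Pr_clear_but_escapes w l c : uniq (c :: l) ->
  Pr (@law n.+1) (fun z => clear_but w l z && escapes w c z) <=
  q ^+ (d * size l) * (p * (1 + d.-1%:R * rho)).
Proof.
move=> ucl; pose esc j z := clear_but w l z && ((z.2 j).1 c && exits (z.2 j) c).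
have escP z : clear_but w l z && escapes w c z ->
    (clear_but w l z && z.1 c) || [exists (j | j != w), esc j z].
  case/andP=> cl /orP [zc|/exists_inP [j jw out]]; first by rewrite cl zc.
  by apply/orP; right; apply/exists_inP; exists j; rewrite // /esc cl.
apply: le_trans (Pr_or_le (law_distr _) escP) _.
rewrite mulrDr mulr1 mulrDr; apply: lerD; first exact: Pr_clear_but_parent.
apply: le_trans (Pr_exists_in_le (law_distr _) _ esc) _.
apply: (@le_trans _ _ (\sum_(j | j != w) q ^+ (d * size l) * (p * rho))).
  by apply: ler_sum => j jw; apply: Pr_clear_but_return.
by rewrite sumr_const cardC1 card_ord -[leLHS]mulr_natl; lra.
Qed.

Variables (i0 : 'I_M) (L : nat).
Let r := ordS i0.

Lemma Pr_return_first k : (k < M)%N -> Pr (@law n) (return_first i0 k) <= q ^+ k * p * rho.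
Proof.
move=> kM; have := Pr_first_exits_le p01 (uniq_iter_traject_ordS r kM) (exits_le _).
by rewrite size_traject.
Qed.

Lemma Pr_return_first_late k : (k < M.-1)%N ->
  Pr (@law n) (fun y => return_first i0 k y && late_bar i0 L y) <=
  q ^+ k * p * ((M.-1 <= k + L)%N%:R + L%:R * p).
Proof.
move=> kM; have kM' : (k < M)%N by lia.
set cells := traject (@ordS M) r k; set c := iter k (@ordS M) r.
have uniq_cells : uniq (c :: cells) := uniq_iter_traject_ordS r kM'.
have qp_ge0 : 0 <= q ^+ k * p by apply: mulr_ge0.
have [kL|kL] := boolP (M.-1 <= k + L)%N.
  apply: (@le_trans _ _ (q ^+ k * p)).
    have := Pr_first_le p01 uniq_cells; rewrite size_traject; apply: le_trans.
    rewrite -(Pr_edge d p01 n (fun b => ~~ has b cells && b c)).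
    by apply: (le_Pr (law_distr n)) => y /andP[/and3P[-> -> _] _].
  by rewrite ler_peMr // -[leLHS]addr0 lerD2l mulr_ge0.
rewrite add0r mulrCA -[X in X%:R * _](size_traject (@ord_pred M) (ord_pred i0) L).
pose late := traject (@ord_pred M) (ord_pred i0) L.
pose meets c' (b : edge_bars M) := [&& ~~ has b cells, b c & b c'].
apply: (Pr_union_le_cst (law_distr n) (r := late) (B := fun c' y => meets c' y.1)) => [|c'].
  move=> y /andP[/and3P[none_y yc _] /hasP [c' late_c' yc']].
  by exists c'; rewrite // /meets none_y yc yc'.
rewrite -/late => late_c'; rewrite (Pr_edge d p01 n (meets c')).
have c'c : c' != c.
  apply: contraNneq kL => e; apply: (iter_ordS_in_traject_ord_pred kM (i := i0)).
  by rewrite -/r -/c -e.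
have [c'_cells|c'_cells] := boolP (c' \in cells); last first.
  by have := Pr_first_and_bit_le p01 uniq_cells c'_cells c'c; rewrite size_traject.
rewrite (eq_Pr _ (B := pred0)) ?Pr0 ?mulr_ge0 // => b; apply/negP => /and3P[/hasPn none_b _].
by apply/negP/none_b.
Qed.

Definition after_return_bound : R :=
  (1 - p) ^+ (d * L) + (\sum_(t < M) (1 - p) ^+ (d * t)) * p * (1 + d.-1%:R * rho).

Lemma after_return_bound_ge0 : 0 <= after_return_bound.
Proof.
have escape_ge0 : 0 <= 1 + d.-1%:R * rho by apply: addr_ge0 => //; apply: mulr_ge0.
by rewrite addr_ge0 ?qX_ge0 // !mulr_ge0 // sumr_ge0.
Qed.

Lemma Pr_escapes_at w y t :
  Pr (@law n.+1) (escapes_at i0 w y t) <= q ^+ (d * t) * (p * (1 + d.-1%:R * rho)).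
Proof.
apply: Pr_andl_le => [|uniq_t].
  by rewrite !mulr_ge0 // addr_ge0 // mulr_ge0.
rewrite -[X in (d * X)%N](size_traject (child_step y) r t).
by apply: Pr_clear_but_escapes; rewrite /= -rcons_uniq -trajectSr.
Qed.

Lemma Pr_after_return w k y : (k < M.-1)%N ->
  Pr (@law n.+1) (after_return i0 L w k y) <= q ^+ (d * k) * ((late_bar i0 L y)%:R + after_return_bound).
Proof.
move=> kM; rewrite mulrDr /after_return_bound -/q mulrDr; case/andP: q01 => q_ge0 q_le1.
apply: le_trans (Pr_or_le (law_distr _) (fun _ => id)) _; apply: lerD.
  case: (late_bar i0 L y); rewrite ?mulr1 ?mulr0 /=; last by rewrite Pr0.
  rewrite Pr_clear_but ?size_traject //; apply: uniq_traject_ordS; lia.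
apply: le_trans (Pr_or_le (law_distr _) (fun _ => id)) _; apply: lerD.
  rewrite -exprD -mulnDr; apply: Pr_andl_le => // uniq_visited.
  by rewrite Pr_clear_but // size_traject ler_wiXn2l // leq_mul2l leqnSn orbT.
apply: le_trans (Pr_exists_in_le (law_distr _) _ (fun t : 'I_M => escapes_at i0 w y t)) _.
set e := 1 + _.
apply: (@le_trans _ _ (\sum_(t < M | (k < t)%N) q ^+ d ^+ t * (p * e))).
  by apply: ler_sum => t _; rewrite -exprM; apply: Pr_escapes_at.
rewrite -mulr_suml -!mulrA [leRHS]mulrA; apply: ler_wpM2r.
  by rewrite mulr_ge0 // addr_ge0 // mulr_ge0.
under [X in _ <= _ * X]eq_bigr do rewrite exprM.
rewrite exprM; apply: sum_expr_tail_le.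
by rewrite qX_ge0 exprn_ile1.
Qed.

Lemma after_return_replace w k y z :
  after_return i0 L w k y (replace_child z w y) = after_return i0 L w k y z.
Proof.
have clearE l : clear_but w l (replace_child z w y) = clear_but w l z.
  by congr (_ && _); apply: eq_forallb => j; case: eqVneq => //= jw; rewrite fupd_neq.
have escapesE c : escapes w c (replace_child z w y) = escapes w c z.
  by congr (_ || _); apply: eq_existsb => j; case: eqVneq => //= jw; rewrite fupd_neq.
rewrite /after_return /escapes_at !clearE.
by under eq_existsb do rewrite clearE escapesE.
Qed.

Lemma Pr_return_first_after_return w k : (k < M.-1)%N ->
  Pr (@law n.+1) (fun z => return_first i0 k (z.2 w) && after_return i0 L w k (z.2 w) z) <=
  q ^+ (d.+1 * k) * p * ((M.-1 <= k + L)%N%:R + L%:R * p + rho * after_return_bound).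
Proof.
move=> kM; have kM' : (k < M)%N by lia.
apply: (@le_trans _ _ (q ^+ (d * k) *
    (Pr (@law n) (fun y => return_first i0 k y && late_bar i0 L y) +
     Pr (@law n) (return_first i0 k) * after_return_bound))); last first.
  set late := (_ <= _)%N%:R + _; set after := after_return_bound.
  have -> : q ^+ (d.+1 * k) * p * (late + rho * after) =
      q ^+ (d * k) * (q ^+ k * p * late + q ^+ k * p * rho * after).
    by rewrite mulSn exprD; ring.
  apply: ler_wpM2l => //; apply: lerD; first exact: Pr_return_first_late.
  by apply: ler_wpM2r; [apply: after_return_bound_ge0|apply: Pr_return_first].
rewrite /Pr (expect_resample_child p01 w) -expectZr -expectD -expectZl.
apply: (le_expect (law_distr n)) => y.
have replaced z : (replace_child z w y).2 w = y by apply: fupd_eq.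
under eq_expect => z do rewrite replaced after_return_replace.
case: (return_first i0 k y) => /=; last first.
  by rewrite mul0r addr0 mulr0 -(Pr0 (@law n.+1)).
by rewrite mul1r; apply: Pr_after_return.
Qed.

Lemma Pr_parent_first k : (k < M.-1)%N ->
  Pr (@law n.+1) (parent_first i0 k) <= q ^+ (d.+1 * k) * p.
Proof.
move=> kM; have kM' : (k < M)%N by lia.
pose cells := traject (@ordS M) r k.
under eq_Pr => z do rewrite /parent_first andbA.
rewrite (Pr_root_children p01 (fun b => ~~ has b cells && b (iter k (@ordS M) r)) predT
  (fun=> fun y : branch n => ~~ has y.1 cells)).
under eq_bigr do rewrite (Pr_edge_none d p01 n (uniq_traject_ordS r (ltnW kM'))).
rewrite prodr_const card_ord size_traject -exprM mulSn exprD mulrAC mulnC.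
apply: ler_wpM2r => //.
by have := Pr_first_le p01 (uniq_iter_traject_ordS r kM'); rewrite size_traject.
Qed.

Lemma Pr_no_child_bar : Pr (@law n.+1) (no_child_bar i0) = q ^+ (d * M.-1).
Proof.
pose cells := traject (@ordS M) r M.-1.
rewrite (Pr_root_children p01 predT predT (fun=> fun y : branch n => ~~ has y.1 cells)).
under eq_bigr do rewrite (Pr_edge_none d p01 n (uniq_traject_ordS r (leq_pred M))).
by rewrite (PrT (bits_is_distr _ p01)) mul1r prodr_const card_ord size_traject -exprM mulnC.
Qed.

Lemma Pr_exits_step :
  Pr (@law n.+1) (fun z => exits z i0) <=
  (\sum_(k < M.-1) q ^+ (d.+1 * k)) * p + q ^+ (d * M.-1) +
  d%:R * \sum_(k < M.-1) q ^+ (d.+1 * k) * p *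
     ((M.-1 <= k + L)%N%:R + L%:R * p + rho * after_return_bound).
Proof.
pose second (wk : 'I_d * 'I_M.-1) z :=
  return_first i0 wk.2 (z.2 wk.1) && after_return i0 L wk.1 wk.2 (z.2 wk.1) z.
have cases z : exits z i0 ->
    [exists k : 'I_M.-1, parent_first i0 k z] ||
    (no_child_bar i0 z || [exists wk, second wk z]).
  case/(exits_cases L) => [[k kM first_k]|->|[w [k [kM ret after]]]]; rewrite ?orbT //.
    by apply/orP; left; apply/existsP; exists (Ordinal kM).
  by apply/or3P; constructor 3; apply/existsP; exists (w, Ordinal kM); apply/andP.
apply: le_trans (Pr_or_le (law_distr _) cases) _; rewrite -addrA; apply: lerD.
  rewrite mulr_suml.
  apply: le_trans (Pr_exists_le (law_distr _) (fun k : 'I_M.-1 => parent_first i0 k)) _.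
  by apply: ler_sum => k _; apply: Pr_parent_first.
apply: le_trans (Pr_or_le (law_distr _) (fun _ => id)) _; rewrite Pr_no_child_bar lerD2l.
apply: le_trans (Pr_exists_le (law_distr _) second) _.
rewrite -(pair_bigA _ (fun w (k : 'I_M.-1) => Pr (@law n.+1) (second (w, k)))) /=.
rewrite mulr_natl -[X in _ *+ X](card_ord d) -sumr_const.
by apply: ler_sum => w _; apply: ler_sum => k _; apply: Pr_return_first_after_return.
Qed.

End ReturnProbability.

Section BarProbability.
Variable R : realType.

Lemma expRN_le_half_exp (x : R) m : m%:R <= x -> expR (- x) <= 2^-1 ^+ m.
Proof.
move=> mx; apply: (@le_trans _ _ (expR (- m%:R))); first by rewrite ler_expR lerN2.
rewrite -[m%:R]mulr1 -mulrN expRM_natl; apply: lerXn2r; rewrite ?nnegrE ?expR_ge0 //.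
rewrite expRN lef_pV2 ?posrE ?expR_gt0 //.
by have := expR_ge1Dx (1 : R); lra.
Qed.

Definition ring_prob (h : R) := 1 - expR (- h).

Lemma ring_prob_ge0_le1 h : 0 <= h -> 0 <= ring_prob h <= 1.
Proof.
move=> h0; rewrite /ring_prob subr_ge0 lerBlDr lerDl expR_ge0 andbT.
by rewrite -expR0 ler_expR oppr_le0.
Qed.

Lemma ring_prob_le h : ring_prob h <= h.
Proof. by have := expR_ge1Dx (- h); rewrite /ring_prob; lra. Qed.

Lemma ring_prob_ge h : 0 <= h -> h * (1 - h) <= ring_prob h.
Proof.
move=> h0; have h1 : 0 < 1 + h by lra.
have expRN_ub : expR (- h) <= (1 + h)^-1.
  by rewrite expRN lef_pV2 ?posrE ?expR_gt0 // expR_ge1Dx.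
apply: (@le_trans _ _ (1 - (1 + h)^-1)); last by rewrite lerD2l lerN2.
rewrite -subr_ge0.
have -> : 1 - (1 + h)^-1 - h * (1 - h) = h ^+ 3 / (1 + h) by field; rewrite gt_eqF.
by rewrite divr_ge0 ?exprn_ge0 // ltW.
Qed.

Lemma ring_probC_exp h k : (1 - ring_prob h) ^+ k = expR (- (k%:R * h)).
Proof. by rewrite /ring_prob opprB addrC subrK -mulrN expRM_natl. Qed.

Lemma geometric_ring_prob_le h m N : 0 <= h ->
  (1 - m%:R * h) * (m%:R * ((\sum_(t < N) (1 - ring_prob h) ^+ (m * t)) * ring_prob h)) <= 1.
Proof.
move=> h0; case/andP: (ring_prob_ge0_le1 h0) => p0 p1.
set q := 1 - ring_prob h; set S := \sum_(t < N) _.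
have q0 : 0 <= q by rewrite subr_ge0.
have S0 : 0 <= S by apply: sumr_ge0 => t _; apply: exprn_ge0.
have mh0 : 0 <= m%:R * h by apply: mulr_ge0.
have [mh1|mh1] := leP (m%:R * h) 1; last first.
  by apply: (@le_trans _ _ 0) => //; rewrite mulr_le0_ge0 ?mulr_ge0 // subr_le0 ltW.
apply: (@le_trans _ _ (ring_prob (m%:R * h) * S)).
  have -> : (1 - m%:R * h) * (m%:R * (S * ring_prob h)) =
      m%:R * ring_prob h * (1 - m%:R * h) * S by ring.
  apply: ler_wpM2r => //; apply: le_trans (ring_prob_ge mh0).
  by apply: ler_wpM2r; rewrite ?subr_ge0 //; apply: ler_wpM2l => //; apply: ring_prob_le.
have -> : ring_prob (m%:R * h) * S = 1 - (q ^+ m) ^+ N.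
  have -> : ring_prob (m%:R * h) = 1 - q ^+ m by rewrite /q ring_probC_exp.
  rewrite -[RHS]opprB subrX1 -mulNr opprB; congr (_ * _).
  by apply: eq_bigr => t _; rewrite exprM.
by rewrite lerBlDr lerDl !exprn_ge0.
Qed.

End BarProbability.

Lemma sum_late_indicator N L : (\sum_(k < N) (N <= k + L)%N = minn N L)%N.
Proof.
elim: N => [|N IH]; first by rewrite big_ord0 min0n.
rewrite big_ord_recl /= add0n (eq_bigr (fun k : 'I_N => (N <= k + L)%N : nat)).
  by rewrite IH; case: leqP; lia.
by move=> k _; rewrite /bump /= add1n addSn ltnS.
Qed.

Section LargeTime.
Variables (R : realType) (d M : nat) (T : R).
Hypotheses (d_ge : (100 <= d)%N) (dT_ge : 20 <= d%:R * T).
Hypothesis M_ge : 10 * (d.+1%:R * T) <= M%:R.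
Let h := T / M%:R.
Let p := ring_prob h.
Let q := 1 - p.

Let dR_ge : 100 <= d%:R :> R. Proof. by rewrite (ler_nat _ 100). Qed.

Let T_gt0 : 0 < T.
Proof. by rewrite -(pmulr_rgt0 T (_ : 0 < d%:R)); move: dR_ge dT_ge; lra. Qed.

Let M_gt0 : 0 < M%:R :> R.
Proof. by apply: lt_le_trans M_ge; rewrite !mulr_gt0 // ltr0n. Qed.

Let h_gt0 : 0 < h. Proof. exact: divr_gt0. Qed.

Let TE : T = M%:R * h. Proof. by rewrite mulrC divfK // gt_eqF. Qed.

Let p01 : 0 <= p <= 1. Proof. by apply/ring_prob_ge0_le1/ltW. Qed.
Let p_ge0 : 0 <= p. Proof. by case/andP: p01. Qed.
Let qX_ge0 k : 0 <= q ^+ k. Proof. by rewrite exprn_ge0 // subr_ge0; case/andP: p01. Qed.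

Let dSh_le : d.+1%:R * h <= 10^-1.
Proof. by rewrite /h mulrA ler_pdivrMr //; move: M_ge; lra. Qed.

Let dh_le : d%:R * h <= 10^-1.
Proof. by apply: le_trans dSh_le; apply: ler_wpM2r; [apply: ltW|rewrite ler_nat]. Qed.

Let dh_gt0 : 0 < d%:R * h. Proof. by apply: mulr_gt0 => //; move: dR_ge; lra. Qed.

Let MpE : M.-1%:R = M%:R - 1 :> R. Proof. by rewrite -subn1 natrB // -(ltr0n R). Qed.

Lemma no_child_bar_le : q ^+ (d * M.-1) <= 2^-1 ^+ 7.
Proof.
rewrite ring_probC_exp expRN_le_half_exp // natrM MpE.
have -> : d%:R * (M%:R - 1) * h = d%:R * T - d%:R * h by rewrite TE; ring.
by move: dh_le dT_ge; lra.
Qed.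

Lemma window_size_exists : exists L, 5 <= d%:R * (L%:R * h) <= 6.
Proof.
exists (Num.truncn (5 / (d%:R * h))).+1.
have /andP[lo hi] := truncn_itv (divr_ge0 (ler0n R 5) (ltW dh_gt0)).
rewrite mulrCA; move: lo hi; rewrite ler_pdivlMr // ltr_pdivrMr // => lo /ltW -> /=.
by rewrite -natr1 mulrDl mul1r; move: dh_le; lra.
Qed.

Lemma sum_first_bar_le N : d.+1%:R * ((\sum_(k < N) q ^+ (d.+1 * k)) * p) <= 10 / 9.
Proof.
have := geometric_ring_prob_le d.+1 N (ltW h_gt0); rewrite -/p -/q.
set G := d.+1%:R * (_ * p) => G_le.
have G0 : 0 <= G by rewrite !mulr_ge0 // sumr_ge0.
have : 9 / 10 * G <= (1 - d.+1%:R * h) * G by apply: ler_wpM2r => //; move: dSh_le; lra.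
by lra.
Qed.

Lemma after_return_bound_le L : 5 <= d%:R * (L%:R * h) ->
  after_return_bound M d p 5^-1 L <= 27 / 100.
Proof.
move=> L_ge; rewrite /after_return_bound -/q.
have qdL : q ^+ (d * L) <= 2^-1 ^+ 5.
  by rewrite ring_probC_exp expRN_le_half_exp // natrM -mulrA.
have := geometric_ring_prob_le d M (ltW h_gt0); rewrite -/p -/q.
set G := _ * p => dG_le.
have G0 : 0 <= G by rewrite mulr_ge0 // sumr_ge0.
have dG0 : 0 <= d%:R * G by rewrite mulr_ge0.
have dG : 9 / 10 * (d%:R * G) <= 1.
  by apply: le_trans dG_le; apply: ler_wpM2r => //; move: dh_le; lra.
have G100 : 100 * G <= d%:R * G by apply: ler_wpM2r.
have dpG : G * d.-1%:R <= G * d%:R by apply: ler_wpM2l; rewrite // ler_nat leq_pred.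
move: qdL; rewrite exprVn -natrX mulrDr mulr1 mulrA; lra.
Qed.

Lemma sum_late_le L : d%:R * (L%:R * h) <= 6 ->
  d%:R * \sum_(k < M.-1) q ^+ (d.+1 * k) * p * (M.-1 <= k + L)%N%:R <= 6 * 2^-1 ^+ 7.
Proof.
move=> L_le.
have late_le (k : nat) : (M.-1 <= k + L)%N -> q ^+ (d.+1 * k) <= 2^-1 ^+ 7.
  move=> kL; rewrite ring_probC_exp expRN_le_half_exp //.
  have kR : M%:R - 1 <= k%:R + L%:R :> R by rewrite -MpE -natrD ler_nat.
  have := ler_wpM2l (ltW dh_gt0) kR.
  have : d%:R * h * k%:R <= (d.+1 * k)%:R * h.
    by rewrite mulrAC ler_wpM2r ?(ltW h_gt0) // -natrM ler_nat leq_mul2r leqnSn orbT.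
  have -> : d%:R * h * (M%:R - 1) = d%:R * T - d%:R * h by rewrite TE; ring.
  have -> : d%:R * h * (k%:R + L%:R) = d%:R * h * k%:R + d%:R * (L%:R * h) by ring.
  by move: dh_le dT_ge L_le; lra.
apply: (@le_trans _ _ (d%:R * (L%:R * h * 2^-1 ^+ 7))); last first.
  by rewrite mulrA; apply: ler_wpM2r; rewrite // exprn_ge0.
apply: ler_wpM2l => //.
apply: (@le_trans _ _ (\sum_(k < M.-1) (M.-1 <= k + L)%N%:R * (h * 2^-1 ^+ 7))).
  apply: ler_sum => k _; rewrite [leRHS]mulrC.
  have [kL|_] := boolP (M.-1 <= k + L)%N; last by rewrite !mulr0.
  rewrite !mulr1 mulrC; apply: ler_pM => //; [exact: ring_prob_le|exact: late_le].
rewrite -mulr_suml -natr_sum sum_late_indicator mulrA.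
do 2 (apply: ler_wpM2r; first by rewrite ?exprn_ge0 ?ltW).
by rewrite ler_nat geq_minr.
Qed.

(* Of the three terms of [Pr_exits_step], the first is at most [1 / 90], the second
   at most [2^-7], and the third at most [6 / 2^7 + 10 / 9 (6 / 100 + 27 / 500)]. *)
Lemma Pr_exits_le_fifth n (c : 'I_M) :
  Pr (@branch_distr R M d p n) (fun y => exits y c) <= 5^-1.
Proof.
elim: n c => [|n IH] c.
  by under eq_Pr => y do rewrite exits_level0; rewrite (Pr0 (@branch_distr R M d p 0)).
have [L /andP[L_ge L_le]] := window_size_exists.
apply: le_trans (Pr_exits_step p01 IH _ c L) _; first by rewrite invr_ge0.
have late := sum_late_le L_le.
have := sum_first_bar_le M.-1; set G := _ * p => G_le.
have G_ge0 : 0 <= G by rewrite mulr_ge0 // sumr_ge0.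
have after_ge0 : 0 <= after_return_bound M d p 5^-1 L.
  by apply: after_return_bound_ge0; rewrite ?invr_ge0.
have := after_return_bound_le L_ge; move: after_ge0.
set after := after_return_bound _ _ _ _ _ => after_ge0 after_le.
have Lp_ge0 : 0 <= L%:R * p by rewrite mulr_ge0.
have G101 : 101 * G <= d.+1%:R * G by apply: ler_wpM2r => //; rewrite (ler_nat _ 101).
have dG : d%:R * G <= d.+1%:R * G by apply: ler_wpM2r => //; rewrite ler_nat.
have Lp : 100 * (L%:R * p) <= 6.
  apply: le_trans L_le; apply: ler_pM => //; apply: ler_wpM2l => //; exact: ring_prob_le.
have -> : d%:R * (\sum_(k < M.-1) q ^+ (d.+1 * k) * p *
      ((M.-1 <= k + L)%N%:R + L%:R * p + 5^-1 * after)) =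
    d%:R * (\sum_(k < M.-1) q ^+ (d.+1 * k) * p * (M.-1 <= k + L)%N%:R) +
    d%:R * G * (L%:R * p + 5^-1 * after).
  rewrite -[d%:R * G * _]mulrA -mulrDr; congr (_ * _); rewrite /G !mulr_suml -big_split /=.
  by apply: eq_bigr => k _; rewrite -addrA mulrDr.
have third : d%:R * G * (L%:R * p + 5^-1 * after) <= 10 / 9 * (6 / 100 + 27 / 500).
  apply: ler_pM; [exact: mulr_ge0| |lra|lra].
  by rewrite addr_ge0 // mulr_ge0 // invr_ge0.
have := no_child_bar_le; move: late; rewrite exprVn -natrX; lra.
Qed.

End LargeTime.

(** * The regime of small [T] *)

Section SingleBar.
Variables (M d n : nat) (i0 : 'I_M).
Let r := ordS i0.
Local Notation cell k := (iter k (@ordS M) r).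

Lemma cell_surj (c : 'I_M) : exists2 s, (s < M)%N & c = cell s.
Proof.
have M0 : (0 < M)%N by apply: leq_ltn_trans (ltn_ord c).
exists ((c + (M - r)) %% M)%N; first by rewrite ltn_mod.
apply: val_inj; rewrite [RHS]val_iter_ordS modnDmr addnCA subnKC; last exact: ltnW.
by rewrite modnDr modn_small.
Qed.

Definition single_bar k : edge_bars M := [ffun i => i == cell k].

Definition one_sided k (b : edge_bars M) :=
  ~~ has b (traject (@ordS M) r k.+1) || ~~ has b (traject (@ordS M) (cell k) (M - k)).

Lemma one_sidedP k b s s' : one_sided k b -> (s <= k)%N -> (k <= s')%N -> (s' < M)%N ->
  b (cell s) -> ~~ b (cell s').
Proof.
move=> /orP [/hasPn none_before|/hasPn none_after] sk ks' s'M bs.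
  suff : ~~ b (cell s) by rewrite bs.
  by apply/none_before/trajectP; exists s.
apply/none_after/trajectP; exists (s' - k)%N; first by rewrite ltn_sub2r // (leq_ltn_trans ks').
by rewrite -iterD subnK.
Qed.

(* The walk on the pole of the root can get past cell [k] only through that cell,
   since no excursion into another child leads from one side of it to the other. *)
Lemma exits_through (t : tree_bars M d n.+1) w k : (k < M.-1)%N ->
  exits ((no_bars, t) : branch M d n.+1) i0 -> (t w).1 = single_bar k ->
  (forall j, j != w -> one_sided k (t j).1) ->
  exits ((no_bars, (t w).2) : branch M d n) (cell k).
Proof.
move=> kM /asboolP [b walk] tw others.
have w_bar i : (t w).1 i = (i == cell k) by rewrite tw ffunE.
suff : exits (t w) (cell k).
  by rewrite [t w]surjective_pairing; apply: exits_mono => i /negbTE ik; rewrite w_bar ik.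
have [s sk er] : exists2 s, (s <= k)%N & ordS i0 = cell s by exists 0%N.
elim: walk s sk er => {b}.
- move=> c /= /orP [|/eqP-> s sk]; first by rewrite ffunE.
  rewrite -[LHS](iter_ordS_period i0) => /iter_ordS_inj; lia.
- move=> c b _ no_bar _ IH s sk ec.
  have s_neq_k : s != k by apply: contraNneq (no_bar w) => e; rewrite w_bar ec e.
  by apply: (IH s.+1); [lia|rewrite ec].
- move=> c w1 j b _ w1c others_clear ret _ IH s sk ec.
  have [ek|s_neq_k] := eqVneq s k.
    have e1 : w1 = w.
      apply/eqP; rewrite eq_sym; apply/negPn/negP => /others_clear.
      by rewrite w_bar ec ek eqxx.
    by rewrite -ek -ec -e1; apply: exits_at_exits w1c ret.
  have w1w : w1 != w.
    apply: contraNneq s_neq_k => e; move: w1c; rewrite e w_bar ec => /eqP /iter_ordS_inj ->//; lia.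
  have [s' s'M ej] := cell_surj j.
  apply: (IH s'.+1); last by rewrite ej.
  rewrite ltnNge; apply/negP => ks'.
  have : ~~ (t w1).1 (cell s') by apply: one_sidedP (others _ w1w) sk ks' s'M _; rewrite -ec.
  by rewrite -ej (exits_at_bar ret).
Qed.

End SingleBar.

Lemma bernoulli_inequality (R : realFieldType) (x : R) m :
  0 <= x <= 1 -> 1 - m%:R * (1 - x) <= x ^+ m.
Proof.
case/andP=> x0 x1; elim: m => [|m IH]; first by rewrite mul0r subr0 expr0.
rewrite exprS -natr1; have := ler_wpM2l x0 IH; apply: le_trans.
have : 0 <= m%:R * ((1 - x) * (1 - x)) by rewrite !mulr_ge0 ?subr_ge0.
by lra.
Qed.

Lemma bonferroni_le1 (R : realFieldType) (I : finType) (a : I -> R) :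
  (forall i, 0 <= a i <= 1) ->
  \sum_i a i - \sum_i \sum_(j | j != i) a i * a j <= 1.
Proof.
move=> a01; set S := \sum_i a i; pose Q := \sum_i a i * a i.
have a0 i : 0 <= a i by case/andP: (a01 i).
have -> : \sum_i \sum_(j | j != i) a i * a j = S * S - Q.
  rewrite /Q /S mulr_suml -sumrB; apply: eq_bigr => i _.
  by rewrite mulr_sumr [in RHS](bigD1 i) //= addrAC subrr add0r.
have QS : Q <= S by apply: ler_sum => i _; rewrite ler_piMl //; case/andP: (a01 i).
have QSS : Q <= S * S.
  rewrite /S mulr_suml; apply: ler_sum => i _; apply: ler_wpM2l => //.
  by rewrite (bigD1 i) //= lerDl sumr_ge0.
by have [|] := leP S 1; nra.
Qed.

Section SurvivalProbability.
Variables (R : realFieldType) (M d n : nat) (p : R) (i0 : 'I_M).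
Hypothesis p01 : 0 <= p <= 1.
Let q := 1 - p.
Let r := ordS i0.
Local Notation cell k := (iter k (@ordS M) r).
Local Notation branch := (branch M d).
Local Notation law := (@branch_distr R M d p).
Local Notation bits_law := (bits_distr p : edge_bars M -> R).
Implicit Types (y : branch n) (x : tree_bars M d n.+1) (w : 'I_d).

Let p_ge0 : 0 <= p. Proof. by case/andP: p01. Qed.
Let q_ge0 : 0 <= q. Proof. by rewrite subr_ge0; case/andP: p01. Qed.
Let q_le1 : q <= 1. Proof. by rewrite /q lerBlDr lerDl. Qed.
Let law_distr m : is_distr (@law m). Proof. exact: branch_is_distr. Qed.
Let tree_distrP m : is_distr (@tree_distr R M d p m). Proof. exact: tree_is_distr. Qed.
Let bits_distrP : is_distr bits_law. Proof. exact: bits_is_distr. Qed.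

Lemma Pr_one_sided k : (k < M)%N ->
  1 - (p + k%:R * (M.-1 - k)%:R * (p * p)) <= Pr bits_law (one_sided i0 k).
Proof.
move=> kM; rewrite lerBlDr -lerBlDl -(PrC bits_distrP).
pose before := traject (@ordS M) r k.
pose after := traject (@ordS M) (cell k.+1) (M.-1 - k).
pose both (cc : 'I_M * 'I_M) (b : edge_bars M) := b cc.1 && b cc.2.
pose straddle (b : edge_bars M) := has b before && has b after.
have cases b : predC (one_sided i0 k) b -> b (cell k) || straddle b.
  have Mk : (M - k = (M.-1 - k).+1)%N by lia.
  by rewrite /= negb_or !negbK Mk trajectSr has_rcons /= -orb_andr.
apply: le_trans (Pr_or_le bits_distrP cases) _; rewrite (Pr_bit p01) lerD2l.
have -> : k%:R * (M.-1 - k)%:R * (p * p) =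
    (size [seq (c, c') | c <- before, c' <- after])%:R * (p * p).
  by rewrite size_allpairs !size_traject natrM.
apply: (Pr_union_le_cst bits_distrP (B := both)) => [b|].
  move=> /andP[/hasP [c c_before bc] /hasP [c' c'_after bc']]; exists (c, c').
    by apply/allpairsP; exists (c, c').
  by rewrite /both bc.
move=> _ /allpairsP [[c c'] /= [c_before c'_after ->]]; apply: Pr_two_bits_le => //.
case/trajectP: c_before c'_after => s sk -> /trajectP [s' s'M ->] /=; rewrite -iterSr -iterD.
apply/eqP => /iter_ordS_inj; lia.
Qed.

Definition survives m (t : tree_bars M d m) c := ~~ exits ((no_bars, t) : branch m) c.

Variable s0 : R.
Hypothesis s0_gt0 : 0 < s0.
Hypothesis survives_ge : forall c, s0 <= Pr (@tree_distr R M d p n) (fun t => survives t c).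

(* Thinning brings the mean down to exactly [s0], so that the second moment term
   of the inclusion-exclusion bound is quadratic in [s0]. *)
Definition thinned c (t : tree_bars M d n) : R :=
  s0 / Pr (@tree_distr R M d p n) (fun t' => survives t' c) * (survives t c)%:R.

Lemma thinned_ge0_le1 c t : 0 <= thinned c t <= 1.
Proof.
have Pr_gt0 := lt_le_trans s0_gt0 (survives_ge c).
rewrite /thinned; case: (survives t c); rewrite ?mulr0 ?mulr1 ?lexx ?ler01 //.
by rewrite ler_pdivrMr // mul1r survives_ge andbT divr_ge0 // ltW.
Qed.

Lemma expect_thinned c : expect (@tree_distr R M d p n) (thinned c) = s0.
Proof.
by rewrite /thinned expectZl -/(Pr _ _) divfK // gt_eqF // (lt_le_trans s0_gt0).
Qed.

Definition lone k y : R := (y.1 == single_bar i0 k)%:R * thinned (cell k) y.2.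

Lemma lone_ge0 k y : 0 <= lone k y.
Proof. by rewrite mulr_ge0 //; case/andP: (thinned_ge0_le1 (cell k) y.2). Qed.

Lemma expect_lone k : expect (@law n) (lone k) = q ^+ M.-1 * p * s0.
Proof.
rewrite expect_pair -[in RHS](card_ord M) -(Pr_single_bit p (cell k)) /Pr -expectZr.
by apply: eq_expect => b /=; rewrite /lone /= expectZl expect_thinned.
Qed.

Lemma sum_lone_le1 y : \sum_(k < M.-1) lone k y <= 1.
Proof.
have [/existsP [k /eqP single_k]|/existsPn none_single] :=
  boolP [exists k : 'I_M.-1, y.1 == single_bar i0 k]; last first.
  by rewrite big1 // => k _; rewrite /lone (negbTE (none_single k)) mul0r.
rewrite (bigD1 k) //= big1 ?addr0 => [|k' k'k].
  by rewrite /lone single_k eqxx mul1r; case/andP: (thinned_ge0_le1 (cell k) y.2).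
rewrite /lone single_k; case: eqP => [/ffunP /(_ (cell k))|_]; last by rewrite mul0r.
rewrite !ffunE eqxx => /esym/eqP /iter_ordS_inj e.
case/eqP: k'k; apply: val_inj; rewrite /= e //; have := ltn_ord k; have := ltn_ord k'; lia.
Qed.

Definition useful w x : R := \sum_(k < M.-1)
  \prod_j (if j == w then lone k (x j) else (one_sided i0 k (x j).1)%:R).

Lemma useful_ge0 w x : 0 <= useful w x.
Proof.
by apply: sumr_ge0 => k _; apply: prodr_ge0 => j _; case: ifP => // _; apply: lone_ge0.
Qed.

Lemma useful_le w x : useful w x <= \sum_(k < M.-1) lone k (x w).
Proof.
apply: ler_sum => k _; rewrite (bigD1 w) //= eqxx ler_piMr ?lone_ge0 //.
by apply: prodr_ile1 => j /negbTE ->; rewrite ler0n -[1]/(1%:R) ler_nat leq_b1.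
Qed.

Lemma useful_survives w x : useful w x != 0 -> survives x i0.
Proof.
apply: contraNN => out; rewrite /useful big1 // => k _.
have [single_k|not_single] := eqVneq (x w).1 (single_bar i0 k); last first.
  by rewrite (bigD1 w) //= eqxx /lone (negbTE not_single) !mul0r.
have [/forall_inP others|] := boolP [forall (j | j != w), one_sided i0 k (x j).1].
  rewrite (bigD1 w) //= eqxx /lone /thinned /survives.
  by rewrite (exits_through (ltn_ord k) out single_k others) !mulr0 mul0r.
rewrite negb_forall_in => /exists_inP [j jw straddled].
by rewrite (bigD1 j) //= (negbTE jw) (negbTE straddled) mul0r.
Qed.

Lemma survives_ge_useful x :
  \sum_w useful w x - \sum_w \sum_(w' | w' != w) useful w x * useful w' x <=
  (survives x i0)%:R.
Proof.
have [surv|dead] := boolP (survives x i0).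
  apply: bonferroni_le1 => w; rewrite useful_ge0 /=.
  exact: le_trans (useful_le _ _) (sum_lone_le1 _).
have useful0 w : useful w x = 0 by apply/eqP; apply: contraNT dead => /useful_survives.
by rewrite !big1 ?subrr // => w _; rewrite big1 // => w' _; rewrite useful0 mul0r.
Qed.

Lemma expect_useful_ge w :
  q ^+ M.-1 * p * s0 *
    (\sum_(k < M.-1) (1 - d%:R * (p + k%:R * (M.-1 - k)%:R * (p * p)))) <=
  expect (@tree_distr R M d p n.+1) (useful w).
Proof.
rewrite /useful expect_sum mulr_sumr; apply: ler_sum => k _.
have kM : (k < M)%N by have := ltn_ord k; lia.
rewrite (expect_prod _ (fun j y => if j == w then lone k y else (one_sided i0 k y.1)%:R)).
rewrite (bigD1 w) //= eqxx (@eq_expect _ _ _ _ (lone k)) // expect_lone.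
apply: ler_wpM2l; first by rewrite !mulr_ge0 ?exprn_ge0 // ltW.
rewrite (eq_bigr (fun=> Pr bits_law (one_sided i0 k))) => [|j /negbTE jw]; last first.
  by rewrite -(Pr_edge d p01 n (one_sided i0 k)); apply: eq_expect => y; rewrite jw.
rewrite prodr_const cardC1 card_ord.
have Pr_ub := Pr_le1 bits_distrP (one_sided i0 k).
apply: le_trans (bernoulli_inequality _ _); last by rewrite Pr_ge0.
have := Pr_one_sided kM; rewrite lerBlDr -lerBlDl => Pr_lb.
by rewrite lerD2l lerN2; apply: ler_pM; rewrite ?subr_ge0 // ler_nat leq_pred.
Qed.

Lemma expect_useful_mul_le w w' : w' != w ->
  expect (@tree_distr R M d p n.+1) (fun x => useful w x * useful w' x) <= (M%:R * p * s0) ^+ 2.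
Proof.
move=> w'w; pose S y := \sum_(k < M.-1) lone k y.
have S_ge0 y : 0 <= S y by apply: sumr_ge0 => k _; apply: lone_ge0.
have expect_S_le : expect (@law n) S <= M%:R * p * s0.
  rewrite /S expect_sum (eq_bigr (fun=> q ^+ M.-1 * p * s0)) => [|k _]; last exact: expect_lone.
  rewrite sumr_const card_ord -[leLHS]mulr_natl -!mulrA.
  have ps_ge0 : 0 <= p * s0 by rewrite mulr_ge0 // ltW.
  apply: ler_pM => //; first by rewrite mulr_ge0 ?exprn_ge0.
    by rewrite ler_nat leq_pred.
  by rewrite ler_piMl // exprn_ile1.
apply: (@le_trans _ _ (expect (@tree_distr R M d p n.+1) (fun x => S (x w) * S (x w')))).
  by apply: (le_expect (tree_distrP n.+1)) => x; apply: ler_pM; rewrite ?useful_ge0 ?useful_le.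
rewrite (expect_mul_coords (law_distr n) S S w'w) -expr2.
by apply: lerXn2r; rewrite ?nnegrE ?(expect_ge0 (law_distr n)) ?mulr_ge0 // ltW.
Qed.

Definition useful_mean : R := d%:R * (q ^+ M.-1 * p *
  \sum_(k < M.-1) (1 - d%:R * (p + k%:R * (M.-1 - k)%:R * (p * p)))).

Lemma Pr_survives_step : useful_mean * s0 - (d%:R * (M%:R * p) * s0) ^+ 2 <=
  Pr (@tree_distr R M d p n.+1) (fun x => survives x i0).
Proof.
apply: le_trans (le_expect (tree_distrP n.+1) survives_ge_useful).
rewrite expectB !expect_sum; apply: lerB.
  apply: (@le_trans _ _ (\sum_(w : 'I_d) q ^+ M.-1 * p * s0 *
    (\sum_(k < M.-1) (1 - d%:R * (p + k%:R * (M.-1 - k)%:R * (p * p)))))).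
    by rewrite sumr_const card_ord -[leRHS]mulr_natl /useful_mean; lra.
  by apply: ler_sum => w _; apply: expect_useful_ge.
apply: (@le_trans _ _ (\sum_(w : 'I_d) \sum_(w' : 'I_d) (M%:R * p * s0) ^+ 2)).
  apply: ler_sum => w _; rewrite expect_sum [leRHS](bigID (fun w' => w' != w)) /= -[leLHS]addr0.
  apply: lerD; first by apply: ler_sum => w' ?; apply: expect_useful_mul_le.
  by apply: sumr_ge0 => w' _; apply: sqr_ge0.
by rewrite !sumr_const !card_ord -mulrnA -[leLHS]mulr_natl natrM expr2; lra.
Qed.

End SurvivalProbability.

(** * Uniform survival *)

Section UsefulMeanLimit.
Variables (R : realType) (d : nat) (T : R).
Hypothesis T_gt0 : 0 < T.
Let h (M : nat) : R := T / M.+1%:R.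
Let p (M : nat) : R := ring_prob (h M).

Let h_ge0 M : 0 <= h M. Proof. by rewrite divr_ge0 // ltW. Qed.

Let ME M : M%:R * h M = T - h M.
Proof. by rewrite /h -natr1; field; rewrite natr1. Qed.

Lemma sum_parabola N : \sum_(k < N) k%:R * (N - k)%:R = (N%:R ^+ 3 - N%:R) / 6 :> R.
Proof.
have sum_le c m : \sum_(k < m) k%:R * (c - k%:R) =
    c * (m%:R * (m%:R - 1) / 2) - m%:R * (m%:R - 1) * (2 * m%:R - 1) / 6 :> R.
  elim: m => [|m IH]; first by rewrite big_ord0; field.
  by rewrite big_ord_recr /= IH -natr1; field.
rewrite (eq_bigr (fun k : 'I_N => k%:R * (N%:R - k%:R))) => [|k _].
  by rewrite sum_le; field.
by rewrite natrB // ltnW.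
Qed.

Lemma useful_meanE M : useful_mean M.+1 d (p M) =
  d%:R * (expR (- (T - h M)) * (M%:R * p M * (1 - d%:R * p M) -
    d%:R * ((M%:R * p M) ^+ 3 - M%:R * p M * p M ^+ 2) / 6)).
Proof.
rewrite /useful_mean /= ring_probC_exp ME -[in LHS]mulrA; congr (_ * (_ * _)).
have -> : \sum_(k < M) (1 - d%:R * (p M + k%:R * (M - k)%:R * (p M * p M))) =
    M%:R * (1 - d%:R * p M) - d%:R * (p M * p M) * \sum_(k < M) k%:R * (M - k)%:R.
  rewrite (eq_bigr (fun k : 'I_M => (1 - d%:R * p M) -
    d%:R * (p M * p M) * (k%:R * (M - k)%:R))) => [|k _]; last by ring.
  by rewrite sumrB sumr_const card_ord -mulr_sumr -[_ *+ M]mulr_natl.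
by rewrite sum_parabola; field.
Qed.

Lemma cell_length_cvg0 : h M @[M --> \oo] --> 0.
Proof.
by rewrite -[X in _ --> X](mulr0 T); apply: cvgMr; exact: cvg_harmonic.
Qed.

Lemma ring_prob_cvg0 : p M @[M --> \oo] --> 0.
Proof.
apply: (squeeze_cvgr (f := fun=> 0) _ _ cell_length_cvg0); last exact: cvg_cst.
apply: nearW => M; rewrite ring_prob_le andbT.
by case/andP: (ring_prob_ge0_le1 (h_ge0 M)).
Qed.

Lemma cells_ring_prob_cvg : M%:R * p M @[M --> \oo] --> T.
Proof.
have upper : T - h M @[M --> \oo] --> T.
  by rewrite -[X in _ --> X]subr0; apply: cvgB cell_length_cvg0; apply: cvg_cst.
have lower : (T - h M) * (1 - h M) @[M --> \oo] --> T.
  rewrite -[X in _ --> X]mulr1; apply: cvgM upper _.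
  by rewrite -[X in _ --> X]subr0; apply: cvgB cell_length_cvg0; apply: cvg_cst.
apply: squeeze_cvgr lower upper; apply: nearW => M; rewrite -ME -mulrA.
by apply/andP; split; apply: ler_wpM2l => //; [apply: ring_prob_ge|apply: ring_prob_le].
Qed.

Lemma useful_mean_cvg : useful_mean M.+1 d (p M) @[M --> \oo] -->
  d%:R * T * expR (- T) * (1 - d%:R * T ^+ 2 / 6).
Proof.
have -> : d%:R * T * expR (- T) * (1 - d%:R * T ^+ 2 / 6) =
    d%:R * (expR (- (T - 0)) * (T * (1 - d%:R * 0) - d%:R * (T ^+ 3 - T * 0 ^+ 2) / 6)).
  by rewrite subr0; field.
under eq_fun do rewrite useful_meanE.
have h0 := cell_length_cvg0; have p0 := ring_prob_cvg0; have MpT := cells_ring_prob_cvg.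
apply: cvgMr; apply: cvgM.
  apply: continuous_cvg; first exact: continuous_expR.
  by apply: cvgN; apply: cvgB => //; apply: cvg_cst.
apply: cvgB.
  by apply: cvgM => //; apply: cvgB; [apply: cvg_cst|apply: cvgMr].
have cvgX (f : nat -> R) (l : R) k : f M @[M --> \oo] --> l -> f M ^+ k @[M --> \oo] --> l ^+ k.
  by move=> fl; apply: (continuous_cvg _ (@exprn_continuous R k l)).
apply: cvgMl; apply: cvgMr; apply: cvgB; first exact: cvgX.
by apply: cvgM => //; apply: cvgX.
Qed.

End UsefulMeanLimit.

Section UniformSurvival.
Variables (R : realType) (d : nat) (T : R).
Hypothesis T_gt0 : 0 < T.

Definition uniform_survival := exists2 s0 : R, 0 < s0 &
  \forall M \near \oo, forall n (c : 'I_M.+1),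
    s0 <= Pr (@tree_distr R M.+1 d (ring_prob (T / M.+1%:R)) n) (fun t => survives t c).

Definition supercritical := 1 < d%:R * T * expR (- T) * (1 - d%:R * T ^+ 2 / 6).

Let ring_prob01 M : 0 <= ring_prob (T / M.+1%:R) <= 1.
Proof. by apply: ring_prob_ge0_le1; rewrite divr_ge0 // ltW. Qed.

Lemma supercritical_uniform_survival : supercritical -> uniform_survival.
Proof.
rewrite /supercritical; set m := (X in 1 < X) => m_gt1.
have dT_gt0 : 0 < d%:R * T.
  rewrite mulr_gt0 // ltr0n lt0n; apply: contraTneq m_gt1 => d0.
  by rewrite /m d0 !mul0r ltr10.
pose m1 := (1 + m) / 2; pose s0 := Num.min 1 ((m1 - 1) / (d%:R * T) ^+ 2).
have s0_gt0 : 0 < s0 by rewrite lt_min ltr01 divr_gt0 ?exprn_gt0 // /m1; lra.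
have mean_lim : \forall M \near \oo, m1 <= useful_mean M.+1 d (ring_prob (T / M.+1%:R)).
  by apply: (cvgr_ge m); [exact: useful_mean_cvg|rewrite /m1; lra].
exists s0 => //; apply: filterS mean_lim => M; set p := ring_prob _ => mean_ge.
elim=> [|n IH] c.
  under eq_Pr do rewrite /survives exits_level0.
  by rewrite (PrT (tree_is_distr _ d (ring_prob01 M) 0)) ge_min lexx.
apply: le_trans (Pr_survives_step c (ring_prob01 M) s0_gt0 IH).
have second_moment : (d%:R * (M.+1%:R * p) * s0) ^+ 2 <= (m1 - 1) * s0.
  have Mp_le : M.+1%:R * p <= T by rewrite mulrC -ler_pdivlMr // ring_prob_le.
  have p_ge0 : 0 <= p by case/andP: (ring_prob01 M).
  apply: (@le_trans _ _ ((d%:R * T) ^+ 2 * s0 * s0)).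
    have -> : (d%:R * T) ^+ 2 * s0 * s0 = (d%:R * T * s0) ^+ 2 by ring.
    have s0_ge0 := ltW s0_gt0; have T_ge0 := ltW T_gt0.
    apply: lerXn2r; rewrite ?nnegrE ?mulr_ge0 //.
    by apply: ler_wpM2r => //; apply: ler_wpM2l.
  apply: ler_wpM2r; first exact: ltW.
  by rewrite mulrC -ler_pdivlMr ?exprn_gt0 // ge_min lexx orbT.
apply: le_trans (lerB (ler_wpM2r (ltW s0_gt0) mean_ge) second_moment).
by rewrite -mulrBl opprB addrC subrK mul1r.
Qed.

Lemma large_time_uniform_survival : (100 <= d)%N -> 20 <= d%:R * T -> uniform_survival.
Proof.
move=> d_ge dT_ge; exists (4 / 5); first by apply: divr_gt0.
apply: filterS (nbhs_infty_ger (10 * (d.+1%:R * T))) => M M_ge n c; set p := ring_prob _.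
have {}M_ge : 10 * (d.+1%:R * T) <= M.+1%:R by apply: le_trans M_ge _; rewrite ler_nat.
have treeP := tree_is_distr M.+1 d (ring_prob01 M) n.
have bitsP := bits_is_distr 'I_M.+1 (ring_prob01 M).
rewrite (PrC treeP); have := Pr_exits_le_fifth d_ge dT_ge M_ge n c.
suff : Pr (@tree_distr R M.+1 d p n) (fun t => exits ((no_bars, t) : branch M.+1 d n) c) <=
    Pr (@branch_distr R M.+1 d p n) (fun y => exits y c) by rewrite -/p; lra.
rewrite -[leLHS](expect_cst bitsP) [leRHS]expect_pair.
apply: (le_expect bitsP) => b; apply: (le_Pr treeP) => t /=.
by apply: exits_mono => i _; rewrite ffunE.
Qed.

End UniformSurvival.

Section Threshold.
Variables (R : realType) (d : nat) (T : R).
Hypothesis d_ge : (100 <= d)%N.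
Local Notation D := (d%:R : R).

Let D_ge : 100 <= D. Proof. by rewrite (ler_nat _ 100). Qed.
Let D_gt0 : 0 < D. Proof. by move: D_ge; lra. Qed.

(* With [x = d T] and [expR (- T) >= 1 - T], it suffices that
   [x^2 + x^3 / 6 < d (x - 1)]; on [1, 20] the left-hand side is at most
   [7 / 6 + 92 (x - 1)]. *)
Lemma supercritical_of_cubic : 1 <= D * T <= 20 ->
  (D * T) ^+ 2 + (D * T) ^+ 3 / 6 < D * (D * T - 1) -> supercritical d T.
Proof.
case/andP=> x_ge1 x_le20 cubic.
have T_ge0 : 0 <= T by rewrite -(pmulr_rge0 T D_gt0); lra.
have T_le : T <= 5^-1.
  by have : 100 * T <= D * T by [apply: ler_wpM2r]; lra.
rewrite /supercritical; set e := D * T ^+ 2 / 6.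
have e_ge0 : 0 <= e by rewrite divr_ge0 // mulr_ge0 // sqr_ge0.
have e_le1 : e <= 1.
  have : D * T * T <= 20 * 5^-1 by apply: ler_pM => //; lra.
  by rewrite /e expr2; lra.
have mean_gt1 : 1 < D * T * (1 - T - e).
  rewrite -(ltr_pM2l D_gt0).
  have -> : D * (D * T * (1 - T - e)) = D * (D * T) - ((D * T) ^+ 2 + (D * T) ^+ 3 / 6).
    by rewrite /e; field.
  by lra.
apply: lt_le_trans mean_gt1 _; rewrite -[leRHS]mulrA; apply: ler_wpM2l; first by lra.
apply: (@le_trans _ _ ((1 - T) * (1 - e))).
  by have : 0 <= T * e by [apply: mulr_ge0]; lra.
by apply: ler_wpM2r; [lra|apply: expR_ge1Dx].
Qed.

Lemma cubic_le (x : R) : 1 <= x <= 20 -> x ^+ 2 + x ^+ 3 / 6 <= 7 / 6 + 92 * (x - 1).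
Proof.
case/andP=> x_ge1 x_le20; have gap : 0 <= (x - 1) * (20 - x) by rewrite mulr_ge0 ?subr_ge0.
have : 0 <= (x - 1) * (20 - x) * x by rewrite mulr_ge0 //; lra.
by rewrite !exprS expr0 mulr1; lra.
Qed.

Lemma threshold_uniform_survival c :
  7 / 6 * (D + 1) ^+ 2 < (D - 92) * ((c - 1) * D - 1) ->
  d.+1%:R^-1 + c * d.+1%:R ^- 2 <= T -> 0 < T /\ uniform_survival d T.
Proof.
move=> c_large T_ge; have dS : d.+1%:R = D + 1 :> R by rewrite -natr1.
have D1_gt0 : 0 < (D + 1) ^+ 2 by rewrite exprn_gt0 //; move: D_gt0; lra.
have DT_ge : ((c - 1) * D - 1) / (D + 1) ^+ 2 <= D * T - 1.
  have -> : ((c - 1) * D - 1) / (D + 1) ^+ 2 = D * (d.+1%:R^-1 + c * d.+1%:R ^- 2) - 1.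
    by rewrite dS; field; rewrite gt_eqF //; move: D_gt0; lra.
  by rewrite lerD2r; apply: ler_wpM2l => //; apply: ltW.
have gap : 7 / 6 < (D - 92) * (D * T - 1).
  apply: (@lt_le_trans _ _ ((D - 92) * (((c - 1) * D - 1) / (D + 1) ^+ 2))).
    by rewrite mulrA ltr_pdivlMr.
  by apply: ler_wpM2l => //; move: D_ge; lra.
have DT_gt1 : 0 < D * T - 1.
  by rewrite -(pmulr_rgt0 _ (_ : 0 < D - 92)); move: D_ge; lra.
have T_gt0 : 0 < T by rewrite -(pmulr_rgt0 T D_gt0); lra.
split=> //; have [large|small] := leP 20 (D * T).
  exact: large_time_uniform_survival.
apply: supercritical_uniform_survival => //; apply: supercritical_of_cubic.
  by apply/andP; split; lra.
by apply: le_lt_trans (cubic_le _) _; [apply/andP; split; lra|lra].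
Qed.

End Threshold.

Lemma threshold_3_uniform_survival (R : realType) (d : nat) (T : R) : (1286 <= d)%N ->
  d.+1%:R^-1 + 3 * d.+1%:R ^- 2 <= T -> 0 < T /\ uniform_survival d T.
Proof.
move=> d_ge; apply: threshold_uniform_survival; first by lia.
have D_ge : 1286 <= d%:R :> R by rewrite (ler_nat _ 1286).
have : 1286 * d%:R <= d%:R * d%:R :> R by apply: ler_wpM2r.
by rewrite expr2; lra.
Qed.

Lemma threshold_eps_uniform_survival (R : realType) (eps : R) : 0 < eps ->
  \forall d \near \oo, forall T : R,
    d.+1%:R^-1 + (13%:R / 6%:R + eps) * d.+1%:R ^- 2 <= T -> 0 < T /\ uniform_survival d T.
Proof.
move=> eps_gt0; apply: filterS2 (nbhs_infty_ge 100) (nbhs_infty_gtr (92 + 111 / eps)) => d.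
move=> d_ge d_gt T; apply: threshold_uniform_survival => //.
have D_ge : 100 <= d%:R :> R by rewrite (ler_nat _ 100).
have gap : 111 < (d%:R - 92) * eps by rewrite -ltr_pdivrMr //; lra.
have : d%:R * 111 < d%:R * ((d%:R - 92) * eps) by rewrite ltr_pM2l //; lra.
by rewrite expr2; lra.
Qed.

(** * From trajectories to discrete paths *)

Section TreeGraph.
Variable d0 : nat.
Implicit Types u v w e : tvert d0.

Lemma tedge_of_child u j : tedge_of u (j :: u) = j :: u.
Proof. by rewrite /tedge_of /= ltnS leqnn. Qed.

Lemma tedge_of_parent u j : tedge_of (j :: u) u = j :: u.
Proof. by rewrite /tedge_of /= ltnNge leqnSn. Qed.

Lemma tadj_sym u w : tadj u w = tadj w u. Proof. by rewrite /tadj orbC. Qed.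

Lemma tadj_child u j : tadj u (j :: u). Proof. by rewrite /tadj /= eqxx. Qed.

Lemma tadjP u w : tadj u w ->
  (exists j, w = j :: u /\ tedge_of u w = w) \/ (exists j, u = j :: w /\ tedge_of u w = u).
Proof.
case/orP=> /andP[].
  by case: w => // j w _ /eqP /= <-; left; exists j; rewrite tedge_of_child.
by case: u => // j u _ /eqP /= <-; right; exists j; rewrite tedge_of_parent.
Qed.

Lemma tedge_of_sym u w : tadj u w -> tedge_of u w = tedge_of w u.
Proof. by case/tadjP=> -[j [-> _]]; rewrite tedge_of_child tedge_of_parent. Qed.

Lemma tincident_tedge_of u w : tadj u w -> tincident u (tedge_of u w).
Proof.
by case/tadjP=> -[j [-> _]];
  rewrite ?tedge_of_child ?tedge_of_parent /tincident /= eqxx ?orbT.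
Qed.

Lemma tincidentP u e : tincident u e -> exists2 w, tadj u w & tedge_of u w = e.
Proof.
case: e => // j e /andP[_ /orP[/eqP <-|/= /eqP ->]].
  by exists e; rewrite ?tedge_of_parent // tadj_sym tadj_child.
by exists (j :: u); rewrite ?tedge_of_child // tadj_child.
Qed.

Lemma tincident_child u j : tincident u (j :: u).
Proof. by rewrite /tincident /= eqxx orbT. Qed.

Lemma tincident_size n u e : (size u < n)%N -> tincident u e -> (0 < size e <= n)%N.
Proof.
by case: e => // j e un /andP[_ /orP[/eqP e_u|/eqP e_u]]; move: un; rewrite -e_u //= => /ltnW.
Qed.

Lemma tadj_size u w : tadj u w -> (size w <= (size u).+1)%N.
Proof. by case/tadjP=> -[j [-> _]] /=; lia. Qed.

Lemma tedge_of_inj u w w' : tadj u w -> tadj u w' -> tedge_of u w = tedge_of u w' -> w = w'.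
Proof.
case/tadjP=> -[j [e ->]]; case/tadjP=> -[j' [e' ->]] //.
- by move=> ew; move: e; rewrite ew => /(congr1 size) /=; lia.
- by move=> ew; move: e'; rewrite -ew => /(congr1 size) /=; lia.
- by move=> _; move: e'; rewrite e => -[].
Qed.

End TreeGraph.

Section Trajectories.
Context {R : realType} (d0 : nat) {dO : measure_display} {Omega : measurableType dO}.
Variables (N : tvert d0 -> Omega -> R -> nat) (om : Omega) (T : R).
Implicit Types (a b s t : R) (u v w x y e : tvert d0).

Definition no_ring_between u a b :=
  forall w, tincident u w -> forall s, a < s -> s < b -> N w om s = N w om a.

Definition no_ring_after u a := forall w, tincident u w -> N w om T = N w om a.

(* The particle that sits at [u] at time [a] ends at [y], and stays below level [n]. *)
Inductive trajectory (n : nat) : R -> tvert d0 -> tvert d0 -> Prop :=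
| trajectory_stay a u : (size u < n)%N -> a <= T -> no_ring_after u a ->
    trajectory n a u u
| trajectory_jump a u v b y : (size u < n)%N -> a < b -> tadj u v ->
    rings_at N (tedge_of u v) om b -> no_ring_between u a b ->
    trajectory n b v y -> trajectory n a u y.

Lemma trajectory_size n a x y : trajectory n a x y -> (size x < n)%N.
Proof. by case. Qed.

Lemma trajectory_le n a x y : trajectory n a x y -> a <= T.
Proof. by elim=> // {}a u v b {}y _ /ltW ab _ _ _ _; apply: le_trans. Qed.

(* [stir_rel N om T x y] is [exists vs ts, jumps 0 x y vs ts]. *)
Definition jumps a x y (vs : seq (tvert d0)) (ts : seq R) :=
  size vs = size ts /\
  last x vs = y /\
  (forall i, (i < size ts)%N -> nth 0 (a :: ts) i < nth 0 (a :: ts) i.+1) /\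
  last a ts <= T /\
  (forall i, (i < size vs)%N ->
     let u := nth x (x :: vs) i in
     let v := nth x (x :: vs) i.+1 in
     let b := nth 0 (a :: ts) i in
     let c := nth 0 (a :: ts) i.+1 in
     tadj u v /\ rings_at N (tedge_of u v) om c /\ no_ring_between u b c) /\
  no_ring_after y (last a ts).

Lemma jumps_nil a x y : jumps a x y [::] [::] <-> [/\ x = y, a <= T & no_ring_after y a].
Proof. by split=> [[_ [? [_ [? [_ ?]]]]]|[? ? ?]]. Qed.

Lemma jumps_cons a x y v vs b ts : jumps a x y (v :: vs) (b :: ts) <->
  [/\ a < b, tadj x v, rings_at N (tedge_of x v) om b, no_ring_between x a b &
      jumps b v y vs ts].
Proof.
split=> [[[szE] [lastE [incr [last_le [steps final]]]]]|
         [ab xv ring quiet [szE [lastE [incr [last_le [steps final]]]]]]].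
  have [xv [ring quiet]] := steps 0%N isT.
  split=> //; first exact: (incr 0%N isT).
  do 2 split=> //; split=> [i|]; first exact: (incr i.+1).
  split=> //; split=> // i ivs; have := steps i.+1 ivs.
  by rewrite /= !(set_nth_default v x) //= ltnS ltnW.
split; first by rewrite /= szE.
split=> //; split; first by case.
split=> //; split=> // -[|i] //= ivs.
by rewrite !(set_nth_default v x) //=; [apply: steps|rewrite ltnS ltnW].
Qed.

Lemma trajectory_jumps n a x y : trajectory n a x y -> exists vs ts, jumps a x y vs ts.
Proof.
elim=> {a x y} [a u _ aT final|a u v b y _ ab uv ring quiet _ [vs [ts IH]]].
  by exists [::], [::]; apply/jumps_nil.
by exists (v :: vs), (b :: ts); apply/jumps_cons.
Qed.

Lemma jumps_trajectory n a x y vs ts :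
  (forall v, v \in (x :: vs : seq (seq _)) -> (size v < n)%N) ->
  jumps a x y vs ts -> trajectory n a x y.
Proof.
elim: vs ts x a => [|v vs IH] [|b ts] x a below; try by case.
  case/jumps_nil=> <- aT final; apply: trajectory_stay => //; exact/below/mem_head.
case/jumps_cons=> ab xv ring quiet tail; apply: (trajectory_jump _ ab xv ring quiet).
  exact/below/mem_head.
by apply: (IH ts) => // w w_vs; apply: below; rewrite in_cons w_vs orbT.
Qed.

Lemma trajectory_stir_rel n x y : trajectory n 0 x y -> stir_rel N om T x y.
Proof. by move=> /trajectory_jumps. Qed.

Lemma stir_rel_trajectory x y : stir_rel N om T x y ->
  exists n0, forall n, (n0 <= n)%N -> trajectory n 0 x y.
Proof.
case=> vs [ts xy]; exists (\max_(v <- x :: vs) size v).+1 => n n0n.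
apply: jumps_trajectory xy => v v_vs; apply: leq_ltn_trans n0n.
exact: (@leq_bigmax_seq _ _ xpredT size).
Qed.

End Trajectories.

Section CellPaths.
Context {R : realType} (d0 : nat) {dO : measure_display} {Omega : measurableType dO}.
Variables (N : tvert d0 -> Omega -> R -> nat) (om : Omega) (T : R) (M : nat).
Definition nondecreasing_clocks :=
  forall e (s t : R), 0 <= s -> s <= t -> (N e om s <= N e om t)%N.

Definition right_continuous_clocks :=
  forall e (t : R), 0 <= t -> exists2 delta : R, 0 < delta &
    forall s : R, t <= s -> s < t + delta -> N e om s = N e om t.

Hypotheses (T_gt0 : 0 < T) (M_gt0 : (0 < M)%N).
Hypotheses (N_mono : nondecreasing_clocks) (N_rcont : right_continuous_clocks).
Implicit Types (a b : R) (u v w x y e : tvert d0) (i j : nat).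

Definition cell_time i : R := i%:R * (T / M%:R).

Let cell_length_gt0 : 0 < T / M%:R. Proof. by rewrite divr_gt0 // ltr0n. Qed.

Lemma cell_time0 : cell_time 0 = 0. Proof. exact: mul0r. Qed.

Lemma cell_time_ge0 i : 0 <= cell_time i. Proof. by rewrite mulr_ge0 // ltW. Qed.

Lemma cell_time_ltS i : cell_time i < cell_time i.+1.
Proof. by rewrite /cell_time ltr_pM2r // ltr_nat. Qed.

Lemma cell_time_le i j : (i <= j)%N -> cell_time i <= cell_time j.
Proof. by move=> ij; rewrite /cell_time ler_pM2r // ler_nat. Qed.

Lemma cell_time_last : cell_time M = T.
Proof. by rewrite /cell_time mulrC divfK // pnatr_eq0 -lt0n. Qed.

Lemma cell_timeS_le i : (i < M)%N -> cell_time i.+1 <= T.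
Proof. by rewrite -cell_time_last; apply: cell_time_le. Qed.

Definition bar e i : bool := (N e om (cell_time i) < N e om (cell_time i.+1))%N.

Lemma no_bar_const e i : ~~ bar e i -> N e om (cell_time i.+1) = N e om (cell_time i).
Proof.
rewrite -leqNgt => no_bar; apply/eqP; rewrite eqn_leq no_bar.
by rewrite N_mono ?cell_time_ge0 // ltW // cell_time_ltS.
Qed.

Lemma no_ring_const e (s t r : R) : 0 <= s -> s <= r -> r <= t -> N e om t = N e om s ->
  N e om r = N e om s.
Proof.
move=> s0 sr rt ts; apply/eqP; rewrite eqn_leq (N_mono _ s0 sr) andbT -ts.
exact: N_mono (le_trans s0 sr) rt.
Qed.

Lemma ring_exists e (s t : R) : 0 <= s -> s <= t -> (N e om s < N e om t)%N ->
  exists b, [/\ s < b, b <= t, (N e om s < N e om b)%N & rings_at N e om b].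
Proof.
move=> s0 st lt_st; pose A := [set r | s <= r /\ (N e om s < N e om r)%N].
have s_lb : lbound A s by move=> r [].
have A_inf : has_inf A by split; [exists t|exists s].
pose b := inf A; have sb : s <= b by apply: lb_le_inf => //; exists t.
have b_le r : A r -> b <= r by move=> Ar; apply: ge_inf => //; exists s.
have [dl dl_gt0 b_const] := N_rcont e (le_trans s0 sb).
have lt_sb : (N e om s < N e om b)%N.
  have [r Ar rb] := inf_adherent dl_gt0 A_inf.
  by rewrite -(b_const r (b_le r Ar) rb); case: Ar.
have sb' : s < b.
  by rewrite lt_neqAle sb andbT; apply: contraTneq lt_sb => ->; rewrite ltnn.
exists b; split=> //; first exact: b_le.
split; first exact: le_lt_trans sb'.
move=> r r0 rb; apply: leq_ltn_trans lt_sb; rewrite leqNgt; apply/negP => lt_sr.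
have [sr|rs] := leP s r; last by move: lt_sr; rewrite ltnNge N_mono // ltW.
by have := b_le r (conj sr lt_sr); rewrite leNgt rb.
Qed.

Definition rings_separated n :=
  (forall e i, (0 < size e <= n)%N -> (i < M)%N ->
    (N e om (cell_time i.+1) <= (N e om (cell_time i)).+1)%N) /\
  (forall e e' i, (0 < size e <= n)%N -> (0 < size e' <= n)%N -> (i < M)%N ->
     bar e i -> bar e' i -> e = e').

Definition cell_step i u w := (w = u /\ forall e, tincident u e -> ~~ bar e i) \/
  (tadj u w /\ bar (tedge_of u w) i).

Fixpoint cell_path (n : nat) (s : seq nat) u y : Prop :=
  if s is i :: s' then exists w, [/\ (size w < n)%N, cell_step i u w & cell_path n s' w y]
  else u = y.

Lemma cell_step_sym i u w : cell_step i u w -> cell_step i w u.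
Proof.
case=> [[-> no_bar]|[uw bar_uw]]; first by left.
by right; rewrite tadj_sym uw -tedge_of_sym.
Qed.

Lemma cell_path_cat n s1 s2 u w y :
  cell_path n s1 u w -> cell_path n s2 w y -> cell_path n (s1 ++ s2) u y.
Proof.
elim: s1 u => [|i s1 IH] u /=; first by move=> ->.
by case=> v [vn step path1] path2; exists v; split=> //; apply: IH.
Qed.

Lemma cell_path_rcons n s i u y : cell_path n (rcons s i) u y ->
  exists2 w, cell_path n s u w & cell_step i w y.
Proof.
elim: s u => [|j s IH] u; first by case=> v [_ step /= <-]; exists u.
by case=> v [vn step /IH [w path_w step_w]]; exists w => //; exists v.
Qed.

Lemma cell_path_rev n s u y : (size u < n)%N -> cell_path n s u y -> cell_path n (rev s) y u.
Proof.
elim: s u => [|i s IH] u un /=; first by move=> ->.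
case=> v [vn step path_v]; rewrite rev_cons -cats1; apply: cell_path_cat (IH _ vn path_v) _.
by exists u; split=> //; apply: cell_step_sym.
Qed.

Lemma cell_path_size n s u y : (size u < n)%N -> cell_path n s u y -> (size y < n)%N.
Proof. by elim: s u => [|i s IH] u un /= => [<-//|[v [vn _]]]; apply: IH. Qed.

Section Separated.
Variable n : nat.
Hypothesis sep : rings_separated n.

Lemma only_bar u e e' i : (i < M)%N -> (size u < n)%N -> tincident u e -> tincident u e' ->
  bar e i -> bar e' i -> e = e'.
Proof. by move=> iM un ue ue'; apply: sep.2 => //; apply: tincident_size un _. Qed.

Lemma cell_step_functional i u w w' : (i < M)%N -> (size u < n)%N ->
  cell_step i u w -> cell_step i u w' -> w = w'.
Proof.
move=> iM un [[-> no_bar]|[uw bar_w]] [[-> no_bar']|[uw' bar_w']] //.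
- by have := no_bar _ (tincident_tedge_of uw'); rewrite bar_w'.
- by have := no_bar' _ (tincident_tedge_of uw); rewrite bar_w.
- apply: (tedge_of_inj uw uw').
  by apply: (only_bar iM un) bar_w bar_w'; apply: tincident_tedge_of.
Qed.

Lemma cell_path_functional s u y y' : all (fun i => (i < M)%N) s -> (size u < n)%N ->
  cell_path n s u y -> cell_path n s u y' -> y = y'.
Proof.
elim: s u => [|i s IH] u /=; first by move=> _ _ -> ->.
move=> /andP[iM sM] un [v [vn step path_v]] [v' [vn' step' path_v']].
rewrite (cell_step_functional iM un step step') in vn path_v.
exact: IH path_v path_v'.
Qed.

Lemma ring_at_most_once u e i a b : (i < M)%N -> (size u < n)%N -> tincident u e ->
  cell_time i <= b -> b <= cell_time i.+1 -> rings_at N e om b ->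
  N e om a = N e om (cell_time i) -> 0 <= a -> a <= b ->
  forall s : R, a <= s -> s < b -> N e om s = N e om a.
Proof.
move=> iM un ue ib bi ring at_a a0 ab s as_ sb; have s0 := le_trans a0 as_.
apply/eqP; rewrite eqn_leq (N_mono _ a0 as_) andbT at_a -ltnS.
apply: leq_trans (sep.1 _ _ (tincident_size un ue) iM).
exact: leq_trans (ring.2 _ s0 sb) (N_mono _ (le_trans s0 (ltW sb)) bi).
Qed.

Lemma no_ring_after_jump i b u v : (i < M)%N -> (size u < n)%N -> (size v < n)%N ->
  tadj u v -> bar (tedge_of u v) i -> cell_time i <= b -> b <= cell_time i.+1 ->
  (N (tedge_of u v) om (cell_time i) < N (tedge_of u v) om b)%N ->
  forall w, tincident v w -> N w om (cell_time i.+1) = N w om b.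
Proof.
move=> iM un vn uv bar_uv ib bi rung w vw; have b0 := le_trans (cell_time_ge0 i) ib.
have ve : tincident v (tedge_of u v) by rewrite tedge_of_sym // tincident_tedge_of // tadj_sym.
have [bar_w|no_bar_w] := boolP (bar w i).
  rewrite (only_bar iM vn vw ve bar_w bar_uv); apply/eqP; rewrite eqn_leq (N_mono _ b0 bi) andbT.
  exact: leq_trans (sep.1 _ _ (tincident_size vn ve) iM) rung.
rewrite (no_bar_const no_bar_w); apply/esym.
by apply: no_ring_const ib bi _; [apply: cell_time_ge0|apply: no_bar_const].
Qed.

Definition quiet i a u :=
  [/\ 0 <= a, a <= cell_time i & forall w, tincident u w -> N w om (cell_time i) = N w om a].

Lemma quietS i a u : quiet i a u ->
  (forall w, tincident u w -> N w om (cell_time i.+1) = N w om a) ->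
  quiet i.+1 a u /\ cell_step i u u.
Proof.
case=> a0 ai at_i at_iS; split; first by split=> //; apply: le_trans ai (ltW (cell_time_ltS i)).
by left; split=> // e ue; rewrite /bar at_i // at_iS // ltnn.
Qed.

Lemma trajectory_cell_path k i a u y : (i + k = M)%N ->
  trajectory N om T n a u y -> quiet i a u -> cell_path n (iota i k) u y.
Proof.
elim: k i a u y => [|k IH] i a u y ik.
  rewrite addn0 in ik; case=> {a u y} // a u v b y _ ab uv [_ ring] _ /trajectory_le bT.
  case=> a0 _ /(_ _ (tincident_tedge_of uv)); rewrite ik cell_time_last => at_T.
  by have := ring a a0 ab; rewrite ltnNge -at_T N_mono // (le_trans a0 (ltW ab)).
have iM : (i < M)%N by rewrite -ik addnS ltnS leq_addr.
have iSk : (i.+1 + k = M)%N by rewrite addSnnS.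
have stay a' u' : trajectory N om T n a' u' y -> quiet i a' u' ->
    (forall w, tincident u' w -> N w om (cell_time i.+1) = N w om a') ->
    cell_path n (i :: iota i.+1 k) u' y.
  move=> traj quiet_u at_iS; have [quiet_S step] := quietS quiet_u at_iS.
  by exists u'; split=> //; [apply: trajectory_size traj|apply: IH traj quiet_S].
move=> traj quiet_u; case: (quiet_u) => a0 ai at_i.
case: traj (traj) stay quiet_u a0 ai at_i => {a u y} [a u _ aT final|
    a u v b y un ab uv ring no_ring traj_v] traj stay quiet_u a0 ai at_i.
  apply: stay traj quiet_u _ => w uw; apply: no_ring_const (final w uw) => //.
    exact: le_trans ai (ltW (cell_time_ltS i)).
  exact: cell_timeS_le.
have [bi|bi] := ltP (cell_time i.+1) b.
  apply: stay traj quiet_u _ => w uw; apply: no_ring => //.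
  exact: le_lt_trans ai (cell_time_ltS i).
have ib : cell_time i < b.
  rewrite ltNge; apply/negP => bi'; have := ring.2 a a0 ab.
  by rewrite ltnNge -(at_i _ (tincident_tedge_of uv)) N_mono // ltW // ring.1.
have rung := ring.2 _ (cell_time_ge0 i) ib.
have bar_uv : bar (tedge_of u v) i.
  by apply: leq_trans rung _; apply: N_mono => //; apply/ltW/ring.1.
have vn := trajectory_size traj_v.
exists v; split=> //; first by right.
apply: IH iSk traj_v _; split=> //; first exact/ltW/ring.1.
exact: no_ring_after_jump (ltW ib) bi rung.
Qed.

Lemma cell_path_trajectory k i a u y : (i + k = M)%N -> cell_path n (iota i k) u y ->
  (size u < n)%N -> quiet i a u -> trajectory N om T n a u y.
Proof.
elim: k i a u => [|k IH] i a u ik /= path un quiet_u; case: (quiet_u) => a0 ai at_i.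
  rewrite addn0 in ik; rewrite -path; apply: trajectory_stay => //.
    by rewrite -cell_time_last -ik.
  by move=> w uw; rewrite -at_i // ik cell_time_last.
have iM : (i < M)%N by rewrite -ik addnS ltnS leq_addr.
have iSk : (i.+1 + k = M)%N by rewrite addSnnS.
case: path => v [vn [[-> no_bar]|[uv bar_uv]] path_v].
  apply: IH iSk path_v un _; case: (quietS quiet_u) => // w uw.
  by rewrite no_bar_const ?at_i // no_bar.
have ue := tincident_tedge_of uv.
have [b [ib bi rung ring]] :=
  ring_exists (cell_time_ge0 i) (ltW (cell_time_ltS i)) bar_uv.
have ab := le_lt_trans ai ib.
apply: (trajectory_jump un ab uv ring) => [w uw s as_ sb|].
  have [bar_w|no_bar_w] := boolP (bar w i).
    rewrite (only_bar iM un uw ue bar_w bar_uv).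
    apply: (ring_at_most_once iM un ue (ltW ib) bi ring _ a0 (ltW ab)) => //.
      by rewrite at_i.
    exact: ltW.
  apply: (@no_ring_const w a (cell_time i.+1)) => //; first exact: ltW.
    exact: le_trans (ltW sb) bi.
  by rewrite no_bar_const ?at_i.
apply: (IH _ _ _ iSk path_v vn); split=> //; first exact: le_trans a0 (ltW ab).
exact: no_ring_after_jump (ltW ib) bi rung.
Qed.

Lemma quiet0 u : quiet 0 0 u.
Proof. by split=> // [|w _]; rewrite cell_time0. Qed.

Lemma trajectory_full_cell_path x y :
  trajectory N om T n 0 x y -> cell_path n (iota 0 M) x y.
Proof. by move=> traj; apply: trajectory_cell_path (add0n M) traj (quiet0 x). Qed.

Lemma cell_path_stir_rel x y :
  (size x < n)%N -> cell_path n (iota 0 M) x y -> stir_rel N om T x y.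
Proof.
move=> xn path; apply: trajectory_stir_rel.
exact: cell_path_trajectory (add0n M) path xn (quiet0 x).
Qed.

End Separated.

End CellPaths.

Lemma suffix_cons_suffix (A : eqType) (a : A) u z : suffix (a :: u) z -> suffix u z.
Proof. by case/suffixP=> s ->; apply/suffixP; exists (rcons s a); rewrite cat_rcons. Qed.

Section ClockTree.
Context {R : realType} (d0 : nat) {dO : measure_display} {Omega : measurableType dO}.
Variables (N : tvert d0 -> Omega -> R -> nat) (om : Omega) (T : R) (M : nat).
Implicit Types (i b : 'I_M) (u w x z e : tvert d0).
Local Notation bar := (bar N om T M).
Local Notation cell_step := (cell_step N om T M).
Local Notation cell_path := (cell_path N om T M).

Fixpoint ring_chain (s : seq nat) (k : nat) u : Prop :=
  match k, s with
  | 0, _ => True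
  | _.+1, [::] => False
  | k'.+1, i :: s' => ring_chain s' k u \/
      exists w, [/\ tadj u w, bar (tedge_of u w) i & ring_chain s' k' w]
  end.

Lemma ring_chain0 s u : ring_chain s 0 u. Proof. by case: s. Qed.

Lemma no_ring_chain_gt0 s k u : ~ ring_chain s k u -> (0 < k)%N.
Proof. by case: k => // /(_ (ring_chain0 s u)). Qed.

Lemma no_ring_chain_cell_path n s k u : ~ ring_chain s k u -> (size u + k <= n)%N ->
  exists y, cell_path n s u y.
Proof.
elim: s k u => [|i s IH] k u no_chain uk; first by exists u.
case: k no_chain uk => [[]//|k] no_chain uk.
have [[e /tincidentP [w uw <-] bar_uw]|no_bar] := pselect (exists2 e, tincident u e & bar e i).
  have no_chain_w : ~ ring_chain s k w by move=> c; apply: no_chain; right; exists w.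
  have k_gt0 := no_ring_chain_gt0 no_chain_w; have w_size := tadj_size uw.
  have [|y path_w] := IH _ _ no_chain_w; first by lia.
  by exists y, w; split=> //; [lia|right].
have [|y path_u] := IH k.+1 u _ uk; first by move=> c; apply: no_chain; left.
exists y, u; split=> //; first by lia.
by left; split=> // e ue; apply/negP => bar_e; apply: no_bar; exists e.
Qed.

Definition clock_bars e : edge_bars M := [ffun i : 'I_M => bar e i].

Fixpoint clock_tree m u : tree_bars M d0.-1 m :=
  match m with
  | 0 => tt
  | m'.+1 => [ffun j => (clock_bars (j :: u), clock_tree m' (j :: u))]
  end.

Definition clock_branch m u : branch M d0.-1 m := (clock_bars u, clock_tree m u).

Lemma clock_treeE m u j : clock_tree m.+1 u j = clock_branch m (j :: u).
Proof. by rewrite ffunE. Qed.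

Definition cyclic_path n L i u z := cell_path n (map val (traject (@ordS M) i L)) u z.

Lemma cyclic_path_cat n L1 L2 i u w z : cyclic_path n L1 i u w ->
  cyclic_path n L2 (iter L1 (@ordS M) i) w z -> cyclic_path n (L1 + L2) i u z.
Proof. by rewrite /cyclic_path trajectD map_cat; apply: cell_path_cat. Qed.

Lemma cyclic_path_last n L i u z : cyclic_path n L.+1 i u z ->
  exists2 w, cyclic_path n L i u w & cell_step (iter L (@ordS M) i) w z.
Proof. by rewrite /cyclic_path trajectSr map_rcons; apply: cell_path_rcons. Qed.

Lemma cyclic_path_step n L i u z : rings_separated N om T M n -> (size u < n)%N ->
  u != [::] \/ (forall i, ~~ bar u i) -> cyclic_path n L.+1 i u z ->
  [\/ [/\ ~~ bar u i, forall j, ~~ bar (j :: u) i & cyclic_path n L (ordS i) u z],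
      bar u i /\ cyclic_path n L (ordS i) (behead u) z |
      exists j, [/\ ~~ bar u i, bar (j :: u) i, forall j', j' != j -> ~~ bar (j' :: u) i,
        (size (j :: u) < n)%N & cyclic_path n L (ordS i) (j :: u) z]].
Proof.
move=> sep un edge_u [w [wn step path]].
have u_tincident : bar u i -> tincident u u.
  by case: edge_u => [u0|no_bar]; [rewrite /tincident u0 eqxx|rewrite (negbTE (no_bar i))].
case: step path wn => [[-> no_bar] path _|[uw bar_uw] path wn].
  constructor 1; split=> // [|j]; last exact/no_bar/tincident_child.
  by apply/negP => bar_u; move: (no_bar u (u_tincident bar_u)); rewrite bar_u.
have only_uw := only_bar sep (ltn_ord i) un (tincident_tedge_of uw) _ bar_uw.
have [[j [ew edge_w]]|[j [eu edge_u']]] := tadjP uw; last first.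
  by constructor 2; split; [rewrite -edge_u'|rewrite eu].
rewrite edge_w in bar_uw only_uw; subst w; constructor 3; exists j; split=> //.
  by apply/negP => bar_u; have /(congr1 size) /= := only_uw _ (u_tincident bar_u) bar_u; lia.
move=> j' j'j; apply/negP => bar_j'.
by have [] := only_uw _ (tincident_child u j') bar_j'; apply/eqP; rewrite eq_sym.
Qed.

(* A path that leaves the subtree of [u] does so for the first time through a bar of
   the edge above [u], unless it stops before, on the pole of [u]. *)
Lemma cyclic_path_exits n L m u z i (B stop : pred 'I_M) :
  rings_separated N om T M n -> (size u + m = n)%N -> (size u < n)%N ->
  (forall i, B i = bar u i || stop i) -> u != [::] \/ (forall i, ~~ bar u i) ->
  cyclic_path n L i u z ->
  ~~ suffix u z \/ (z = u /\ stop (iter L (@ordS M) i)) ->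
  exists b, exits_at (clock_tree m u) B i b /\
    (stop b \/ exists L', [/\ (L' < L)%N, cyclic_path n L' (ordS b) (behead u) z &
      iter L' (@ordS M) (ordS b) = iter L (@ordS M) i]).
Proof.
move=> sep; elim/ltn_ind: L m u i B stop => L IH m u i B stop um un BE edge_u path target.
case: m um => [|m] um; first by rewrite -um addn0 ltnn in un.
have [stop_i|nstop_i] := boolP (stop i).
  by exists i; split; [apply: pole_walk_exit; rewrite BE stop_i orbT|left].
case: L IH path target => [|L] IH path target.
  have uz : u = z := path.
  by case: target => [|[_ /=]]; rewrite ?(negbTE nstop_i) // -uz suffix_refl.
have BEi : B i = bar u i by rewrite BE (negbTE nstop_i) orbF.
have := cyclic_path_step sep un edge_u path; rewrite -BEi.
case=> {path} [[nBi no_bar path]|[Bi path]|[j [nBi bar_j only_j jn path]]].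
- have [|b [out rest]] := IH L (ltnSn L) m.+1 u (ordS i) B stop um un BE edge_u path.
    by rewrite -iterSr.
  exists b; split; first by apply: pole_walk_pass nBi _ out => j; rewrite clock_treeE ffunE.
  case: rest => [|[L' [L'L path' end']]]; [by left|right].
  by exists L'; rewrite iterSr; split=> //; apply: leqW.
- exists i; split; first exact: pole_walk_exit.
  by right; exists L; rewrite iterSr.
have below_z : ~~ suffix (j :: u) z.
  case: target => [|[-> _]]; first by apply: contra; apply: suffix_cons_suffix.
  by apply/negP => /size_suffix /=; lia.
have [||||b1 [out1 [//|[L1 [L1L path1 end1]]]]] := IH L (ltnSn L) m (j :: u) (ordS i)
  (clock_bars (j :: u)) pred0 _ jn _ _ path; [by rewrite /= -um addSnnS| |by left|by left|].
  by move=> i'; rewrite ffunE orbF.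
have [|b [out rest]] := IH L1 (leqW L1L) m.+1 u (ordS b1) B stop um un BE edge_u path1.
  by rewrite end1 -iterSr.
exists b; split.
  apply: (pole_walk_child (w := j) (j := b1)) nBi _ _ _ out; rewrite ?clock_treeE ?ffunE //.
  by move=> j' /only_j; rewrite clock_treeE ffunE.
case: rest => [|[L' [L'L1 path' end']]]; [by left|right].
exists L'; split=> //; first by apply: leqW; apply: ltn_trans L1L.
by rewrite end' end1 -iterSr.
Qed.

(* Implied, for a vertex whose orbit is finite, by the walk along that orbit, which
   ends at time [T], in cell [lst], where it started. *)
Definition may_return m (lst : 'I_M) (y : branch M d0.-1 m.+1) : bool :=
  [|| [exists i, y.1 i], [exists j, (y.2 j).1 lst] |
      exits ((no_bars, y.2) : branch M d0.-1 m.+1) lst].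

Lemma closed_path_may_return n m L x (lst : 'I_M) :
  rings_separated N om T M n -> (size x + m.+1)%N = n ->
  iter L (@ordS M) (ordS lst) = lst -> cyclic_path n L.+1 (ordS lst) x x ->
  may_return lst (clock_branch m.+1 x).
Proof.
move=> sep xm end_lst path; apply/or3P.
have [|/existsPn no_bar] := boolP [exists i, clock_bars x i]; first by constructor 1.
have [|/existsPn no_bar_child] := boolP [exists j, (clock_tree m.+1 x j).1 lst].
  by constructor 2.
constructor 3; apply/asboolP.
have {}no_bar i : ~~ bar x i by have := no_bar i; rewrite ffunE.
have xn : (size x < n)%N by rewrite -xm addnS ltnS leq_addr.
have [w path_w step] := cyclic_path_last path; rewrite end_lst in step.
have {step} ew : w = x.
  case: (cell_step_sym step) => [[]//|[xw]]; case/tadjP: xw => -[j [e ->]] bar_w.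
    by have := no_bar_child j; rewrite clock_treeE ffunE -e bar_w.
  by have := no_bar lst; rewrite bar_w.
rewrite {}ew in path_w.
have [||b [out _]] := @cyclic_path_exits n L m.+1 x x (ordS lst)
  [pred i | no_bars i || (i == lst)] (pred1 lst) sep xm xn _ (or_intror no_bar) path_w.
- by move=> i /=; rewrite ffunE (negbTE (no_bar i)).
- by right; rewrite end_lst /= eqxx.
- by exists b.
Qed.

End ClockTree.

Lemma finite_orbit_periodic (A : eqType) (f : A -> A) x : injective f ->
  finite_set [set iter k f x | k in setT] -> exists k, iter k.+1 f x = x.
Proof.
move=> f_inj /finite_seqP [s sE].
have orbit_s k : iter k f x \in s.
  by suff : [set` s] (iter k f x) by []; rewrite -sE; exists k.
have /trajectP [m ms e] : looping f x (size s).
  apply: contraT; rewrite -looping_uniq => /uniq_leq_size le_s.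
  have := le_s s; rewrite size_traject ltnn; apply.
  by move=> y /trajectP [k _ ->].
have iter_inj k : injective (iter k f) by elim: k => [|k IH] a b //= /f_inj /IH.
exists (size s - m).-1; rewrite prednK ?subn_gt0 //; apply: (iter_inj m).
by rewrite -iterD subnKC // ltnW.
Qed.

Lemma val_traject_ordS M i L : (i + L <= M.+1)%N ->
  map val (traject (@ordS M.+1) (inord i) L) = iota i L.
Proof.
elim: L i => //= L IH i iL; rewrite inordK; last by lia.
have [->//|L_gt0] := posnP L; congr (_ :: _); rewrite -IH; last by lia.
congr (map _ (traject _ _ _)); apply: val_inj.
by rewrite /= !inordK ?modn_small //; lia.
Qed.

Section StirringPermutation.
Context {R : realType} (d0 : nat) {dO : measure_display} {Omega : measurableType dO}.
Variables (N : tvert d0 -> Omega -> R -> nat) (om : Omega) (T : R) (mesh : nat -> nat).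
Hypothesis T_gt0 : 0 < T.
Hypothesis N_mono : nondecreasing_clocks N om.
Hypothesis N_rcont : right_continuous_clocks N om.
Implicit Types (x y : tvert d0) (sigma : tvert d0 -> tvert d0).

Local Notation cells n := (mesh n).+1.

Definition separated_at n := rings_separated N om T (cells n) n.

Definition few_rings_at n k x :=
  ~ ring_chain N om T (cells n) (iota 0 (cells n)) k x /\
  ~ ring_chain N om T (cells n) (rev (iota 0 (cells n))) k x.

Definition separated_io := forall n0, exists2 n, (n0 <= n)%N & separated_at n.

Definition finite_chains x :=
  exists k n, [/\ (size x + k <= n)%N, separated_at n & few_rings_at n k x].

Hypothesis separated : separated_io.
Hypothesis chains : forall x, finite_chains x.

Lemma stir_rel_cell_path x y : stir_rel N om T x y -> exists n0, forall n, (n0 <= n)%N ->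
  separated_at n -> (size x < n)%N /\ cell_path N om T (cells n) n (iota 0 (cells n)) x y.
Proof.
move=> /stir_rel_trajectory [n0 traj]; exists n0 => n /traj {}traj sep.
split; first exact: trajectory_size traj.
exact: trajectory_full_cell_path.
Qed.

Lemma all_iota_lt M : all (fun i => (i < M)%N) (iota 0 M).
Proof. by apply/allP => i; rewrite mem_iota add0n. Qed.

Lemma stir_rel_functional x y y' : stir_rel N om T x y -> stir_rel N om T x y' -> y = y'.
Proof.
move=> /stir_rel_cell_path [n1 path1] /stir_rel_cell_path [n2 path2].
have [n n12 sep] := separated (maxn n1 n2); move: n12; rewrite geq_max => /andP[n1n n2n].
have [xn path] := path1 n n1n sep; have [_ path'] := path2 n n2n sep.
exact: cell_path_functional sep _ _ _ _ (all_iota_lt _) xn path path'.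
Qed.

Lemma stir_rel_injective x x' y : stir_rel N om T x y -> stir_rel N om T x' y -> x = x'.
Proof.
move=> /stir_rel_cell_path [n1 path1] /stir_rel_cell_path [n2 path2].
have [n n12 sep] := separated (maxn n1 n2); move: n12; rewrite geq_max => /andP[n1n n2n].
have [xn path] := path1 n n1n sep; have [x'n path'] := path2 n n2n sep.
apply: cell_path_functional sep _ _ _ _ _ (cell_path_size xn path)
  (cell_path_rev xn path) (cell_path_rev x'n path').
by rewrite all_rev all_iota_lt.
Qed.

Lemma stir_rel_total x : exists y, stir_rel N om T x y.
Proof.
have [k [n [xk sep [no_chain _]]]] := chains x.
have [y path] := no_ring_chain_cell_path no_chain xk; exists y.
apply: (cell_path_stir_rel T_gt0 _ N_mono N_rcont sep) path => //.
by have := no_ring_chain_gt0 no_chain; lia.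
Qed.

Lemma stir_rel_surjective y : exists x, stir_rel N om T x y.
Proof.
have [k [n [yk sep [_ no_chain]]]] := chains y.
have yn : (size y < n)%N by have := no_ring_chain_gt0 no_chain; lia.
have [x path] := no_ring_chain_cell_path no_chain yk; exists x.
apply: (cell_path_stir_rel T_gt0 _ N_mono N_rcont sep) => //.
  exact: cell_path_size yn path.
by have := cell_path_rev yn path; rewrite revK.
Qed.

Lemma stirring_permutation_exists : exists sigma,
  bijective sigma /\ (forall x y, stir_rel N om T x y <-> sigma x = y).
Proof.
have [sigma sigmaP] := choice stir_rel_total; have [tau tauP] := choice stir_rel_surjective.
exists sigma; split.
  exists tau => x; first exact: stir_rel_injective (tauP _) (sigmaP _).
  exact: stir_rel_functional (sigmaP _) (tauP _).
by move=> x y; split=> [xy|<- //]; apply: stir_rel_functional (sigmaP x) xy.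
Qed.

Lemma iter_cyclic_path sigma x k : (forall x y, stir_rel N om T x y <-> sigma x = y) ->
  exists n0, forall n, (n0 <= n)%N -> separated_at n -> (size x < n)%N /\
    cyclic_path N om T n (k * cells n) (ord0 : 'I_(cells n)) x (iter k sigma x).
Proof.
move=> sigmaP; elim: k => [|k [n0 IH]]; first by exists (size x).+1.
have [n1 path1] := stir_rel_cell_path ((sigmaP (iter k sigma x) _).2 erefl).
exists (maxn n0 n1) => n; rewrite geq_max => /andP[n0n n1n] sep.
have [xn path_k] := IH n n0n sep; have [_ path] := path1 n n1n sep.
split=> //; rewrite mulSn addnC; apply: cyclic_path_cat path_k _.
have -> : iter (k * cells n) (@ordS (cells n)) ord0 = ord0.
  by apply: val_inj; rewrite /= val_iter_ordS /= add0n modnMl.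
by rewrite /cyclic_path -[ord0]inord_val val_traject_ordS.
Qed.

Lemma no_infinite_cycle_may_return x : ~ stirring_infinite_cycle N om T ->
  exists n0, forall n, (n0 <= n)%N -> separated_at n ->
    may_return ord_max (clock_branch N om T (cells n) (n - (size x).+1).+1 x).
Proof.
move=> finite_cycles; have [sigma [sigma_bij sigmaP]] := stirring_permutation_exists.
have [k periodic] : exists k, iter k.+1 sigma x = x.
  apply: (@finite_orbit_periodic (seq 'I_d0.-1)); first exact: bij_inj.
  apply: contrapT => infinite_orbit; apply: finite_cycles.
  exists sigma; split=> //; split=> //; exists x => /sub_finite_set finite_cycle.
  by apply: infinite_orbit; apply: finite_cycle => _ [k _ <-]; exists k; left.
have [n0 path] := iter_cyclic_path x k.+1 sigmaP; exists n0 => n /path {}path sep.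
have [xn] := path sep; rewrite periodic => {}path.
apply: (closed_path_may_return (L := k * cells n + mesh n) sep).
- by rewrite -addSnnS subnKC.
- rewrite -iterSr; apply: val_inj; rewrite [LHS]val_iter_ordS /=.
  by rewrite -addnS addnC -mulSnr modnMDl modn_small.
- have -> : ordS ord_max = ord0 :> 'I_(cells n) by apply: val_inj; rewrite /= modnn.
  by move: path; rewrite mulSn addnC addnS.
Qed.

End StirringPermutation.

(** * The law of the bars *)

Section RealProbability.
Context {R : realType} {dO : measure_display} {Omega : measurableType dO}.
Variable P : probability Omega R.
Implicit Types A B E : set Omega.

Definition rprob A : R := fine (P A).

Lemma rprobE A : measurable A -> P A = (rprob A)%:E.
Proof. by move=> mA; rewrite /rprob fineK // fin_num_measure. Qed.

Lemma rprob_ge0 A : 0 <= rprob A.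
Proof. exact: fine_ge0. Qed.

Lemma rprob_set0 : rprob set0 = 0.
Proof. by rewrite /rprob measure0. Qed.

Lemma le_rprob A B : measurable A -> measurable B -> A `<=` B -> rprob A <= rprob B.
Proof. by move=> mA mB AB; rewrite -lee_fin -!rprobE //; apply: le_measure; rewrite ?inE. Qed.

Lemma rprobU_le A B : measurable A -> measurable B -> rprob (A `|` B) <= rprob A + rprob B.
Proof.
move=> mA mB; rewrite -lee_fin EFinD -!rprobE //; last exact: measurableU.
exact: measureU2.
Qed.

Lemma rprobDI A B : measurable A -> measurable B ->
  rprob A = rprob (A `\` B) + rprob (A `&` B).
Proof.
move=> mA mB; apply: EFin_inj; rewrite EFinD -!rprobE; first exact: measureDI.
- exact: measurableI.
- exact: measurableD.
- exact: mA.
Qed.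

Lemma rprob_bigsetU_le (J : Type) (s : seq J) (F : J -> set Omega) :
  (forall j, measurable (F j)) ->
  rprob (\big[setU/set0]_(j <- s) F j) <= \sum_(j <- s) rprob (F j).
Proof.
move=> mF; elim: s => [|j s IH]; first by rewrite !big_nil rprob_set0.
rewrite !big_cons; apply: le_trans (rprobU_le _ _) _ => //; first exact: bigsetU_measurable.
by rewrite lerD2l.
Qed.

Lemma rprob_bigsetU_le_cst (J : eqType) (s : seq J) (F : J -> set Omega) c :
  (forall j, measurable (F j)) -> (forall j, j \in s -> rprob (F j) <= c) ->
  rprob (\big[setU/set0]_(j <- s) F j) <= (size s)%:R * c.
Proof.
move=> mF F_le; apply: le_trans (rprob_bigsetU_le s mF) _; rewrite big_seq.
apply: (@le_trans _ _ (\sum_(j <- s | j \in s) c)); first exact: ler_sum.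
by rewrite -big_seq big_const_seq count_predT iter_addr_0 mulr_natl.
Qed.

Lemma rprob_finType (C : finType) (X : Omega -> C) (w : C -> R) (D : pred C) :
  (forall c, measurable [set om | X om = c]) -> (forall c, rprob [set om | X om = c] = w c) ->
  measurable [set om | D (X om)] /\ rprob [set om | D (X om)] = Pr w D.
Proof.
move=> mX wX; pose F c := [set om | X om = c].
have -> : [set om | D (X om)] = \bigcup_(c in [set` enum D]) F c.
  apply/seteqP; split=> om /=; first by exists (X om) => //=; rewrite mem_enum.
  by case=> c /= + ->; rewrite mem_enum.
split; first by rewrite bigcup_seq; apply: bigsetU_measurable => c *; exact: mX.
rewrite /rprob measure_fin_bigcup //; [|by move=> c d _ _ [om [<- <-]]|by move=> c _; apply: mX].
rewrite -fsbig_seq ?enum_uniq // big_enum /=; under eq_bigr => c _ do rewrite (rprobE (mX c)) wX.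
rewrite sumEFin /= /Pr /expect big_mkcond; apply: eq_bigr => c _.
by rewrite unfold_in; case: (D c); rewrite ?mulr1 ?mulr0.
Qed.

Lemma negligible_of_small_covers E :
  (forall eta : R, 0 < eta -> exists V, [/\ measurable V, E `<=` V & rprob V <= eta]) ->
  P.-negligible E.
Proof.
move=> covers; have small k : exists V,
    [/\ measurable V, E `<=` V & rprob V <= k.+1%:R^-1] by apply: covers; rewrite invr_gt0.
have [V VP] := choice small.
have mV : measurable (\bigcap_k V k) by apply: bigcapT_measurable => k; case: (VP k).
exists (\bigcap_k V k); split=> //; last by move=> om Eom k _; case: (VP k) => _ + _; apply.
rewrite rprobE //; congr EFin; apply/eqP; rewrite eq_le rprob_ge0 andbT.
apply/ler_addgt0Pr => eta eta_gt0; rewrite add0r.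
have [mVk _ Vk_le] := VP (Num.truncn eta^-1).
apply: le_trans (le_rprob mV mVk (bigcap_inf I)) _; apply: le_trans Vk_le _.
by rewrite -[leRHS]invrK lef_pV2 ?posrE ?invr_gt0 // ltW // truncnS_gt.
Qed.

Lemma rprob_liminf_le (U : (set Omega)^nat) eta : (forall n, measurable (U n)) ->
  (\forall n \near \oo, rprob (U n) <= eta) ->
  measurable (\bigcup_m \bigcap_(n in [set n | (m <= n)%N]) U n) /\
  rprob (\bigcup_m \bigcap_(n in [set n | (m <= n)%N]) U n) <= eta.
Proof.
move=> mU [n1 _ U_le]; pose F m := \bigcap_(n in [set n | (m <= n)%N]) U n.
have mF m : measurable (F m) by apply: bigcap_measurable => //; exists m => /=.
have mV : measurable (\bigcup_m F m) by apply: bigcup_measurable.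
split=> //; rewrite -lee_fin -rprobE //.
have F_mono : {homo F : n m / (n <= m)%N >-> (n <= m)%O}.
  by move=> n m nm; apply/subsetPset => om Fn k /= mk; apply: Fn => /=; apply: leq_trans mk.
have cvF := nondecreasing_cvg_mu (mu := P) mF mV F_mono.
rewrite -(cvg_lim _ cvF) //; apply: lime_le; first by apply/cvg_ex; eexists; exact: cvF.
apply: nearW => m /=; rewrite rprobE // lee_fin.
apply: le_trans (U_le (maxn m n1) (leq_maxr _ _)).
by apply: le_rprob => // om Fm; apply: Fm => /=; apply: leq_maxl.
Qed.

Lemma negligible_liminf E :
  (forall eta : R, 0 < eta -> exists U : (set Omega)^nat, [/\ forall n, measurable (U n),
     forall om, E om -> \forall n \near \oo, U n om &
     \forall n \near \oo, rprob (U n) <= eta]) ->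
  P.-negligible E.
Proof.
move=> covers; apply: negligible_of_small_covers => eta /covers [U [mU EU U_le]].
have [mV V_le] := rprob_liminf_le mU U_le.
exists (\bigcup_m \bigcap_(n in [set n | (m <= n)%N]) U n); split=> //.
Qed.

End RealProbability.

Section PoissonClocks.
Context {R : realType} (d0 : nat) {dO : measure_display} {Omega : measurableType dO}.
Variables (P : probability Omega R) (N : tvert d0 -> Omega -> R -> nat) (T : R).
Hypotheses (clocks : poisson_clocks P N) (T_gt0 : 0 < T).
Variable M : nat.
Hypothesis M_gt0 : (0 < M)%N.
Let h := T / M%:R.
Let p := ring_prob h.
Local Notation edge := (seq 'I_d0.-1).
Local Notation cell_time := (cell_time T M).
Local Notation bar_event e i := [set om | bar N om T M e i].
Implicit Types (e u : edge).

Let h_gt0 : 0 < h. Proof. by rewrite divr_gt0 // ltr0n. Qed.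

Lemma poisson_clocks_nondecreasing om : nondecreasing_clocks N om.
Proof. by case: clocks => _ [mono _] e; apply: mono. Qed.

Lemma poisson_clocks_right_continuous om : right_continuous_clocks N om.
Proof. by case: clocks => _ [_ [rcont _]] e; apply: rcont. Qed.

Lemma poisson_clocks_measurable e t : measurable_fun setT (fun om => (N e om t)%:R : R).
Proof. by case: clocks => _ [_ [_ [meas _]]]. Qed.

Lemma cell_time_diff i : cell_time i.+1 - cell_time i = h.
Proof. by rewrite /cell_time -natr1 mulrDl mul1r addrAC subrr add0r. Qed.

Lemma measurable_ring_count_lt e s t k : measurable [set om | (N e om s + k < N e om t)%N].
Proof.
have -> : [set om | (N e om s + k < N e om t)%N] =
    [set om | (N e om s)%:R + k%:R < (N e om t)%:R :> R].
  by apply/seteqP; split=> om /=; rewrite -natrD ltr_nat.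
have meas : measurable_fun setT (fun om => (N e om s)%:R + k%:R < (N e om t)%:R :> R).
  apply: measurable_fun_ltr; last exact: poisson_clocks_measurable.
  by apply: measurable_funD => //; exact: poisson_clocks_measurable.
have := meas measurableT [set true] I; rewrite setTI.
by congr measurable; apply/seteqP; split=> om /=.
Qed.

Lemma measurable_bar e i : measurable (bar_event e i).
Proof.
by have := measurable_ring_count_lt e (cell_time i) (cell_time i.+1) 0; congr measurable;
  apply/seteqP; split=> om /=; rewrite addn0.
Qed.

Lemma measurable_bar_eq e i (b : bool) : measurable [set om | bar N om T M e i = b].
Proof.
case: b; first exact: measurable_bar.
have := measurableC (measurable_bar e i); congr measurable.
by apply/seteqP; split=> om /= => [/negP/negbTE|->].
Qed.

(* A triple [(e, i, b)] tells whether the edge [e] has a bar in cell [i]. *)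
Definition bars_agree (l : seq (edge * nat * bool)) : set Omega :=
  [set om | all (fun t => bar N om T M t.1.1 t.1.2 == t.2) l].

Lemma bars_agree_nil : bars_agree [::] = setT.
Proof. by apply/seteqP. Qed.

Lemma bars_agree_cons t l :
  bars_agree (t :: l) = [set om | bar N om T M t.1.1 t.1.2 = t.2] `&` bars_agree l.
Proof.
apply/seteqP; split=> om; first by move=> /= /andP[/eqP bar_t bars_l].
by move=> [/= bar_t bars_l]; apply/andP; split=> //; apply/eqP.
Qed.

Lemma bars_agree_cat l1 l2 : bars_agree (l1 ++ l2) = bars_agree l1 `&` bars_agree l2.
Proof.
apply/seteqP; split=> om; rewrite /bars_agree /= all_cat; first by move/andP.
by case=> -> ->.
Qed.

Lemma bars_agree_flatten (J : eqType) (s : seq J) (f : J -> seq (edge * nat * bool)) om :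
  bars_agree (flatten (map f s)) om <-> forall j, j \in s -> bars_agree (f j) om.
Proof.
elim: s => [|j s IH] /=; first by split.
rewrite bars_agree_cat; split=> [[fj /IH fs] j'|all_f].
  by rewrite in_cons => /predU1P [->|/fs].
by split; [apply/all_f/mem_head|apply/IH => j' j's; apply: all_f; rewrite in_cons j's orbT].
Qed.

Lemma measurable_bars_agree l : measurable (bars_agree l).
Proof.
elim: l => [|t l IH]; first by rewrite bars_agree_nil.
by rewrite bars_agree_cons; apply: measurableI => //; apply: measurable_bar_eq.
Qed.

Lemma rprob_no_bars (Z : seq (edge * nat)) : uniq Z -> (forall z, z \in Z -> z.1 != [::]) ->
  rprob P (bars_agree [seq (z, false) | z <- Z]) = (1 - p) ^+ size Z.
Proof.
move=> Z_uniq Z_edges; case: clocks => _ [_ [_ [_ law]]].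
pose f (z : edge * nat) : tvert d0 * R * R * nat :=
  (z.1, cell_time z.2, cell_time z.2.+1, 0%N).
have nth_f k : (k < size Z)%N ->
    nth ([::], 0, 0, 0%N) (map f Z) k = f (nth ([::], 0%N) Z k).
  by move=> kZ; rewrite (nth_map ([::] : edge, 0%N)).
have -> : (1 - p) ^+ size Z = \prod_(q <- map f Z) poisson_pmf (q.1.2 - q.1.1.2) q.2.
  rewrite big_map /= (eq_bigr (fun=> 1 - p)) => [|z _].
    by rewrite big_const_seq count_predT iter_mulr_1.
  by rewrite /= cell_time_diff /poisson_pmf h_gt0 expr0 fact0 divr1 mul1r /p /ring_prob; ring.
apply: EFin_inj; rewrite -rprobE; last exact: measurable_bars_agree.
rewrite -prodEFin -law ?size_map.
- congr (P _); apply/seteqP; split=> om /=.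
    move=> /allP no_bars k kZ; rewrite nth_f //=; apply/eqP; rewrite subn_eq0 leqNgt -eqbF_neg.
    by apply: (no_bars (_, false)); apply/map_f/mem_nth.
  move=> no_rings; apply/allP => _ /mapP [z zZ ->] /=.
  have := no_rings (index z Z); rewrite index_mem zZ nth_f ?index_mem // nth_index //=.
  by move=> /(_ isT) /eqP; rewrite subn_eq0 eqbF_neg -leqNgt.
- move=> k kZ; rewrite nth_f //=; split; first exact/Z_edges/mem_nth.
  by split; [apply: cell_time_ge0|apply: cell_time_ltS].
- move=> k l kZ lZ kl; rewrite !nth_f //= => same_edge.
  have : (nth ([::], 0%N) Z k).2 != (nth ([::], 0%N) Z l).2.
    apply/eqP => same_cell; apply/kl/eqP; rewrite -(nth_uniq ([::] : edge, 0%N) kZ lZ Z_uniq).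
    by rewrite [nth _ Z k]surjective_pairing same_edge same_cell -surjective_pairing.
  by rewrite neq_ltn => /orP [lt|lt]; [left|right]; apply: cell_time_le.
Qed.

Lemma rprob_bars_agree_after_no_bars (Z : seq (edge * nat)) l :
  uniq (Z ++ [seq t.1 | t <- l]) -> (forall z, z \in Z -> z.1 != [::]) ->
  (forall t, t \in l -> t.1.1 != [::]) ->
  rprob P (bars_agree ([seq (z, false) | z <- Z] ++ l)) =
  (1 - p) ^+ size Z * \prod_(t <- l) bernoulli_pmf p t.2.
Proof.
elim: l Z => [|[z b] l IH] Z Zl_uniq Z_edges l_edges.
  by rewrite cats0 big_nil mulr1 rprob_no_bars //; rewrite cats0 in Zl_uniq.
have z_edge : z.1 != [::] by apply: (l_edges (z, b)); rewrite mem_head.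
have {}l_edges t : t \in l -> t.1.1 != [::].
  by move=> tl; apply: l_edges; rewrite in_cons tl orbT.
pose prefix := [seq (z', false) | z' <- Z].
have agree_false : rprob P (bars_agree (prefix ++ (z, false) :: l)) =
    (1 - p) ^+ size Z * ((1 - p) * \prod_(t <- l) bernoulli_pmf p t.2).
  have := IH (rcons Z z); rewrite map_rcons !cat_rcons size_rcons exprSr -mulrA; apply=> //.
  by move=> z'; rewrite mem_rcons in_cons => /predU1P [->|/Z_edges].
case: b Zl_uniq => Zl_uniq; last by rewrite agree_false big_cons.
have agree_tail : rprob P (bars_agree (prefix ++ l)) =
    (1 - p) ^+ size Z * \prod_(t <- l) bernoulli_pmf p t.2.
  apply: IH => //; apply: subseq_uniq Zl_uniq.
  by apply: cat_subseq => //; apply: subseq_cons.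
have agreeE b : bars_agree (prefix ++ (z, b) :: l) =
    bars_agree (prefix ++ l) `&` [set om | bar N om T M z.1 z.2 = b].
  by rewrite !bars_agree_cat bars_agree_cons -setIA [X in _ = _ `&` X]setIC.
have := rprobDI P (measurable_bars_agree (prefix ++ l)) (measurable_bar z.1 z.2).
have -> : bars_agree (prefix ++ l) `\` bar_event z.1 z.2 = bars_agree (prefix ++ (z, false) :: l).
  by rewrite agreeE; congr (_ `&` _); apply/seteqP; split=> om /= => [/negP/negbTE|->].
by rewrite -(agreeE true) agree_tail agree_false big_cons /=; lra.
Qed.

Lemma rprob_bars_agree l : uniq [seq t.1 | t <- l] -> (forall t, t \in l -> t.1.1 != [::]) ->
  rprob P (bars_agree l) = \prod_(t <- l) bernoulli_pmf p t.2.
Proof.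
by move=> l_uniq l_edges; rewrite -[bars_agree l]/(bars_agree ([::] ++ l))
  (@rprob_bars_agree_after_no_bars [::]) ?mul1r.
Qed.

End PoissonClocks.

Lemma uniq_flatten_map (J A : eqType) (s : seq J) (f : J -> seq A) : uniq s ->
  (forall j, uniq (f j)) -> (forall j j' a, a \in f j -> a \in f j' -> j = j') ->
  uniq (flatten (map f s)).
Proof.
move=> s_uniq f_uniq f_disj; elim: s s_uniq => //= j s IH /andP[js /IH {}IH].
rewrite cat_uniq f_uniq IH andbT /=; apply/hasPn => a /flattenP [_ /mapP [j' j's ->] aj'].
by apply: contra js => aj; rewrite (f_disj j j' a aj aj').
Qed.

Lemma suffix_same_size (A : eqType) (v v' e : seq A) :
  suffix v e -> suffix v' e -> size v = size v' -> v = v'.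
Proof.
move=> ve v'e vv'; move: ve v'e; rewrite !suffixE vv' => /eqP ve /eqP v'e.
exact: etrans (esym ve) v'e.
Qed.

Section BranchLaw.
Context {R : realType} (d0 : nat) {dO : measure_display} {Omega : measurableType dO}.
Variables (P : probability Omega R) (N : tvert d0 -> Omega -> R -> nat) (T : R).
Hypotheses (clocks : poisson_clocks P N) (T_gt0 : 0 < T).
Variable M : nat.
Hypothesis M_gt0 : (0 < M)%N.
Let p := ring_prob (T / M%:R).
Local Notation edge := (seq 'I_d0.-1).
Local Notation tree_bars := (tree_bars M d0.-1).
Local Notation branch := (branch M d0.-1).
Local Notation bars_agree := (bars_agree N T M).
Local Notation keys l := [seq t.1 | t <- l].
Implicit Types (u e : edge) (t : edge * nat * bool).

Definition edge_pattern u (b : edge_bars M) : seq (edge * nat * bool) :=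
  [seq (u, val i, b i) | i <- enum 'I_M].

Fixpoint tree_pattern m u : tree_bars m -> seq (edge * nat * bool) :=
  match m with
  | 0 => fun=> [::]
  | m'.+1 => fun c : tree_bars m'.+1 =>
      flatten [seq edge_pattern (j :: u) (c j).1 ++ tree_pattern (j :: u) (c j).2
              | j <- enum 'I_d0.-1]
  end.

Definition branch_pattern m u (y : branch m) := edge_pattern u y.1 ++ tree_pattern u y.2.

Lemma bars_agree_edge u b om : bars_agree (edge_pattern u b) om <-> clock_bars N om T M u = b.
Proof.
rewrite /bars_agree /= all_map; split.
  move=> /allP /= agree; apply/ffunP => i; rewrite ffunE.
  by have := agree i; rewrite mem_enum => /(_ isT) /eqP.
by move=> <-; apply/allP => i _ /=; rewrite ffunE.
Qed.

Lemma bars_agree_tree m u (c : tree_bars m) om :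
  bars_agree (tree_pattern u c) om <-> clock_tree N om T M m u = c.
Proof.
elim: m u c => [|m IH] u c /=; first by split=> // _; case: c.
rewrite bars_agree_flatten; split=> [agree|<- j _].
  apply/ffunP => j; rewrite ffunE; have := agree j; rewrite mem_enum => /(_ isT).
  by rewrite bars_agree_cat => -[/bars_agree_edge -> /IH ->]; case: (c j).
by rewrite ffunE bars_agree_cat; split; [apply/bars_agree_edge|apply/IH].
Qed.

Lemma bars_agree_branch m u (y : branch m) om :
  bars_agree (branch_pattern u y) om <-> clock_branch N om T M m u = y.
Proof.
rewrite /branch_pattern bars_agree_cat; split=> [[]|<-].
  move=> /bars_agree_edge eq_edge /bars_agree_tree eq_tree.
  by rewrite [y]surjective_pairing -eq_edge -eq_tree.
by split; [apply/bars_agree_edge|apply/bars_agree_tree].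
Qed.

Lemma prod_edge_pattern u b :
  \prod_(t <- edge_pattern u b) bernoulli_pmf p t.2 = bits_distr p b.
Proof. by rewrite /edge_pattern big_map /= big_enum. Qed.

Lemma prod_tree_pattern m u (c : tree_bars m) :
  \prod_(t <- tree_pattern u c) bernoulli_pmf p t.2 = tree_distr p c.
Proof.
elim: m u c => [|m IH] u c /=; first by rewrite big_nil.
rewrite big_flatten /= big_map big_enum /=; apply: eq_bigr => j _.
by rewrite big_cat prod_edge_pattern IH.
Qed.

Lemma prod_branch_pattern m u (y : branch m) :
  \prod_(t <- branch_pattern u y) bernoulli_pmf p t.2 = branch_distr p y.
Proof. by rewrite big_cat prod_edge_pattern prod_tree_pattern. Qed.

Lemma edge_pattern_edge u b t : t \in edge_pattern u b -> t.1.1 = u.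
Proof. by case/mapP=> i _ ->. Qed.

Lemma tree_pattern_edge m u (c : tree_bars m) t :
  t \in tree_pattern u c -> suffix u t.1.1 /\ (size u < size t.1.1)%N.
Proof.
elim: m u c => [|m IH] u c //= /flattenP [l /mapP [j _ ->]]; rewrite mem_cat => /orP [].
  by move=> /edge_pattern_edge ->; split=> //; apply: suffix_cons_suffix (suffix_refl _).
by move=> /IH [ju_t ju_lt]; split; [apply: suffix_cons_suffix ju_t|apply: ltn_trans ju_lt].
Qed.

Lemma branch_pattern_edge m u (y : branch m) t : t \in branch_pattern u y -> suffix u t.1.1.
Proof.
rewrite mem_cat => /orP [/edge_pattern_edge ->|/tree_pattern_edge []//].
exact: suffix_refl.
Qed.

Lemma edge_pattern_uniq u b : uniq (keys (edge_pattern u b)).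
Proof.
rewrite /edge_pattern -map_comp map_inj_in_uniq ?enum_uniq // => i j _ _ [].
exact: val_inj.
Qed.

Lemma branch_pattern_uniq_of_tree m u (y : branch m) :
  uniq (keys (tree_pattern u y.2)) -> uniq (keys (branch_pattern u y)).
Proof.
move=> tree_uniq; rewrite /branch_pattern map_cat cat_uniq edge_pattern_uniq tree_uniq andbT /=.
apply/hasPn => k /mapP [t /tree_pattern_edge [_ ut] ->].
apply/negP => /mapP [t' /edge_pattern_edge t'u tt'].
by move: ut; rewrite tt' t'u ltnn.
Qed.

Lemma tree_pattern_uniq m u (c : tree_bars m) : uniq (keys (tree_pattern u c)).
Proof.
elim: m u c => [|m IH] u c //=; rewrite map_flatten -map_comp; apply: uniq_flatten_map.
- exact: enum_uniq.
- by move=> j /=; apply: (branch_pattern_uniq_of_tree (y := c j)); apply: IH.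
- move=> j j' a /mapP [t /(branch_pattern_edge (y := c j)) ju ->].
  move=> /mapP [t' /(branch_pattern_edge (y := c j')) j'u tt'].
  by rewrite tt' in ju; case: (suffix_same_size ju j'u erefl).
Qed.

Lemma branch_pattern_uniq m u (y : branch m) : uniq (keys (branch_pattern u y)).
Proof. exact/branch_pattern_uniq_of_tree/tree_pattern_uniq. Qed.

Lemma clock_branches_law (I : finType) (v : I -> edge) (L m : nat) :
  injective v -> (forall i, size (v i) = L.+1) -> forall c : {ffun I -> branch m},
  measurable [set om | [ffun i => clock_branch N om T M m (v i)] = c] /\
  rprob P [set om | [ffun i => clock_branch N om T M m (v i)] = c] =
    ffun_distr (@branch_distr R M d0.-1 p m) c.
Proof.
move=> v_inj v_size c; pose l := flatten [seq branch_pattern (v i) (c i) | i <- enum I].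
have -> : [set om | [ffun i => clock_branch N om T M m (v i)] = c] = bars_agree l.
  apply/seteqP; split=> om; rewrite /l.
    by move=> /= <-; apply/bars_agree_flatten => i _; rewrite ffunE; apply/bars_agree_branch.
  move/bars_agree_flatten => agree; apply/ffunP => i; rewrite ffunE; apply/bars_agree_branch.
  by apply: agree; rewrite mem_enum.
split; first exact: (measurable_bars_agree T clocks).
rewrite (rprob_bars_agree clocks T_gt0 M_gt0).
- rewrite /l big_flatten /= big_map big_enum /=; apply: eq_bigr => i _.
  exact: prod_branch_pattern.
- rewrite /l map_flatten -map_comp; apply: uniq_flatten_map => [|i|i i' a].
  + exact: enum_uniq.
  + exact: branch_pattern_uniq.
  + move=> /mapP [t /branch_pattern_edge vi ->] /mapP [t' /branch_pattern_edge vi' tt'].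
    by rewrite tt' in vi; apply: v_inj; apply: (suffix_same_size vi vi'); rewrite !v_size.
- move=> t /flattenP [_ /mapP [i _ ->]] /branch_pattern_edge vt; apply: contraTneq vt => ->.
  by rewrite suffixs0; apply/eqP => v0; have := v_size i; rewrite v0.
Qed.

End BranchLaw.

Section Discretization.
Context {R : realType} (d0 : nat) {dO : measure_display} {Omega : measurableType dO}.
Variables (P : probability Omega R) (N : tvert d0 -> Omega -> R -> nat) (T : R).
Hypotheses (clocks : poisson_clocks P N) (T_gt0 : 0 < T).
Variable M : nat.
Hypothesis M_gt0 : (0 < M)%N.
Let h := T / M%:R.
Let p := ring_prob h.
Local Notation d := d0.-1.
Local Notation edge := (seq 'I_d).
Local Notation cell_time := (cell_time T M).
Local Notation bar_event e i := [set om | bar N om T M e i].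
Local Notation bars_agree := (bars_agree N T M).
Local Notation all_bars Z := (bars_agree [seq (z, true) | z <- Z]).
Implicit Types (e u : edge) (Z : seq (edge * nat)).

Let h_gt0 : 0 < h. Proof. by rewrite divr_gt0 // ltr0n. Qed.
Let MR_gt0 : 0 < M%:R :> R. Proof. by rewrite ltr0n. Qed.
Let p_le : p <= h. Proof. exact: ring_prob_le. Qed.
Let p_ge0 : 0 <= p. Proof. by case/andP: (ring_prob_ge0_le1 (ltW h_gt0)). Qed.

Lemma rprob_all_bars Z : uniq Z -> (forall z, z \in Z -> z.1 != [::]) ->
  rprob P (all_bars Z) = p ^+ size Z.
Proof.
move=> Z_uniq Z_edges; rewrite (rprob_bars_agree clocks T_gt0 M_gt0).
- by rewrite big_map /= big_const_seq count_predT iter_mulr_1.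
- by rewrite -map_comp map_id.
- by move=> t /mapP [z zZ ->]; apply: Z_edges.
Qed.

Lemma rprob_bar e i : e != [::] -> rprob P (bar_event e i) = p.
Proof.
move=> e0; have := @rprob_all_bars [:: (e, i)] isT.
rewrite expr1 => <-; last by move=> z; rewrite inE => /eqP ->.
by congr rprob; apply/seteqP; split=> om; rewrite /bars_agree /= andbT eqb_id.
Qed.

Lemma rprob_two_bars e e' i : e != [::] -> e' != [::] -> e != e' ->
  rprob P (bar_event e i `&` bar_event e' i) = p ^+ 2.
Proof.
move=> e0 e0' ee'; have := @rprob_all_bars [:: (e, i); (e', i)].
rewrite /= inE andbT xpair_eqE negb_and ee' /= => <- //; last first.
  by move=> z; rewrite !inE => /orP [] /eqP ->.
by congr rprob; apply/seteqP; split=> om; rewrite /bars_agree /= andbT !eqb_id => /andP.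
Qed.

Definition two_rings e i : set Omega :=
  [set om | (N e om (cell_time i) + 1 < N e om (cell_time i.+1))%N].

Lemma measurable_two_rings e i : measurable (two_rings e i).
Proof. exact: (measurable_ring_count_lt clocks). Qed.

Lemma rprob_one_ring e i : e != [::] ->
  rprob P (bar_event e i `\` two_rings e i) = h * expR (- h).
Proof.
move=> e0; case: (clocks) => _ [_ [_ [_ law]]].
have := law [:: (e, cell_time i, cell_time i.+1, 1%N)].
rewrite big_seq1 /= cell_time_diff /poisson_pmf h_gt0 expr1 divr1 => {}law.
apply: EFin_inj; rewrite -rprobE; last first.
  by apply: measurableD; [apply: (measurable_bar T clocks)|apply: measurable_two_rings].
rewrite -law.
- congr (P _); apply/seteqP; split=> om /=.
    move=> [bar_e not_two] [|//] _ /=; apply/eqP; rewrite eqn_leq subn_gt0 andbC.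
    by apply/andP; split; [exact: bar_e|rewrite leq_subLR leqNgt; apply/negP].
  move=> /(_ 0%N isT) /= one; split; first by rewrite /bar -subn_gt0 one.
  by apply/negP; rewrite -leqNgt -leq_subLR one.
- by case=> //= _; split=> //; split; [apply: cell_time_ge0|apply: cell_time_ltS].
- by case=> [|//] [].
Qed.

Lemma rprob_two_rings_le e i : e != [::] -> rprob P (two_rings e i) <= h ^+ 2.
Proof.
move=> e0; have := rprobDI P (measurable_bar T clocks M e i) (measurable_two_rings e i).
rewrite rprob_bar // rprob_one_ring //.
have -> : bar_event e i `&` two_rings e i = two_rings e i.
  apply/setIidPr => om two; rewrite /= /bar; apply: leq_ltn_trans two; exact: leq_addr.
rewrite /p /ring_prob; have := ler_wpM2l (ltW h_gt0) (expR_ge1Dx (- h)).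
by have := expR_ge1Dx (- h); rewrite expr2; lra.
Qed.

Definition edges_upto n : seq edge :=
  flatten [seq [seq val w | w : k.+1.-tuple 'I_d] | k <- iota 0 n].

Lemma mem_edges_upto n e : (e \in edges_upto n) = (0 < size e <= n)%N.
Proof.
apply/flattenP/idP => [[_ /mapP [k + ->] /mapP [w _ ->]]|/andP[e0 en]].
  by rewrite mem_iota size_tuple.
exists [seq val w | w : (size e).-1.+1.-tuple 'I_d].
  by apply/mapP; exists (size e).-1; rewrite ?mem_iota ?prednK.
have e_size : size e == (size e).-1.+1 by rewrite prednK.
by apply/mapP; exists (Tuple e_size); rewrite ?mem_enum.
Qed.

Lemma edges_upto_neq0 n e : e \in edges_upto n -> e != [::].
Proof. by rewrite mem_edges_upto; case: e. Qed.

Definition two_bars (ee : edge * edge) i : set Omega :=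
  if ee.1 == ee.2 then set0 else bar_event ee.1 i `&` bar_event ee.2 i.

Lemma measurable_two_bars ee i : measurable (two_bars ee i).
Proof.
by rewrite /two_bars; case: ifP => // _; apply: measurableI; apply: (measurable_bar T clocks).
Qed.

Definition collision n : set Omega :=
  (\big[setU/set0]_(ei <- [seq (e, i) | e <- edges_upto n, i <- iota 0 M])
     two_rings ei.1 ei.2) `|`
  (\big[setU/set0]_(ei <-
      [seq (ee, i) | ee <- [seq (e, e') | e <- edges_upto n, e' <- edges_upto n], i <- iota 0 M])
     two_bars ei.1 ei.2).

Lemma measurable_collision n : measurable (collision n).
Proof.
apply: measurableU; apply: bigsetU_measurable => ei _; first exact: measurable_two_rings.
exact: measurable_two_bars.
Qed.

Lemma not_separated_collision n om : ~ rings_separated N om T M n -> collision n om.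
Proof.
move=> not_sep; apply: contrapT => no_collision; apply: not_sep.
split=> [e i en iM|e e' i en e'n iM bar_e bar_e'].
  rewrite leqNgt; apply/negP => two; apply: no_collision; left; rewrite -bigcup_seq.
  exists (e : edge, i); last by rewrite /two_rings /= addn1.
  by apply/allpairsP; exists (e : edge, i); rewrite mem_edges_upto en mem_iota iM.
apply/eqP/negPn/negP => ee'; apply: no_collision; right; rewrite -bigcup_seq.
exists (e : edge, e' : edge, i); last by rewrite /two_bars /= (negbTE ee').
apply/allpairsP; exists (e : edge, e' : edge, i); rewrite mem_iota iM; split=> //=.
by apply/allpairsP; exists (e : edge, e' : edge); rewrite !mem_edges_upto en e'n.
Qed.

Lemma rprob_collision_le n : rprob P (collision n) <=
  (size (edges_upto n) + size (edges_upto n) ^ 2)%:R * T ^+ 2 / M%:R.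
Proof.
set E := size (edges_upto n).
have -> : (E + E ^ 2)%:R * T ^+ 2 / M%:R = (E * M)%:R * h ^+ 2 + (E * E * M)%:R * h ^+ 2 :> R.
  by rewrite /h natrD natrX !natrM; field; rewrite gt_eqF.
apply: le_trans (rprobU_le _ _ _) _.
- by apply: bigsetU_measurable => ei _; apply: measurable_two_rings.
- by apply: bigsetU_measurable => ei _; apply: measurable_two_bars.
apply: lerD.
  apply: le_trans (rprob_bigsetU_le_cst _ (c := h ^+ 2) _) _.
  - by move=> ei; apply: measurable_two_rings.
  - move=> ei /allpairsP [[e i] /= [he _ ->]]; apply: rprob_two_rings_le.
    exact: edges_upto_neq0 he.
  - by rewrite size_allpairs size_iota.
apply: le_trans (rprob_bigsetU_le_cst _ (c := h ^+ 2) _) _.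
- by move=> ei; apply: measurable_two_bars.
- move=> _ /allpairsP [[ee i] /= [/allpairsP [[e e'] /= [he he' ->]] _ ->]] /=.
  rewrite /two_bars /=; case: eqVneq => [_|ee']; first by rewrite rprob_set0 sqr_ge0.
  rewrite rprob_two_bars ?(edges_upto_neq0 he) ?(edges_upto_neq0 he') //.
  by apply: lerXn2r; rewrite ?nnegrE // ltW.
- by rewrite !size_allpairs size_iota.
Qed.

Definition neighbours u : seq edge :=
  [seq w <- behead u :: [seq j :: u | j <- enum 'I_d] | tadj u w].

Lemma mem_neighbours u w : (w \in neighbours u) = tadj u w.
Proof.
rewrite mem_filter; apply: andb_idr => uw; case/tadjP: uw => -[j [e _]].
  by rewrite in_cons e (map_f (fun j => j :: u)) ?orbT // mem_enum.
by rewrite in_cons e eqxx.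
Qed.

Lemma size_neighbours u : (size (neighbours u) <= d.+1)%N.
Proof.
by apply: leq_trans (size_subseq (filter_subseq _ _)) _; rewrite /= size_map size_enum_ord.
Qed.

Fixpoint chain_event (s : seq nat) (k : nat) u : set Omega :=
  match k, s with
  | 0, _ => setT
  | _.+1, [::] => set0
  | k'.+1, i :: s' => chain_event s' k u `|`
      \big[setU/set0]_(w <- neighbours u) (bar_event (tedge_of u w) i `&` chain_event s' k' w)
  end.

Lemma measurable_chain_event s k u : measurable (chain_event s k u).
Proof.
elim: s k u => [|i s IH] [|k] u //=; apply: measurableU; first exact: IH.
by apply: bigsetU_measurable => w _; apply: measurableI => //; apply: (measurable_bar T clocks).
Qed.

Lemma ring_chain_event s k u om : ring_chain N om T M s k u -> chain_event s k u om.
Proof.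
elim: s k u => [|i s IH] [|k] u //= [/IH|[w [uw bar_w /IH chain_w]]]; first by left.
by right; rewrite -bigcup_seq; exists (w : edge); rewrite //= mem_neighbours.
Qed.

Lemma all_bars_cons z Z : all_bars (z :: Z) = bar_event z.1 z.2 `&` all_bars Z.
Proof. exact: bars_agree_cons. Qed.

Lemma rprob_bars_chain_le s k u Z : uniq s -> uniq Z ->
  (forall z, z \in Z -> z.1 != [::] /\ z.2 \notin s) ->
  rprob P (all_bars Z `&` chain_event s k u) <=
  p ^+ size Z * ('C(size s, k)%:R * (d.+1%:R * p) ^+ k).
Proof.
have mZ Z' : measurable (all_bars Z') := measurable_bars_agree T clocks M _.
have mZI Z' s' k' u' : measurable (all_bars Z' `&` chain_event s' k' u').
  exact: measurableI (mZ Z') (measurable_chain_event s' k' u').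
elim: s k u Z => [|i s IH] [|k] u Z s_uniq Z_uniq Z_edges.
- by rewrite /= setIT bin0 expr0 !mulr1 rprob_all_bars // => z /Z_edges [].
- by rewrite /= setI0 rprob_set0 bin0n mul0r mulr0.
- by rewrite /= setIT bin0 expr0 !mulr1 rprob_all_bars // => z /Z_edges [].
case/andP: s_uniq => i_s s_uniq.
have {}Z_edges z : z \in Z -> [/\ z.1 != [::], z.2 != i & z.2 \notin s].
  by move=> /Z_edges [-> ]; rewrite in_cons negb_or => /andP[].
have IHZ : rprob P (all_bars Z `&` chain_event s k.+1 u) <=
    p ^+ size Z * ('C(size s, k.+1)%:R * (d.+1%:R * p) ^+ k.+1).
  by apply: IH => // z /Z_edges [].
rewrite /= setIUr binS natrD mulrDl mulrDr; apply: le_trans (rprobU_le _ _ _) (lerD IHZ _) => //.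
  apply: measurableI (mZ Z) _; apply: bigsetU_measurable => w _; apply: measurableI.
    exact: (measurable_bar T clocks).
  exact: measurable_chain_event.
rewrite big_distrr /=; pose b := p ^+ (size Z).+1 * ('C(size s, k)%:R * (d.+1%:R * p) ^+ k).
have mZbar w : measurable (all_bars Z `&` (bar_event (tedge_of u w) i `&` chain_event s k w)).
  by apply: measurableI (mZ Z) (measurableI _ _ (measurable_bar T clocks _ _ _) _);
    apply: measurable_chain_event.
apply: le_trans (rprob_bigsetU_le_cst (c := b) mZbar _) _ => [w|].
  rewrite mem_neighbours => uw; have /andP[e0 _] := tincident_tedge_of uw.
  rewrite setIA [_ `&` bar_event _ _]setIC -(all_bars_cons (_, _)).
  apply: (IH k w ((tedge_of u w, i) :: Z)) => //=.
    by rewrite Z_uniq andbT; apply/negP => /Z_edges []; rewrite eqxx.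
  by move=> z; rewrite in_cons => /predU1P [->|/Z_edges []].
apply: (@le_trans _ _ (d.+1%:R * b)).
  apply: ler_wpM2r; last by rewrite ler_nat size_neighbours.
  by rewrite !mulr_ge0 ?exprn_ge0 // mulr_ge0.
by rewrite /b !exprS; lra.
Qed.

Lemma ffact_le_exp n k : (n ^_ k <= n ^ k)%N.
Proof. by elim: k n => // k IH n; rewrite ffactnSr expnSr leq_mul // leq_subr. Qed.

Lemma rprob_chain_event_le s k u : uniq s -> size s = M ->
  rprob P (chain_event s k u) <= exp_coeff (d.+1%:R * T) k.
Proof.
move=> s_uniq s_size; have := @rprob_bars_chain_le s k u [::] s_uniq isT.
rewrite /= expr0 mul1r bars_agree_nil setTI => bound; apply: le_trans (bound _) _ => //.
rewrite /exp_coeff /= ler_pdivlMr ?ltr0n ?fact_gt0 // mulrAC -natrM bin_ffact s_size.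
have dp_ge0 : 0 <= d.+1%:R * p by rewrite mulr_ge0.
apply: (@le_trans _ _ ((M ^ k)%:R * (d.+1%:R * h) ^+ k)).
  apply: ler_pM; rewrite ?exprn_ge0 ?ler_nat ?ffact_le_exp //.
  by apply: lerXn2r; rewrite ?nnegrE ?ler_wpM2l // mulr_ge0 // ltW.
have -> : d.+1%:R * T = M%:R * (d.+1%:R * h) by rewrite /h; field; rewrite gt_eqF.
by rewrite natrX -exprMn.
Qed.

End Discretization.

(** * Almost sure existence of an infinite cycle *)

Section MayReturnProbability.
Variables (R : realType) (d0 M m : nat) (T s0 : R) (lst : 'I_M).
Hypothesis T_gt0 : 0 < T.
Local Notation d := d0.-1.
Let p := ring_prob (T / M%:R).
Local Notation tree_law := (@tree_distr R M d p).

Let M_gt0 : (0 < M)%N. Proof. exact: leq_ltn_trans (ltn_ord lst). Qed.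

Let p01 : 0 <= p <= 1.
Proof. by apply: ring_prob_ge0_le1; rewrite divr_ge0 // ltW. Qed.

Lemma Pr_child_bar_le :
  Pr (@tree_law m.+1) (fun c => [exists j, (c j).1 lst]) <= d%:R * (T / M%:R).
Proof.
have tree_lawP := tree_is_distr M d p01 m.+1.
apply: le_trans (Pr_exists_le tree_lawP _) _; rewrite (eq_bigr (fun=> p)) => [|j _].
  by rewrite sumr_const card_ord -[leLHS]mulr_natl ler_wpM2l // ring_prob_le.
rewrite -[RHS](Pr_bit p01 lst) -(Pr_edge d p01 m (fun b => b lst)) /Pr.
exact: (expect_coord (branch_is_distr M d p01 m) j (fun y => (y.1 lst)%:R)).
Qed.

Lemma Pr_may_return_le : d%:R * (T / M%:R) <= s0 / 2 ->
  s0 <= Pr (@tree_law m.+1) (fun c => survives c lst) ->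
  Pr (@branch_distr R M d p m.+1) (may_return (d0 := d0) lst) <= 1 - expR (- T) * (s0 / 2).
Proof.
move=> cell_small survival.
pose child_bar (c : tree_bars M d m.+1) := [exists j, (c j).1 lst].
pose good c := ~~ child_bar c && survives c lst.
have tree_lawP := tree_is_distr M d p01 m.+1.
rewrite lerBrDr -lerBrDl -(PrC (branch_is_distr M d p01 m.+1)).
have exists_bar (b : edge_bars M) : [exists i, b i] = has b (enum 'I_M).
  by apply/existsP/hasP => [[i bi]|[i _ bi]]; exists i; rewrite ?mem_enum.
have -> : Pr (@branch_distr R M d p m.+1) (predC (may_return (d0 := d0) lst)) =
    Pr (bits_distr p) (fun b : edge_bars M => ~~ has b (enum 'I_M)) * Pr (@tree_law m.+1) good.
  rewrite -Pr_pair; apply: eq_Pr => y; rewrite -[predC _ y]/(~~ may_return lst y).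
  by rewrite /may_return exists_bar 2!negb_or.
rewrite (Pr_none p01 (enum_uniq 'I_M)) size_enum_ord ring_probC_exp.
have -> : M%:R * (T / M%:R) = T by rewrite mulrC divfK // pnatr_eq0 -lt0n.
apply: ler_wpM2l; first exact: expR_ge0.
have good_or_child_bar : Pr (@tree_law m.+1) (fun c => survives c lst) <=
    Pr (@tree_law m.+1) good + Pr (@tree_law m.+1) child_bar.
  by apply: (Pr_or_le tree_lawP) => c surv; rewrite /good surv andbT; case: (child_bar c).
by have := Pr_child_bar_le; rewrite -/child_bar; lra.
Qed.

End MayReturnProbability.

Section AlmostSure.
Context {R : realType} (d0 : nat) {dO : measure_display} {Omega : measurableType dO}.
Variables (P : probability Omega R) (N : tvert d0 -> Omega -> R -> nat) (T : R).
Hypotheses (clocks : poisson_clocks P N) (T_gt0 : 0 < T) (d_gt1 : (1 < d0.-1)%N).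
Local Notation d := d0.-1.
Implicit Types (x : tvert d0) (om : Omega).

Definition all_may_return M (lst : 'I_M) L m : set Omega :=
  [set om | [forall v : L.+1.-tuple 'I_d,
    may_return lst (clock_branch N om T M m.+1 (tval v))]].

Lemma all_may_return_le M (lst : 'I_M) L m r : r <= 1 ->
  Pr (@branch_distr R M d (ring_prob (T / M%:R)) m.+1) (may_return (d0 := d0) lst) <= r ->
  measurable (all_may_return lst L m) /\ rprob P (all_may_return lst L m) <= r ^+ L.+1.
Proof.
move=> r_le1 Pr_le; set p := ring_prob _ in Pr_le.
have M_gt0 : (0 < M)%N by apply: leq_ltn_trans (ltn_ord lst).
have p01 : 0 <= p <= 1 by apply: ring_prob_ge0_le1; rewrite divr_ge0 // ltW.
pose X om := [ffun v : L.+1.-tuple 'I_d => clock_branch N om T M m.+1 (tval v)].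
pose D (c : {ffun L.+1.-tuple 'I_d -> branch M d m.+1}) := [forall v, may_return lst (c v)].
have law := clock_branches_law clocks T_gt0 M_gt0 (m := m.+1) val_inj (@size_tuple L.+1 'I_d).
have [mD rD] := rprob_finType D (fun c => (law c).1) (fun c => (law c).2).
have -> : all_may_return lst L m = [set om | D (X om)].
  by apply/seteqP; split=> om /= /forallP H; apply/forallP => v; move: (H v); rewrite ffunE.
split; first exact: mD.
rewrite rD /D (Pr_forall _ (fun=> may_return lst)) prodr_const card_tuple card_ord.
have Pr_ge := Pr_ge0 (branch_is_distr M d p01 m.+1) (may_return (d0 := d0) lst).
have r_ge0 := le_trans Pr_ge Pr_le.
apply: (@le_trans _ _ (r ^+ (d ^ L.+1))); first by apply: lerXn2r.
by apply: ler_wiXn2l => //; apply/ltnW/ltn_expl.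
Qed.

Definition fine_cells s0 n M :=
  [/\ forall m (i : 'I_M),
        s0 <= Pr (@tree_distr R M d (ring_prob (T / M%:R)) m) (fun c => survives c i),
      d%:R * (T / M%:R) <= s0 / 2 & rprob P (collision N T M n) <= n.+1%:R^-1].

Section Mesh.
Variables (s0 : R) (mesh : nat -> nat).
Hypothesis s0_gt0 : 0 < s0.
Local Notation cells n := (mesh n).+1.
Hypothesis fine : forall n, fine_cells s0 n (cells n).

Let measurable_collision n : measurable (collision N T (cells n) n).
Proof. exact: measurable_collision clocks _ _. Qed.

Let collision_small (eta : R) : 0 < eta ->
  \forall n \near \oo, rprob P (collision N T (cells n) n) <= eta.
Proof.
move=> eta_gt0; apply: filterS (near_infty_natSinv_lt (PosNum eta_gt0)) => n /ltW.
by apply: le_trans; case: (fine n).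
Qed.

Lemma negligible_not_separated_io : P.-negligible [set om | ~ separated_io N om T mesh].
Proof.
apply: negligible_liminf => eta eta_gt0; exists (fun n => collision N T (cells n) n).
split=> //; last exact: collision_small.
move=> om /existsNP [n0 not_sep]; exists n0 => // n n0n; apply: not_separated_collision => sep.
by apply: not_sep; exists n.
Qed.

Lemma negligible_infinite_chains x : P.-negligible [set om | ~ finite_chains N om T mesh x].
Proof.
apply: negligible_liminf => eta eta_gt0; have eta3_gt0 : 0 < eta / 3 by rewrite divr_gt0.
have [k _ /(_ k (leqnn k)) coeff_le] :=
  cvgr_le 0 (@cvg_exp_coeff R (d.+1%:R * T)) _ eta3_gt0.
pose cell_list n := iota 0 (cells n).
pose chain n s := chain_event N T (cells n) s k x.
have mchain n s : measurable (chain n s).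
  exact: (measurable_chain_event T clocks (cells n) s k x).
exists (fun n => collision N T (cells n) n `|`
  (chain n (cell_list n) `|` chain n (rev (cell_list n)))); split.
- by move=> n; apply: measurableU => //; apply: measurableU.
- move=> om many_chains; exists (size x + k)%N => // n xkn; apply: contrapT => nU.
  apply: many_chains; exists k, n; split=> //.
    by apply: contrapT => /not_separated_collision collide; apply: nU; left.
  by split=> /ring_chain_event c; apply: nU; right; [left|right].
- apply: filterS (collision_small eta3_gt0) => n coll.
  have chain_le (s : seq nat) : uniq s -> size s = cells n -> rprob P (chain n s) <= eta / 3.
    move=> s_uniq s_size; apply: le_trans coeff_le.
    exact: (rprob_chain_event_le clocks T_gt0 (ltn0Sn (mesh n)) k x s_uniq s_size).
  have fwd := chain_le (cell_list n) (iota_uniq _ _) (size_iota _ _).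
  have bwd : rprob P (chain n (rev (cell_list n))) <= eta / 3.
    by apply: chain_le; rewrite ?rev_uniq ?iota_uniq // size_rev size_iota.
  apply: le_trans (rprobU_le P _ _) _; [by []|exact: measurableU|].
  by have := rprobU_le P (mchain n (cell_list n)) (mchain n (rev (cell_list n))); lra.
Qed.

Lemma negligible_infinite_chains_somewhere :
  P.-negligible [set om | ~ forall x, finite_chains N om T mesh x].
Proof.
pose F k := if unpickle k is Some x
  then [set om | ~ finite_chains N om T mesh (x : seq 'I_d)] else set0.
apply: (@negligibleS _ _ _ _ (\bigcup_k F k)).
  move=> om /existsNP [x infinite_x]; exists (pickle (x : seq 'I_d)) => //.
  by rewrite /F pickleK.
apply: negligible_bigcup => k; rewrite /F; case: unpickle => [x|].
  exact: negligible_infinite_chains.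
exact: negligible_set0.
Qed.

Lemma no_infinite_cycle_all_may_return L om :
  separated_io N om T mesh -> (forall x, finite_chains N om T mesh x) ->
  ~ stirring_infinite_cycle N om T ->
  \forall n \near \oo, separated_at N om T mesh n ->
    all_may_return (ord_max : 'I_(cells n)) L (n - L.+2) om.
Proof.
move=> sep chains no_cycle.
have /choice [n0 n0P] (v : L.+1.-tuple 'I_d) : exists n0, forall n, (n0 <= n)%N ->
    separated_at N om T mesh n ->
    may_return ord_max (clock_branch N om T (cells n) (n - L.+2).+1 (tval v)).
  have [n0 n0P] := no_infinite_cycle_may_return T_gt0 (poisson_clocks_nondecreasing clocks om)
    (poisson_clocks_right_continuous clocks om) sep chains (tval v) no_cycle.
  by exists n0 => n n0n sep_n; have := n0P n n0n sep_n; rewrite size_tuple.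
exists (\max_v n0 v)%N => // n n0n sep_n; apply/forallP => v.
by apply: n0P sep_n; apply: leq_trans n0n; apply: leq_bigmax.
Qed.

Lemma negligible_no_infinite_cycle : P.-negligible [set om |
  [/\ separated_io N om T mesh, forall x, finite_chains N om T mesh x &
      ~ stirring_infinite_cycle N om T]].
Proof.
pose r := 1 - expR (- T) * (s0 / 2).
have Pr_le n m : Pr (@branch_distr R (cells n) d (ring_prob (T / (cells n)%:R)) m.+1)
    (may_return (d0 := d0) ord_max) <= r.
  by have [survival cell_small _] := fine n; apply: Pr_may_return_le.
have r_lt1 : r < 1 by rewrite /r ltrBlDr ltrDl mulr_gt0 ?expR_gt0 ?divr_gt0.
have r_ge0 : 0 <= r.
  apply: le_trans (Pr_le 0%N 0%N); apply/Pr_ge0/branch_is_distr/ring_prob_ge0_le1.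
  by rewrite divr_ge0 // ltW.
apply: negligible_liminf => eta eta_gt0; have eta2_gt0 : 0 < eta / 2 by rewrite divr_gt0.
have [L _ /(_ L.+1 (leqnSn L)) rL] : \forall L \near \oo, r ^+ L <= eta / 2.
  by apply: (cvgr_le 0) => //; apply: cvg_expr; rewrite ger0_norm.
pose trapped n := all_may_return (ord_max : 'I_(cells n)) L (n - L.+2).
have trapped_le n := all_may_return_le L (ltW r_lt1) (Pr_le n (n - L.+2)%N).
exists (fun n => collision N T (cells n) n `|` trapped n); split.
- by move=> n; apply: measurableU => //; case: (trapped_le n).
- move=> om [sep chains no_cycle].
  apply: filterS (no_infinite_cycle_all_may_return L sep chains no_cycle) => n trapped_n.
  have [/trapped_n|/not_separated_collision] := pselect (separated_at N om T mesh n).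
    by right.
  by left.
- apply: filterS (collision_small eta2_gt0) => n coll; have [mtrapped trapped_n] := trapped_le n.
  by apply: le_trans (rprobU_le P _ _) _ => //; lra.
Qed.

Lemma mesh_infinite_cycle_ae : {ae P, forall om, stirring_infinite_cycle N om T}.
Proof.
apply: (negligibleS _ (negligibleU negligible_not_separated_io
  (negligibleU negligible_infinite_chains_somewhere negligible_no_infinite_cycle))).
move=> om /= no_cycle.
have [sep|] := pselect (separated_io N om T mesh); last by left.
have [chains|] := pselect (forall x, finite_chains N om T mesh x); last by right; left.
by right; right.
Qed.

End Mesh.

Lemma fine_mesh_exists (s0 : R) : 0 < s0 -> (\forall M \near \oo, forall m (i : 'I_M.+1),
    s0 <= Pr (@tree_distr R M.+1 d (ring_prob (T / M.+1%:R)) m) (fun c => survives c i)) ->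
  exists mesh : nat -> nat, forall n, fine_cells s0 n (mesh n).+1.
Proof.
move=> s0_gt0 survival.
suff /choice [mesh fine] : forall n, exists M, fine_cells s0 n M.+1 by exists mesh.
move=> n; pose K := (size (edges_upto d0 n) + size (edges_upto d0 n) ^ 2)%:R * T ^+ 2.
have le_S M (a : R) : a <= M%:R -> a <= M.+1%:R by move/le_trans; apply; rewrite ler_nat.
suff [M _ /(_ M (leqnn M)) fine] : \forall M \near \oo, fine_cells s0 n M.+1 by exists M.
apply: filterS3 survival (nbhs_infty_ger (2 * (d%:R * T) / s0)) (nbhs_infty_ger (n.+1%:R * K)).
move=> M surv /le_S cell_small /le_S collision_small; split=> //.
  by move: cell_small; rewrite [d%:R * (T / _)]mulrA !ler_pdivrMr ?ltr0n //; lra.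
apply: le_trans (rprob_collision_le clocks T_gt0 (ltn0Sn M) n) _.
by rewrite -/K ler_pdivrMr ?ltr0n // mulrC ler_pdivlMr ?ltr0n // mulrC.
Qed.

Lemma uniform_survival_infinite_cycle_ae : uniform_survival d T ->
  {ae P, forall om, stirring_infinite_cycle N om T}.
Proof.
by case=> s0 s0_gt0 /(fine_mesh_exists s0_gt0) [mesh]; apply: mesh_infinite_cycle_ae.
Qed.

End AlmostSure.

Lemma uniform_survival_in_scrT (R : realType) (d : nat) (T : R) : (1 < d)%N ->
  0 < T /\ uniform_survival d T -> in_scrT d.+1 T.
Proof.
move=> d_gt1 [T_gt0 survival]; split=> // dO Omega P N clocks.
exact: uniform_survival_infinite_cycle_ae.
Qed.

Theorem theorem4 (R : realType) :
  (forall d0 : nat, (2 <= d0)%N -> (1287 <= d0)%N ->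
     forall T : R, d0%:R^-1 + 3 * d0%:R^-2 <= T -> in_scrT d0 T) /\
  (forall eps : R, 0 < eps -> exists d0' : nat,
     forall d0 : nat, (2 <= d0)%N -> (d0' <= d0)%N ->
     forall T : R, d0%:R^-1 + (13%:R / 6%:R + eps) * d0%:R^-2 <= T ->
       in_scrT d0 T).
Proof.
split=> [[|d] // _ d_ge T T_ge|eps eps_gt0].
  apply: uniform_survival_in_scrT; first by lia.
  exact: threshold_3_uniform_survival T_ge.
have [d1 _ threshold] := threshold_eps_uniform_survival eps_gt0.
exists (maxn 3 d1.+1) => -[|d] // _; rewrite geq_max => /andP[d_gt1 d1d] T T_ge.
by apply: uniform_survival_in_scrT => //; apply: threshold.
Qed.
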